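(* There exist absolute constants $c,C>0$ such that the following holds. Let $A\in\mathbb{R}^{m\times n}$ have rank $\rho$ and singular values $\sigma_1\ge\sigma_2\ge\cdots$, let $0<\epsilon<1/6$, $0<\delta<1$, and let $k\le l\le \min(m,n)$ be positive integers with $l\ge 10\,\epsilon^{-1}(\sqrt{k}+\sqrt{8\log(n/\delta)})^2\log(k/\delta)$ and $l\ge\log(n/\delta)\log(\rho/\delta)$. Let $V_1\in\mathbb{R}^{n\times l}$ be such that $V_1^T$ is drawn from the SRHT ensemble, and let $Q_1$ and $R_{22}$ be obtained from the randomized QR factorization of $A$ with sketch $V_1$ (see context). Then: (i) for a particular $1\le j\le\min(m,n)-k$, with probability at least $1-2\delta$, $$\|R_{22}-(R_{22})_{\mathrm{opt},j-1}\|_F^2\le(1+C\epsilon)\,\|A-A_{\mathrm{opt},k+j-1}\|_F^2;$$ (ii) for a particular $1\le j\le\min(m,n)-k$, with probability at least $1-3\delta$, $$\sigma_j^2(R_{22})\le C\,\sigma_{k+j}^2+C\,\frac{\log(\rho/\delta)}{l}\,\|A-A_{\mathrm{opt},k+j-1}\|_F^2;$$ (iii) with probability at least $1-2\max(\delta,e^{-k/5})$, for $1\le j\le k$, $$\sigma_j(A)\ \ge\ \sigma_j(Q_1Q_1^TA)\ \ge\ c\sqrt{\frac{k}{n}}\;\sigma_j(A);$$ (iv) with probability at least $1-\delta$, for $1\le j\le k$ (with $\sigma_j\ne0$), $$\sigma_j(A)\ \ge\ \sigma_j(Q_1Q_1^TA)\ \ge\ \frac{\sigma_j}{1+C\sqrt{\frac{n}{k}}\;\frac{\sigma_{k+1}}{\sigma_j}}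 .$$
   Context: Singular values are in decreasing order (and are $0$ beyond the matrix dimensions); $X_{\mathrm{opt},r}$ is the rank-$r$ truncated SVD of $X$. SRHT ensemble: the subsampled randomized Hadamard transform embedding $\mathbb{R}^n$ into $\mathbb{R}^s$ is the random $s\times n$ matrix $\sqrt{n/s}\,PHD$, where $P$ is the $s\times n$ matrix selecting $s$ rows (chosen uniformly at random without replacement), $H$ is the $n\times n$ normalized (orthogonal) Hadamard matrix, and $D$ is an $n\times n$ diagonal matrix of independent uniformly random signs, independent of $P$; $n$ is a power of $2$. Randomized QR factorization: write $V_1=V_1'R_{11}'$ (thin QR), complete $V_1'$ to an $n\times n$ orthogonal matrix $V'=(V_1'\ V_2')$, and put $V=(V_1\ V_2')$. Let $AV=QR$ with $Q\in\mathbb{R}^{m\times m}$ orthogonal and $R\in\mathbb{R}^{m\times n}$ upper triangular; $Q_1=Q[:,:l]$ is the first $l$ columns of $Q$ and $R_{22}$ is the trailing $(m-l)\times(n-l)$ block of $R$. *)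

(* Defs.v *)
From HB Require Import structures.
From mathcomp Require Import all_boot all_order all_algebra.
From mathcomp Require Import all_classical all_reals all_analysis ring.

Set Implicit Arguments.
Unset Strict Implicit.
Unset Printing Implicit Defensive.
Import Order.TTheory GRing.Theory Num.Theory.
Import numFieldNormedType.Exports.
Local Open Scope classical_set_scope.
Local Open Scope ring_scope.

Section SingularValues.
Context {R : realType}.

Definition orthomx n (Q : 'M[R]_n) : Prop := Q^T *m Q = 1%:M.

Definition rdiag_mx m n (s : nat -> R) : 'M[R]_(m, n) :=
  \matrix_(i, j) (s i *+ (i == j :> nat)).

(* Full SVD [X = U S V^T]; the sequence [s] is indexed from 0 and extended by
   zeros beyond the dimensions of [X]. *)
Definition is_svd m n (X : 'M[R]_(m, n))
    (U : 'M[R]_m) (s : nat -> R) (V : 'M[R]_n) : Prop :=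
  [/\ orthomx U, orthomx V,
      (forall i, 0 <= s i.+1 <= s i),
      (forall i, (minn m n <= i)%N -> s i = 0)
    & X = U *m rdiag_mx m n s *m V^T].

Definition sqn n (v : 'cV[R]_n) : R := (v^T *m v) 0 0.

Lemma sqnE n (v : 'cV[R]_n) : sqn v = \sum_i v i 0 ^+ 2.
Proof.
by rewrite /sqn mxE; apply: eq_bigr => i _; rewrite mxE expr2.
Qed.

Lemma sqn_ge0 n (v : 'cV[R]_n) : 0 <= sqn v.
Proof. by rewrite sqnE; apply: sumr_ge0 => i _; exact: sqr_ge0. Qed.

Lemma sqn_eq0 n (v : 'cV[R]_n) : sqn v = 0 -> v = 0.
Proof.
rewrite sqnE => /eqP; rewrite psumr_eq0 => [|i _]; last exact: sqr_ge0.
move=> /allP h; apply/colP => i; rewrite mxE.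
by have := h i (mem_index_enum _); rewrite sqrf_eq0 => /eqP.
Qed.

Lemma sqnZ n a (v : 'cV[R]_n) : sqn (a *: v) = a ^+ 2 * sqn v.
Proof.
rewrite !sqnE mulr_sumr; apply: eq_bigr => i _.
by rewrite mxE exprMn.
Qed.

Lemma sqn_ortho n (Q : 'M[R]_n) (v : 'cV[R]_n) :
  orthomx Q -> sqn (Q *m v) = sqn v.
Proof.
by move=> hQ; rewrite /sqn trmx_mul mulmxA -(mulmxA v^T) hQ mulmx1.
Qed.

Lemma sqn_block m n (a : 'cV[R]_m) (b : 'cV[R]_n) :
  sqn (col_mx a b) = sqn a + sqn b.
Proof. by rewrite /sqn tr_col_mx mul_row_col mxE. Qed.

Lemma orthomxT n (Q : 'M[R]_n) : orthomx Q -> orthomx Q^T.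
Proof. by move=> h; rewrite /orthomx trmxK; apply: mulmx1C. Qed.

Lemma orthomxM n (P Q : 'M[R]_n) : orthomx P -> orthomx Q -> orthomx (P *m Q).
Proof.
move=> hP hQ.
by rewrite /orthomx trmx_mul mulmxA -(mulmxA Q^T) hP mulmx1 hQ.
Qed.

Lemma orthomx1 n : orthomx (1%:M : 'M[R]_n).
Proof. by rewrite /orthomx trmx1 mulmx1. Qed.

Lemma orthomx_block n (Q : 'M[R]_n) :
  orthomx Q -> orthomx (block_mx (1%:M : 'M[R]_1) 0 0 Q).
Proof.
move=> hQ; rewrite /orthomx tr_block_mx !trmx0 trmx1 mulmx_block.
by rewrite !mulmx0 !mul0mx !mulmx1 hQ addr0 !add0r -scalar_mx_block.
Qed.

(* Householder reflection exchanging [u] and the first basis vector *)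
Lemma householder n (u : 'cV[R]_(1 + n)) : sqn u = 1 ->
  exists2 Q : 'M[R]_(1 + n), orthomx Q & Q *m delta_mx 0 0 = u.
Proof.
move=> hu; pose e : 'cV[R]_(1 + n) := delta_mx 0 0.
have he : sqn e = 1.
  rewrite sqnE (bigD1 0) //= big1 ?addr0; first by rewrite mxE !eqxx expr1n.
  by move=> i /negPf hi; rewrite mxE hi /= expr0n.
have [->|hue] := eqVneq u e; first by exists 1%:M; [exact: orthomx1|rewrite mul1mx].
pose w := e - u.
have hw0 : sqn w != 0.
  apply/eqP => /sqn_eq0 /eqP; rewrite subr_eq0 eq_sym; exact/negP.
pose c := 2%:R / sqn w.
pose Q : 'M[R]_(1 + n) := 1%:M - c *: (w *m w^T).
have hww : w *m w^T *m (w *m w^T) = sqn w *: (w *m w^T).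
  rewrite -mulmxA (mulmxA w^T) [w^T *m w]mx11_scalar -/(sqn w).
  by rewrite mul_scalar_mx -scalemxAr.
exists Q.
  have hQT : Q^T = Q.
    by rewrite /Q linearB /= linearZ /= trmx_mul trmxK trmx1.
  rewrite /orthomx hQT /Q mulmxBl mul1mx mulmxBr mulmx1 -!scalemxAl -!scalemxAr.
  rewrite hww !scalerA.
  have -> : c * c * sqn w = c + c.
    by rewrite -mulrA /c mulfVK // mulr_natr mulr2n.
  by rewrite scalerDl opprB addrK subrK.
have hwT : w^T = e^T - u^T by apply/matrixP => i j; rewrite !mxE.
have hx : (w^T *m e) 0 0 = sqn w / 2%:R.
  have h1 : (u^T *m e) 0 0 = (e^T *m u) 0 0.
    by rewrite [LHS]mxE [RHS]mxE; apply: eq_bigr => j _; rewrite !mxE mulrC.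
  have mB (A B : 'M[R]_1) : (A - B) 0 0 = A 0 0 - B 0 0 by rewrite [LHS]mxE [X in _ + X]mxE.
  have h2 : sqn w = (1 - (u^T *m e) 0 0) * 2%:R.
    rewrite /sqn hwT mulmxBl /w !mulmxBr !mB -h1.
    by rewrite -[(e^T *m e) 0 0]/(sqn e) -[(u^T *m u) 0 0]/(sqn u) he hu; ring.
  by rewrite h2 mulfK ?pnatr_eq0 // hwT mulmxBl mB -[(e^T *m e) 0 0]/(sqn e) he.
rewrite -/e /Q mulmxBl mul1mx -scalemxAl -mulmxA [w^T *m e]mx11_scalar hx.
rewrite mul_mx_scalar scalerA /c mulrA mulfVK // divff ?pnatr_eq0 // scale1r.
by rewrite /w opprB addrC subrK.
Qed.


Lemma sqn_max m n (X : 'M[R]_(m, 1 + n)) :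
  exists2 v : 'cV[R]_(1 + n), sqn v = 1 &
    forall w : 'cV[R]_(1 + n), sqn w = 1 -> sqn (X *m w) <= sqn (X *m v).
Proof.
pose g (p : nat) (Y : 'M[R]_(p, 1 + n)) (v : 'rV[R]_(1 + n)) := sqn (Y *m v^T).
have cg p (Y : 'M[R]_(p, 1 + n)) : continuous (g p Y).
  have -> : g p Y = (fun v => \sum_i (\sum_j Y i j * v 0 j) ^+ 2).
    apply/funext => z; rewrite /g sqnE; apply: eq_bigr => i _.
    by rewrite mxE; congr (_ ^+ 2); apply: eq_bigr => j _; rewrite mxE.
  apply: (@continuous_big R _ +%R 0 xpredT) => [|i _]; first exact: add_continuous.
  have cM (f f' : 'rV[R]_(1 + n) -> R) :
    continuous f -> continuous f' -> continuous (fun v => f v * f' v).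
    by move=> cf cf' v; apply: continuousM; [exact: cf|exact: cf'].
  have h : continuous (fun v : 'rV[R]_(1 + n) => \sum_j Y i j * v 0 j).
    apply: (@continuous_big R _ +%R 0 xpredT) => [|j _]; first exact: add_continuous.
    apply: cM; last exact: coord_continuous.
    by move=> v; exact: cst_continuous.
  exact: cM.
pose S := [set v : 'rV[R]_(1 + n) | g _ 1%:M v = 1].
have Scl : closed S.
  have -> : S = g _ 1%:M @^-1` [set 1] by [].
  by apply: preimage_closed => // v _; exact: cg.
have Sco : compact S.
  pose B := [set v : 'rV[R]_(1 + n) | forall i, v ord0 i \in `[(-1 : R), 1]].
  apply: (@subclosed_compact _ S B) => //.
    apply: (@rV_compact _ _ (fun=> `[(-1 : R), 1]%classic)) => _.
    exact: segment_compact.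
  move=> v; rewrite /S /g /= mul1mx sqnE => hv i.
  rewrite in_itv /= -ler_norml -(@ler_pXn2r _ 2) ?nnegrE // expr1n.
  rewrite -normrX ger0_norm ?sqr_ge0 // -hv (bigD1 i) //= mxE lerDl.
  by apply: sumr_ge0 => j _; exact: sqr_ge0.
have Sn0 : S !=set0.
  exists (delta_mx 0 0); rewrite /S /g /= mul1mx sqnE (bigD1 0) //= big1.
    by rewrite !mxE !eqxx expr1n addr0.
  by move=> i /negPf hi; rewrite !mxE hi /= expr0n.
have [|v vS hmax] := @EVT_max_rV R _ (g _ X) S Sn0 Sco.
  exact/continuous_subspaceT/cg.
exists v^T; first by move: vS; rewrite inE /S /g /= mul1mx.
move=> w hw; have := hmax w^T; rewrite /g trmxK; apply.
by rewrite inE /S /g /= mul1mx trmxK.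
Qed.

Lemma sqn_delta n (i : 'I_n) : sqn (delta_mx i 0 : 'cV[R]_n) = 1.
Proof.
rewrite sqnE (bigD1 i) //= big1 ?addr0; first by rewrite mxE !eqxx expr1n.
by move=> k /negPf hk; rewrite mxE hk /= expr0n.
Qed.

Lemma svd0 m n : is_svd (0 : 'M[R]_(m, n)) 1%:M (fun=> 0) 1%:M.
Proof.
split=> //; try exact: orthomx1; first by move=> i; rewrite lexx.
have -> : rdiag_mx m n (fun=> 0) = 0 :> 'M[R]_(m, n).
  by apply/matrixP => i j; rewrite !mxE mul0rn.
by rewrite mulmx0 mul0mx.
Qed.

Lemma svd_exists m n (X : 'M[R]_(m, n)) :
  exists p : 'M[R]_m * (nat -> R) * 'M[R]_n, is_svd X p.1.1 p.1.2 p.2.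
Proof.
elim: m n X => [n X|m IHm [X|n]].
- exists (1%:M, fun=> 0, 1%:M); have -> : X = 0 by apply/matrixP => -[].
  exact: svd0.
- exists (1%:M, fun=> 0, 1%:M); have -> : X = 0 by apply/matrixP => i [].
  exact: svd0.
rewrite -[m.+1]/(1 + m)%N -[n.+1]/(1 + n)%N => X.
have [v hv hmax] := sqn_max X; set a := sqn (X *m v) in hmax.
have hX w : sqn (X *m w) <= a * sqn w.
  have [w0|w0] := eqVneq (sqn w) 0.
    by rewrite (sqn_eq0 w0) mulmx0 /sqn !mulmx0 mxE mulr0.
  have wp : 0 < sqn w by rewrite lt_neqAle eq_sym w0 sqn_ge0.
  have := hmax ((Num.sqrt (sqn w))^-1 *: w).
  rewrite sqnZ exprVn sqr_sqrtr ?sqn_ge0 // mulVf // => /(_ erefl).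
  rewrite -scalemxAr sqnZ exprVn sqr_sqrtr ?sqn_ge0 //.
  by rewrite mulrC ler_pdivrMr.
have [a0|a0] := eqVneq a 0.
  exists (1%:M, fun=> 0, 1%:M); suff -> : X = 0 by exact: svd0.
  apply/matrixP => i j; have /sqn_eq0 : sqn (X *m delta_mx j 0) = 0.
    by apply/eqP; rewrite eq_le sqn_ge0 andbT (le_trans (hX _)) // a0 mul0r.
  by rewrite -colE => /colP/(_ i); rewrite !mxE.
have ap : 0 < a by rewrite lt_neqAle eq_sym a0 sqn_ge0.
pose sg := Num.sqrt a.
have sgp : 0 < sg by rewrite sqrtr_gt0.
have sg2 : sg ^+ 2 = a by rewrite sqr_sqrtr // ltW.
have [|Q hQ Qe] := @householder m (sg^-1 *: (X *m v)).
  by rewrite sqnZ exprVn sg2 mulVf.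
have [P hP Pe] := householder hv.
pose B := Q^T *m X *m P.
have XB : X = Q *m B *m P^T.
  rewrite /B !mulmxA (mulmx1C hQ) mul1mx -mulmxA.
  by rewrite (mulmx1C hP) mulmx1.
have hB y : sqn (B *m y) <= a * sqn y.
  rewrite /B -!mulmxA sqn_ortho; last exact: orthomxT.
  by rewrite (le_trans (hX _)) // sqn_ortho.
have Be : B *m delta_mx 0 0 = sg *: (delta_mx 0 0 : 'cV_(1 + m)).
  rewrite /B -!mulmxA Pe.
  have -> : X *m v = sg *: (Q *m delta_mx 0 0).
    by rewrite Qe scalerA divff ?scale1r // gt_eqF.
  by rewrite -scalemxAr mulmxA hQ mul1mx.
clearbody B; pose w := ursubmx B; pose B' := drsubmx B.
have Bcol i : B i 0 = sg * (i == 0)%:R.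
  move: Be; rewrite -colE => /colP/(_ i); rewrite !mxE => ->.
  by rewrite andbT.
have l0 p : lshift p (0 : 'I_1) = 0 by exact: val_inj.
have BE : B = block_mx sg%:M w 0 B'.
  rewrite -[LHS]submxK; congr block_mx; apply/matrixP => i j.
    by rewrite !ord1 !mxE !l0 Bcol eqxx mulr1 mulr1n.
  by rewrite !ord1 !mxE !l0 Bcol (_ : (rshift 1 i == 0) = false) ?mulr0.
have w0 : w = 0.
  have hs : sqn (sg%:M : 'cV[R]_1) = a.
    by rewrite /sqn tr_scalar_mx -scalar_mxM mxE eqxx mulr1n -expr2.
  have := hB (col_mx sg%:M w^T); set t := sqn (col_mx _ _).
  have tE : t = a + sqn w^T by rewrite /t sqn_block hs.
  have tp : 0 < t by rewrite tE ltr_wpDr ?sqn_ge0.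
  rewrite BE mul_block_col mul0mx add0r sqn_block.
  have -> : sg%:M *m sg%:M + w *m w^T = t%:M.
    rewrite -scalar_mxM -expr2 sg2 [w *m w^T]mx11_scalar -raddfD tE.
    by rewrite /sqn trmxK.
  have -> : sqn (t%:M : 'cV[R]_1) = t * t.
    by rewrite /sqn tr_scalar_mx -scalar_mxM mxE eqxx mulr1n.
  move=> h; have : t * t <= a * t by rewrite (le_trans _ h) // lerDl sqn_ge0.
  rewrite ler_pM2r // tE gerDl => h0.
  rewrite -[w]trmxK (@sqn_eq0 _ w^T) ?trmx0 //.
  by apply/eqP; rewrite eq_le h0 sqn_ge0.
have [[[U s] V] /= [hU hV hs hs0 B'E]] := IHm n B'.
have hB' y : sqn (B' *m y) <= a * sqn y.
  have := hB (col_mx 0 y); rewrite BE w0 mul_block_col !mul0mx mulmx0 !add0r.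
  by rewrite !sqn_block {1 3}/sqn !mulmx0 mxE !add0r.
have s0 i : 0 <= s i.
  by have /andP[h1 h2] := hs i; exact: le_trans h1 h2.
exists (Q *m block_mx 1%:M 0 0 U,
        fun i => if i is i'.+1 then s i' else sg,
        P *m block_mx 1%:M 0 0 V); split=> /=.
- by apply: orthomxM => //; exact: orthomx_block.
- by apply: orthomxM => //; exact: orthomx_block.
- case=> [|i]; last exact: hs.
  rewrite s0 /=; have [|] := leqP (minn m n) 0; first by move/hs0 ->; exact: ltW.
  rewrite leq_min => /andP[m0 n0].
  pose i0 := Ordinal m0; pose j0 := Ordinal n0.
  have := hB' (V *m delta_mx j0 0).
  rewrite sqn_ortho // sqn_delta mulr1 {1}B'E -!mulmxA (mulmxA V^T) hV mul1mx.
  rewrite sqn_ortho //.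
  have -> : rdiag_mx m n s *m delta_mx j0 0 = s 0%N *: delta_mx i0 0 :> 'cV_m.
    rewrite -colE; apply/colP => i; rewrite !mxE andbT mulr_natr.
    rewrite (_ : (i == i0) = (i == j0 :> nat)) //.
    by have [->|] := eqVneq (i : nat) j0.
  rewrite sqnZ sqn_delta mulr1 -sg2 ler_pXn2r ?nnegrE //.
  exact: ltW.
- by case=> [|i]; rewrite minnSS // ltnS => /hs0.
rewrite {1}XB BE w0 B'E.
have -> : rdiag_mx (1 + m) (1 + n) (fun i => if i is i'.+1 then s i' else sg)
    = block_mx sg%:M 0 0 (rdiag_mx m n s).
  rewrite -[LHS]submxK; congr block_mx; apply/matrixP => i j.
  - by rewrite !ord1 !mxE.
  - by rewrite !mxE !ord1 /= mulr0n.
  - by rewrite !mxE !ord1 /= mulr0n.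
  - by rewrite !mxE /= eqSS.
rewrite trmx_mul tr_block_mx !trmx0 trmx1 -!mulmxA; congr (_ *m _).
rewrite !mulmxA; congr (_ *m _).
by rewrite !mulmx_block !(mulmx0, mul0mx, mul1mx, mulmx1, addr0, add0r).
Qed.

Definition svd m n (X : 'M[R]_(m, n)) : 'M[R]_m * (nat -> R) * 'M[R]_n :=
  projT1 (cid (svd_exists X)).

Lemma svdP m n (X : 'M[R]_(m, n)) :
  is_svd X (svd X).1.1 (svd X).1.2 (svd X).2.
Proof. exact: (projT2 (cid (svd_exists X))). Qed.

(* [singval X j] is the [j]-th largest singular value for [j >= 1]; the value
   at [j = 0] is junk. *)
Definition singval m n (X : 'M[R]_(m, n)) (j : nat) : R := (svd X).1.2 j.-1.

(* [X_{opt,r}], computed from one fixed SVD of [X] (truncated SVDs need not be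
   unique when singular values coincide) *)
Definition trunc_svd m n (X : 'M[R]_(m, n)) (r : nat) : 'M[R]_(m, n) :=
  let: (U, s, V) := svd X in
  U *m rdiag_mx m n (fun i => if (i < r)%N then s i else 0) *m V^T.

Definition fnorm m n (X : 'M[R]_(m, n)) : R :=
  Num.sqrt (\sum_i \sum_j X i j ^+ 2).

End SingularValues.

Section SRHT.
Context {R : realType}.

Lemma exp2S q : (2 ^ q + 2 ^ q = 2 ^ q.+1)%N.
Proof. by rewrite expnS mul2n addnn. Qed.

(* unnormalized (Sylvester) Hadamard matrix, with entries +1 and -1 *)
Fixpoint hadamard (q : nat) : 'M[R]_(2 ^ q) :=
  if q is q'.+1 then
    let H := hadamard q' in
    castmx (exp2S q', exp2S q') (block_mx H H H (- H))
  else const_mx 1.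

(* Sample space: an ordered choice of [s] distinct rows, and [n] signs; the
   uniform law on this product makes the rows a uniform sample without
   replacement and the signs i.i.d. uniform, independent of the rows. *)
Definition srht_space (s n : nat) : finType :=
  ({f : {ffun 'I_s -> 'I_n} | injectiveb f} * {ffun 'I_n -> bool})%type.

Definition srht (q s : nat) (w : srht_space s (2 ^ q)) : 'M[R]_(s, 2 ^ q) :=
  let n := (2 ^ q)%N in
  let P : 'M[R]_(s, n) := \matrix_(i, j) (val w.1 i == j)%:R in
  let H : 'M[R]_n := (Num.sqrt n%:R)^-1 *: hadamard q in
  let D : 'M[R]_n := diag_mx (\row_j (-1) ^+ w.2 j) in
  Num.sqrt (n%:R / s%:R) *: (P *m H *m D).

Definition unif_prob (T : finType) (E : T -> Prop) : R :=
  #|[pred w : T | `[< E w >]]|%:R / #|T|%:R.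

(* probability that [V1] has the property [E], when [V1^T] is an SRHT *)
Definition prob_srht_tr (q s : nat) (E : 'M[R]_(2 ^ q, s) -> Prop) : R :=
  unif_prob (fun w : srht_space s (2 ^ q) => E (srht w)^T).

End SRHT.

Section RandomizedQR.
Context {R : realType}.

Definition upper_trig m n (T : 'M[R]_(m, n)) : Prop :=
  forall (i : 'I_m) (j : 'I_n), (j < i)%N -> T i j = 0.

Definition hcat n l (hn : (l <= n)%N) (V1 : 'M[R]_(n, l)) (V2 : 'M[R]_(n, n - l)) :
    'M[R]_n :=
  castmx (erefl n, subnKC hn) (row_mx V1 V2).

Definition lead_cols m l (hm : (l <= m)%N) (Q : 'M[R]_m) : 'M[R]_(m, l) :=
  colsub (widen_ord hm) Q.

Lemma trail_subproof l n (i : 'I_(n - l)) : (l + i < n)%N.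
Proof. by rewrite -ltn_subRL. Qed.

Definition trail_ord l n (i : 'I_(n - l)) : 'I_n := Ordinal (trail_subproof i).

Definition trail_block m n l (T : 'M[R]_(m, n)) : 'M[R]_(m - l, n - l) :=
  mxsub (@trail_ord l m) (@trail_ord l n) T.

(* [Q] and [T] (the upper triangular factor usually called R) are a possible output
   of the randomized QR factorization of [A] with sketch [V1]; the output is
   not unique, because neither the QR factorizations nor the completion [V2']
   are. *)
Definition rand_qr m n l (hn : (l <= n)%N) (A : 'M[R]_(m, n)) (V1 : 'M[R]_(n, l))
    (Q : 'M[R]_m) (T : 'M[R]_(m, n)) : Prop :=
  exists (V1' : 'M[R]_(n, l)) (R11' : 'M[R]_l) (V2' : 'M[R]_(n, n - l)),
    [/\ V1 = V1' *m R11', V1'^T *m V1' = 1%:M & upper_trig R11'] /\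
    [/\ orthomx (hcat hn V1' V2'),
        A *m hcat hn V1 V2' = Q *m T, orthomx Q & upper_trig T].

End RandomizedQR.

(* Main.v *)
(* The row space of [V1'] is orthogonal to that of [V2'], so [R22] is
   [(1 - Q1 Q1^T) A] read in orthonormal bases, and [(1 - Q1 Q1^T) A V1 = 0].
   If [W = Vk^T V1] (with [Vk] the top [k] right singular vectors) has a bounded
   right inverse [Wd], then [A] may be replaced by [A (1 - V1 Wd Vk^T)], which
   only sees the singular directions beyond [k].  Everything then reduces to
   three facts on the SRHT, each with failure probability [delta]:
   [W W^T >= 1/16], [|E V1 V1^T Vk|_F^2 <= C eps |E|_F^2], and
   [|E V1|^2 <= C (|E|^2 + log(rho/delta)/l |E|_F^2)] for the tail [E] of [A].
   The signs flatten the rows (an exponential moment of a Rademacher chaos).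
   The uniform row sample [S] is drawn one row at a time, without replacement;
   with [A_S] the sum of [v_j v_j^T] and [Z_S] the sum of [x_j] over [S], each
   draw changes the mean of a potential by a controlled factor: [tr (N - A_S)^p]
   for the lower tail, where [N - A_S] is the sum over the complement of [S],
   [tr (p + A_S)^p] for the upper tail, and [(h + |Z_S|^2)^p] for vector sums.
   Rank-one updates of these trace powers are controlled by Chebyshev's sum
   inequality, so no matrix exponential is needed. *)
From Pilot Require Import Defs.
From HB Require Import structures.
From mathcomp Require Import all_boot all_order all_algebra.
From mathcomp Require Import all_classical all_reals all_analysis.
From mathcomp Require Import zify ring lra.

Set Implicit Arguments.
Unset Strict Implicit.
Unset Printing Implicit Defensive.
Import Order.TTheory GRing.Theory Num.Theory.
Local Open Scope ring_scope.
(* [Defs] again: mathcomp also defines an [orthomx]. *)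
Import Pilot.Defs.

(** * Singular values and linear constraints *)

Section LinearAlgebra.
Context {R : realType}.

(** Why potentials suit sampling without replacement: given [S], the undrawn terms sum to [N - A_S]
    for the lower tail and to [- Z_S] for the vector sum, so the mean effect of the next draw is
    explicit and has the favourable sign. The upper tail and the vector sum also need at least half
    of the indices to remain. When [l > n / 2], the vector sum passes to the complement, and the
    operator bound follows from [V1^T V1 = (n / l) I]. The power [p] plays the role of the parameter
    of an exponential moment. It is about [N / 2] for the lower tail and about the logarithm of the
    inverse failure probability elsewhere, plus the mean level for the upper tail. Bounds (i) and
    (ii) are vacuous for [delta >= 1/2], but (iv) is not. The embedding must therefore fail with
    probability at most [delta] for every [delta < 1]. The Chernoff estimate [2 delta (delta / k)^6]
    is too large when [delta / k] is close to 1, which forces a separate argument for [k = 1]. *)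

Definition dotp n (u v : 'cV[R]_n) : R := (u^T *m v) 0 0.

Lemma dotpE n (u v : 'cV[R]_n) : dotp u v = \sum_i u i 0 * v i 0.
Proof. by rewrite /dotp mxE; apply: eq_bigr => i _; rewrite mxE. Qed.

Lemma dotpC n (u v : 'cV[R]_n) : dotp u v = dotp v u.
Proof. by rewrite !dotpE; apply: eq_bigr => i _; rewrite mulrC. Qed.

Lemma dotpDr n (u v w : 'cV[R]_n) : dotp u (v + w) = dotp u v + dotp u w.
Proof. by rewrite /dotp mulmxDr mxE. Qed.

Lemma dotpZr n (u v : 'cV[R]_n) a : dotp u (a *: v) = a * dotp u v.
Proof. by rewrite /dotp -scalemxAr mxE. Qed.

Lemma dotpDl n (u v w : 'cV[R]_n) : dotp (v + w) u = dotp v u + dotp w u.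
Proof. by rewrite !(dotpC _ u) dotpDr. Qed.

Lemma dotpZl n (u v : 'cV[R]_n) a : dotp (a *: v) u = a * dotp v u.
Proof. by rewrite !(dotpC _ u) dotpZr. Qed.

Lemma dotp_mulr m n (X : 'M[R]_(m, n)) u v : dotp u (X *m v) = dotp (X^T *m u) v.
Proof. by rewrite /dotp trmx_mul trmxK mulmxA. Qed.

Lemma dotp_mull m n (X : 'M[R]_(m, n)) u v : dotp (X *m u) v = dotp u (X^T *m v).
Proof. by rewrite dotp_mulr trmxK. Qed.

Lemma dotp_vv n (v : 'cV[R]_n) : dotp v v = sqn v.
Proof. by []. Qed.

Lemma sqnD n (u v : 'cV[R]_n) : sqn (u + v) = sqn u + 2%:R * dotp u v + sqn v.
Proof.
by rewrite -!dotp_vv dotpDl !dotpDr (dotpC v u); ring.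
Qed.

Lemma sqn0 n : sqn (0 : 'cV[R]_n) = 0.
Proof. by rewrite /sqn mulmx0 mxE. Qed.

Lemma sqn_gt0 n (v : 'cV[R]_n) : v != 0 -> 0 < sqn v.
Proof.
move=> v0; rewrite lt_neqAle sqn_ge0 andbT eq_sym.
by apply: contra_neqN v0 => /eqP /sqn_eq0.
Qed.

Lemma dotp_sqr_le n (u v : 'cV[R]_n) : dotp u v ^+ 2 <= sqn u * sqn v.
Proof.
have [->|v0] := eqVneq v 0; first by rewrite sqn0 /dotp mulmx0 mxE expr0n mulr0.
have vp := sqn_gt0 v0.
have := sqn_ge0 (sqn v *: u + (- dotp u v) *: v).
rewrite sqnD !sqnZ dotpZl dotpZr.
have -> : sqn v ^+ 2 * sqn u + 2%:R * (sqn v * (- dotp u v * dotp u v))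
   + (- dotp u v) ^+ 2 * sqn v = sqn v * (sqn u * sqn v - dotp u v ^+ 2) by ring.
by rewrite pmulr_rge0 // subr_ge0.
Qed.

Lemma sqnD_le n (u v : 'cV[R]_n) : sqn (u + v) <= 2%:R * sqn u + 2%:R * sqn v.
Proof.
have := sqn_ge0 (u + (- 1) *: v); rewrite !sqnD sqnZ dotpZr => h.
by rewrite -subr_ge0; apply: le_trans h _; rewrite le_eqVlt; apply/orP; left;
  apply/eqP; ring.
Qed.

Lemma sqn_mul_gram m n (X : 'M[R]_(m, n)) c (v : 'cV[R]_n) :
  X^T *m X = c%:M -> sqn (X *m v) = c * sqn v.
Proof.
move=> h; rewrite -dotp_vv dotp_mull mulmxA h mul_scalar_mx.
by rewrite dotpZr.
Qed.

Lemma sum_ord_trunc m n (g : nat -> R) :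
  (forall i, (minn m n <= i)%N -> g i = 0) ->
  \sum_(i < m) g i = \sum_(i < n) g i.
Proof.
move=> h; wlog le_mn : m n h / (m <= n)%N.
  move=> H; case: (leqP m n) => [|/ltnW] ?; first exact: H.
  by apply/esym/H => //; rewrite minnC.
rewrite -!(big_mkord xpredT g) [RHS](big_cat_nat (n := m)) //=.
rewrite [X in _ = _ + X](_ : _ = 0) ?addr0 //.
rewrite big_nat_cond big1 // => i /andP[/andP[mi _] _].
by apply: h; rewrite (minn_idPl le_mn).
Qed.

(** Coordinates indexed by [nat] and extended by zero match the zero-extended singular values, so
    that sums over ['I_m] and ['I_n] can be compared without casts. *)
Definition extc n (x : 'cV[R]_n) (i : nat) : R :=
  if insub i is Some o then x o 0 else 0.

Lemma extcE n (x : 'cV[R]_n) (i : 'I_n) : extc x i = x i 0.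
Proof. by rewrite /extc insubT //= => h; congr (x _ _); apply: val_inj. Qed.

Lemma extc_out n (x : 'cV[R]_n) (i : nat) : (n <= i)%N -> extc x i = 0.
Proof. by move=> h; rewrite /extc insubF //; apply/negbTE; rewrite -leqNgt. Qed.

Lemma rdiag_mulE m n s (x : 'cV[R]_n) (i : 'I_m) :
  (rdiag_mx m n s *m x) i 0 = s i * extc x i.
Proof.
rewrite mxE; case: (ltnP i n) => hi; last first.
  rewrite extc_out // mulr0 big1 // => j _; rewrite mxE.
  by rewrite gtn_eqF ?mulr0n ?mul0r //; apply: leq_trans hi.
rewrite (bigD1 (Ordinal hi)) //= mxE /= eqxx mulr1n big1 ?addr0.
  by rewrite -(extcE x (Ordinal hi)).
move=> j hj; rewrite mxE; case: eqP => [h|]; last by rewrite mulr0n mul0r.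
by case/eqP: hj; apply: val_inj; rewrite /= -h.
Qed.

Lemma sqn_rdiag m n s (x : 'cV[R]_n) :
  (forall i, (minn m n <= i)%N -> s i = 0) ->
  sqn (rdiag_mx m n s *m x) = \sum_(j < n) s j ^+ 2 * x j 0 ^+ 2.
Proof.
move=> hs; rewrite sqnE.
under eq_bigr => i _ do rewrite rdiag_mulE exprMn.
rewrite (@sum_ord_trunc m n (fun i => s i ^+ 2 * extc x i ^+ 2)).
  by apply: eq_bigr => j _; rewrite extcE.
by move=> i /hs ->; rewrite expr0n mul0r.
Qed.

Lemma orthomx_sqn n (Q : 'M[R]_n) (v : 'cV[R]_n) : orthomx Q -> sqn (Q^T *m v) = sqn v.
Proof. by move=> h; rewrite sqn_ortho //; apply: orthomxT. Qed.

Lemma svd_sqn m n (X : 'M[R]_(m, n)) U s V (x : 'cV[R]_n) : is_svd X U s V ->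
  sqn (X *m x) = \sum_(j < n) s j ^+ 2 * (V^T *m x) j 0 ^+ 2.
Proof.
case=> hU hV _ hs ->; rewrite -!mulmxA sqn_ortho // sqn_rdiag //.
Qed.

Lemma svd_ge0 m n (X : 'M[R]_(m, n)) U s V i : is_svd X U s V -> 0 <= s i.
Proof.
by case=> _ _ h _ _; have /andP[h1 h2] := h i; apply: le_trans h1 h2.
Qed.

Lemma svd_mono m n (X : 'M[R]_(m, n)) U s V i j :
  is_svd X U s V -> (i <= j)%N -> s j <= s i.
Proof.
case=> _ _ h _ _ /subnKC <-; elim: (j - i)%N => [|d IH]; first by rewrite addn0.
by rewrite addnS; apply: le_trans IH; have /andP[] := h (i + d)%N.
Qed.

Lemma kernel_vector d t (N : 'M[R]_(d, t)) : (d < t)%N ->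
  exists2 z : 'cV[R]_t, z != 0 & N *m z = 0.
Proof.
move=> dt; have : kermx N^T != 0.
  rewrite -mxrank_eq0 mxrank_ker subn_eq0 -ltnNge.
  by apply: leq_ltn_trans dt; rewrite mxrank_tr rank_leq_row.
case/rowV0Pn=> v /sub_kermxP hv v0; exists v^T.
  by apply: contra_neq v0 => h; rewrite -[v]trmxK h trmx0.
by rewrite -[N]trmxK -trmx_mul hv trmx0.
Qed.

(** The rectangular identity: it pads with zeros or keeps the leading coordinates, according to
    which dimension is larger. *)
Definition isel m n : 'M[R]_(m, n) := rdiag_mx m n (fun=> 1).

Lemma isel_gram n t : (t <= n)%N -> (isel n t)^T *m isel n t = 1%:M.
Proof.
move=> tn; apply/matrixP => i j; rewrite !mxE.
have hi : (i < n)%N by apply: leq_trans tn.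
rewrite (bigD1 (Ordinal hi)) //= !mxE /= eqxx mulr1n mul1r big1 ?addr0 //.
by move=> a ha; rewrite !mxE; case: eqP => [h|]; rewrite ?mulr0n ?mul0r //;
  case/eqP: ha; apply: val_inj.
Qed.

Lemma isel_mulE m n (x : 'cV[R]_n) (i : 'I_m) : (isel m n *m x) i 0 = extc x i.
Proof. by rewrite rdiag_mulE mul1r. Qed.

Lemma isel_tr m n : (isel m n)^T = isel n m.
Proof. by apply/matrixP => i j; rewrite !mxE eq_sym. Qed.

(* Courant-Fischer: singular values only see the norms [|Xv|], up to an index
   shift by the number of linear constraints imposed on [v]. *)
Lemma sv_compare m n p d (X : 'M[R]_(m, n)) (K : 'M[R]_(p, n)) (N : 'M[R]_(d, n))
    U s V U' s' V' : is_svd X U s V -> is_svd K U' s' V' ->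
  (forall v, N *m v = 0 -> sqn (X *m v) <= sqn (K *m v)) ->
  forall i, s (i + d)%N <= s' i.
Proof.
move=> hX hK h i.
case: (leqP (minn m n) (i + d)) => [|].
  by case: (hX) => _ _ _ hs _ /hs ->; apply: svd_ge0 hK.
rewrite leq_min => /andP[_ hn].
pose t := (i + d).+1; pose W := V *m isel n t.
have hV : orthomx V by case: hX.
have hV' : orthomx V' by case: hK.
have hW : W^T *m W = 1%:M.
  by rewrite /W trmx_mul mulmxA -(mulmxA _ V^T) hV mulmx1 isel_gram.
(* A combination of the top [i + d + 1] right singular vectors of [X] has to meet [d] conditions
   from [N] and [i] orthogonality conditions to the top directions of [K]: one unknown more than
   equations. *)
have [|z z0] := @kernel_vector (d + i) t
   (col_mx (N *m W) (isel i n *m V'^T *m W)); first by rewrite /t addnC.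
rewrite mul_col_mx -(col_mx0 _ _) => /eq_col_mx [h1 h2].
have hz : sqn (W *m z) = sqn z by rewrite (sqn_mul_gram _ hW) mul1r.
have zp := sqn_gt0 z0.
have := h (W *m z); rewrite mulmxA => /(_ h1).
rewrite (svd_sqn _ hX) (svd_sqn _ hK) => hle.
have low : s (i + d)%N ^+ 2 * sqn z <=
    \sum_(j < n) s j ^+ 2 * (V^T *m (W *m z)) j 0 ^+ 2.
  rewrite /W -!mulmxA (mulmxA V^T) hV mul1mx.
  have -> : sqn z = \sum_(j < n) extc z j ^+ 2.
    rewrite sqnE; under eq_bigr => j _ do rewrite -extcE.
    rewrite (@sum_ord_trunc t n (fun j => extc z j ^+ 2)) // => j.
    by rewrite (minn_idPl _) // => hj; rewrite extc_out // expr0n.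
  rewrite mulr_sumr; apply: ler_sum => j _; rewrite isel_mulE.
  case: (leqP t j) => hj; first by rewrite extc_out // expr0n !mulr0.
  rewrite ler_wpM2r ?sqr_ge0 // ler_pXn2r ?nnegrE ?(svd_ge0 _ hX) //.
  exact: svd_mono hX _.
have up : \sum_(j < n) s' j ^+ 2 * (V'^T *m (W *m z)) j 0 ^+ 2
    <= s' i ^+ 2 * sqn z.
  rewrite -hz -(orthomx_sqn (W *m z) hV') sqnE mulr_sumr; apply: ler_sum => j _.
  case: (ltnP j i) => hj.
    have /colP /(_ (Ordinal hj)) := h2.
    rewrite -!mulmxA isel_mulE /= extcE !mxE => ->.
    by rewrite expr0n !mulr0.
  rewrite ler_wpM2r ?sqr_ge0 // ler_pXn2r ?nnegrE ?(svd_ge0 _ hK) //.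
  exact: svd_mono hK _.
have := le_trans low (le_trans hle up).
by rewrite ler_pM2r // ler_pXn2r ?nnegrE ?(svd_ge0 _ hX) ?(svd_ge0 _ hK).
Qed.

Lemma sv_le m n p (X : 'M[R]_(m, n)) (K : 'M[R]_(p, n)) U s V U' s' V' :
  is_svd X U s V -> is_svd K U' s' V' ->
  (forall v, sqn (X *m v) <= sqn (K *m v)) -> forall i, s i <= s' i.
Proof.
move=> hX hK h i; have := @sv_compare _ _ _ 0 X K 0 _ _ _ _ _ _ hX hK _ i.
by rewrite addn0; apply => v _.
Qed.

(** The [\rank X] equations of a row basis force [X v = 0], so [sv_compare] applies against the zero
    matrix. *)
Lemma svd_rank m n (X : 'M[R]_(m, n)) U s V i :
  is_svd X U s V -> (\rank X <= i)%N -> s i = 0.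
Proof.
move=> hX hi; apply/eqP; rewrite eq_le (svd_ge0 _ hX) andbT.
have h0 := @svd0 R m n; apply: le_trans (svd_mono hX hi) _.
rewrite -[\rank X]add0n.
apply: (sv_compare (N := row_base X) hX h0) => v hv.
by rewrite -(mulmx_base X) -mulmxA hv mulmx0 sqn0 sqn_ge0.
Qed.

Lemma svd_tr m n (X : 'M[R]_(m, n)) U s V : is_svd X U s V -> is_svd X^T V s U.
Proof.
case=> hU hV h1 h2 ->; split=> //; first by move=> i; rewrite minnC; apply: h2.
rewrite !trmx_mul trmxK !mulmxA; congr (_ *m _ *m _).
apply/matrixP => i j; rewrite !mxE eq_sym.
by case: eqP => [->|//].
Qed.

Lemma svd_uniq m n (X : 'M[R]_(m, n)) U s V U' s' V' :
  is_svd X U s V -> is_svd X U' s' V' -> s =1 s'.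
Proof.
by move=> h h' i; apply/eqP; rewrite eq_le (sv_le h h') ?(sv_le h' h).
Qed.

Definition fsq m n (X : 'M[R]_(m, n)) : R := \sum_i \sum_j X i j ^+ 2.

Lemma fsq_ge0 m n (X : 'M[R]_(m, n)) : 0 <= fsq X.
Proof. by apply: sumr_ge0 => i _; apply: sumr_ge0 => j _; apply: sqr_ge0. Qed.

Lemma fnorm_sqr m n (X : 'M[R]_(m, n)) : fnorm X ^+ 2 = fsq X.
Proof. by rewrite /fnorm sqr_sqrtr // fsq_ge0. Qed.

Lemma fsq_tr m n (X : 'M[R]_(m, n)) : fsq X^T = fsq X.
Proof.
rewrite /fsq exchange_big /=; apply: eq_bigr => i _; apply: eq_bigr => j _.
by rewrite mxE.
Qed.

Lemma fsq_trace m n (X : 'M[R]_(m, n)) : fsq X = \tr (X^T *m X).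
Proof.
rewrite /fsq exchange_big /= /mxtrace; apply: eq_bigr => j _; rewrite mxE.
by apply: eq_bigr => i _; rewrite mxE expr2.
Qed.

Lemma fsq_ortho m n (Q : 'M[R]_m) (X : 'M[R]_(m, n)) : orthomx Q ->
  fsq (Q *m X) = fsq X.
Proof.
by move=> h; rewrite !fsq_trace trmx_mul mulmxA -(mulmxA _ Q^T) h mulmx1.
Qed.

Lemma fsq_orthor m n (Q : 'M[R]_n) (X : 'M[R]_(m, n)) : orthomx Q ->
  fsq (X *m Q^T) = fsq X.
Proof. by move=> h; rewrite -fsq_tr trmx_mul trmxK fsq_ortho // fsq_tr. Qed.

Lemma fsq_rdiag m n s : (forall i, (minn m n <= i)%N -> s i = 0) ->
  fsq (rdiag_mx m n s) = \sum_(j < n) s j ^+ 2.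
Proof.
move=> hs; rewrite /fsq exchange_big /=; apply: eq_bigr => j _.
under eq_bigr => i _ do rewrite mxE.
case: (ltnP j m) => hj.
  rewrite (bigD1 (Ordinal hj)) //= eqxx mulr1n big1 ?addr0 // => i hi.
  case: eqP => [h|_]; last by rewrite mulr0n expr0n.
  by case/eqP: hi; apply: val_inj.
rewrite hs ?geq_min ?hj // expr0n big1 // => i _.
by rewrite (ltn_eqF (leq_trans (ltn_ord i) hj)) mulr0n expr0n.
Qed.

Lemma fsq_svd m n (X : 'M[R]_(m, n)) U s V : is_svd X U s V ->
  fsq X = \sum_(j < n) s j ^+ 2.
Proof.
by case=> hU hV _ hs ->; rewrite fsq_orthor // fsq_ortho // fsq_rdiag.
Qed.

Lemma fsq_sub_trunc m n (X : 'M[R]_(m, n)) r :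
  fsq (X - trunc_svd X r) =
  \sum_(j < n) (if (j < r)%N then 0 else (svd X).1.2 j ^+ 2).
Proof.
rewrite /trunc_svd; case: (svd X) (svdP X) => [[U s] V] /= [hU hV _ hs hX].
rewrite {1}hX -mulmxBl -mulmxBr.
have -> : rdiag_mx m n s - rdiag_mx m n (fun i => if (i < r)%N then s i else 0) =
    rdiag_mx m n (fun i => if (i < r)%N then 0 else s i) :> 'M[R]_(m, n).
  apply/matrixP => i j; rewrite !mxE.
  by case: ifP; rewrite ?subrr ?mul0rn ?subr0.
rewrite fsq_orthor // fsq_ortho // fsq_rdiag.
  by apply: eq_bigr => j _; case: ifP => // _; rewrite expr0n.
by move=> i hi; case: ifP => // _; apply: hs.
Qed.

End LinearAlgebra.

(** * Blocks of the randomized QR factorization *)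

Section Deterministic.
Context {R : realType}.

Lemma proj_sqn_le m n (P : 'M[R]_(m, n)) (x : 'cV[R]_m) : P^T *m P = 1%:M ->
  sqn (P^T *m x) <= sqn x.
Proof.
move=> hP; have := sqn_ge0 (x + (-1) *: (P *m (P^T *m x))).
rewrite sqnD dotpZr sqnZ (sqn_mul_gram _ hP) dotp_mulr dotp_vv.
lra.
Qed.

Lemma fsq_col m n (X : 'M[R]_(m, n)) : fsq X = \sum_j sqn (col j X).
Proof.
rewrite /fsq exchange_big /=; apply: eq_bigr => j _; rewrite sqnE.
by apply: eq_bigr => i _; rewrite mxE.
Qed.

Lemma fsq_mull_le m n p (X : 'M[R]_(m, n)) (Y : 'M[R]_(n, p)) c :
  (forall v, sqn (X *m v) <= c * sqn v) -> fsq (X *m Y) <= c * fsq Y.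
Proof.
move=> h; rewrite !fsq_col mulr_sumr; apply: ler_sum => j _.
by rewrite !colE -mulmxA.
Qed.

Lemma svd_top_le m n (X : 'M[R]_(m, n)) U s V b : is_svd X U s V -> 0 <= b ->
  (forall v, sqn (X *m v) <= b * sqn v) -> s 0%N ^+ 2 <= b.
Proof.
move=> hX b0 h; case: (leqP (minn m n) 0) => [|].
  by case: (hX) => _ _ _ hs _ /hs ->; rewrite expr0n.
rewrite leq_min => /andP[_ hn].
have hV : orthomx V by case: hX.
have := h (V *m delta_mx (Ordinal hn) 0).
rewrite sqn_ortho // sqn_delta mulr1; apply: le_trans.
rewrite (svd_sqn _ hX) mulmxA hV mul1mx (bigD1 (Ordinal hn)) //=.
rewrite mxE !eqxx expr1n mulr1 lerDl.
by apply: sumr_ge0 => i _; rewrite mulr_ge0 ?sqr_ge0.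
Qed.

(** Among [t + 1] parameters, some nonzero [a] makes [Y a] orthogonal to the top [t] right singular
    vectors, and there [X] stretches by at most [s t]. *)
Lemma sv_lower m n t (X : 'M[R]_(m, n)) (Y : 'M[R]_(n, t.+1)) U s V al be :
  is_svd X U s V ->
  (forall a, al * sqn a <= sqn (X *m (Y *m a))) ->
  (forall a, sqn (Y *m a) <= be * sqn a) -> al <= s t ^+ 2 * be.
Proof.
move=> hX hal hbe; have hV : orthomx V by case: hX.
have [|a a0 ha] := @kernel_vector R t t.+1 (isel t n *m V^T *m Y); first by [].
have ap := sqn_gt0 a0; rewrite -(ler_pM2r ap).
apply: le_trans (hal a) _; rewrite -mulrA.
apply: le_trans (ler_wpM2l (sqr_ge0 _) (hbe a)).
rewrite (svd_sqn _ hX) -(orthomx_sqn _ hV) sqnE mulr_sumr; apply: ler_sum => j _.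
case: (ltnP j t) => hj.
  have /colP /(_ (Ordinal hj)) := ha.
  rewrite -!mulmxA isel_mulE /= extcE !mxE => ->.
  by rewrite expr0n !mulr0.
rewrite ler_wpM2r ?sqr_ge0 // ler_pXn2r ?nnegrE ?(svd_ge0 _ hX) //.
exact: svd_mono hX _.
Qed.

Lemma sum_lead_trail l n (hn : (l <= n)%N) (F : 'I_n -> R) :
  \sum_i F i = \sum_i F (widen_ord hn i) + \sum_i F (@trail_ord l n i).
Proof.
rewrite (reindex (cast_ord (subnKC hn))) /=; last first.
  by exists (cast_ord (esym (subnKC hn))) => i _; rewrite ?cast_ordK ?cast_ordKV.
rewrite big_split_ord /=; congr (_ + _); apply: eq_bigr => i _;
  by congr F; apply: val_inj.
Qed.

Lemma mulmx_lead_trail m n p l (hn : (l <= n)%N) (X : 'M[R]_(m, n))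
    (Y : 'M[R]_(n, p)) :
  X *m Y = colsub (widen_ord hn) X *m rowsub (widen_ord hn) Y
         + colsub (@trail_ord l n) X *m rowsub (@trail_ord l n) Y.
Proof.
apply/matrixP => i j; rewrite !mxE (sum_lead_trail hn).
by congr (_ + _); apply: eq_bigr => a _; rewrite !mxE.
Qed.

Lemma hcat_lead n l (hn : (l <= n)%N) (V1 : 'M[R]_(n, l)) V2 :
  colsub (widen_ord hn) (hcat hn V1 V2) = V1.
Proof.
apply/matrixP => i j; rewrite !mxE castmxE /= cast_ord_id.
rewrite (_ : cast_ord _ _ = lshift (n - l) j) ?row_mxEl //.
exact: val_inj.
Qed.

Lemma hcat_trail n l (hn : (l <= n)%N) (V1 : 'M[R]_(n, l)) V2 :
  colsub (@trail_ord l n) (hcat hn V1 V2) = V2.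
Proof.
apply/matrixP => i j; rewrite !mxE castmxE /= cast_ord_id.
rewrite (_ : cast_ord _ _ = rshift l j) ?row_mxEr //.
exact: val_inj.
Qed.

Lemma colsub_orthomx n p (f : 'I_p -> 'I_n) (Q : 'M[R]_n) : injective f ->
  orthomx Q -> (colsub f Q)^T *m colsub f Q = 1%:M.
Proof.
move=> fi hQ; apply/matrixP => i j.
have /matrixP /(_ (f i) (f j)) := hQ; rewrite !mxE (inj_eq fi) => <-.
by apply: eq_bigr => a _; rewrite !mxE.
Qed.

Lemma trail_ord_inj l n : injective (@trail_ord l n).
Proof. by move=> i j /(congr1 val) /= /addnI h; apply: val_inj. Qed.

Lemma widen_ord_injective l n (h : (l <= n)%N) : injective (widen_ord h).
Proof. by move=> i j /(congr1 val) h'; apply: val_inj. Qed.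

(** The vanishing lower-left block of [T] says that [Q2^T A V1 = 0], so the range of [A V1] lies in
    that of [Q1]. All later bounds go through these facts, which hold for every admissible output of
    the factorization. *)
Lemma rand_qr_blocks m n l (hm : (l <= m)%N) (hn : (l <= n)%N) (A : 'M[R]_(m, n))
    V1 Q T : rand_qr hn A V1 Q T ->
  exists (V2 : 'M[R]_(n, n - l)) (Q2 : 'M[R]_(m, m - l)),
    [/\ V2^T *m V2 = 1%:M, Q2^T *m Q2 = 1%:M, Q2^T *m A *m V1 = 0,
        trail_block l T = Q2^T *m A *m V2 &
        let Q1 := lead_cols hm Q in
        Q1^T *m Q1 = 1%:M /\ Q1 *m Q1^T *m (A *m V1) = A *m V1].
Proof.
case=> V1' [R11 [V2 [_ [hV hT hQ hup]]]].
have TE : T = Q^T *m A *m hcat hn V1 V2 by rewrite -mulmxA hT mulmxA hQ mul1mx.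
pose Q2 := colsub (@trail_ord l m) Q.
have Q2T : Q2^T = rowsub (@trail_ord l m) Q^T by rewrite trmx_mxsub.
have h0 : Q2^T *m A *m V1 = 0.
  apply/matrixP => i j; rewrite [RHS]mxE.
  have := hup (trail_ord i) (widen_ord hn j).
  have hlt : (widen_ord hn j < trail_ord i)%N by rewrite /= ltn_addr.
  move=> /(_ hlt); rewrite TE => <-.
  rewrite -{1}(hcat_lead hn V1 V2) Q2T mulmx_colsub mul_rowsub_mx mul_rowsub_mx.
  by rewrite !mxE.
exists V2, Q2; split=> //.
- rewrite -(hcat_trail hn V1' V2); apply: colsub_orthomx => //.
  exact: trail_ord_inj.
- by apply: colsub_orthomx => //; apply: trail_ord_inj.
- rewrite TE -{2}(hcat_trail hn V1 V2) Q2T mulmx_colsub !mul_rowsub_mx.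
  by apply/matrixP => i j; rewrite !mxE.
split; first by apply: colsub_orthomx => //; apply: widen_ord_injective.
have -> : A *m V1 = Q *m (Q^T *m (A *m V1)) by rewrite mulmxA (mulmx1C hQ) mul1mx.
rewrite [in RHS](mulmx_lead_trail hm) -!mul_rowsub_mx -Q2T [Q2^T *m _]mulmxA h0.
rewrite mulmx0 addr0 [Q *m _]mulmxA (mulmx1C hQ) mul1mx -!mulmxA.
by rewrite /lead_cols trmx_mxsub.
Qed.

(** [Wd] is the pseudo-inverse [W^T (W W^T)^-1]. The last bound replaces [E V1 Wd] by
    [E V1 V1^T Vk], a sketch of the product [E Vk], which is zero when [E] is the tail of [A]. *)
Lemma emb_right_inverse n k l (Vk : 'M[R]_(n, k)) (V1 : 'M[R]_(n, l)) c :
  0 < c -> (forall u, c * sqn u <= sqn (V1^T *m (Vk *m u))) ->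
  exists Wd : 'M[R]_(l, k),
  [/\ Vk^T *m V1 *m Wd = 1%:M,
      forall z, sqn (Wd *m z) <= c^-1 * sqn z &
      forall p (E : 'M[R]_(p, n)),
        fsq (E *m V1 *m Wd) <= c^-2 * fsq (E *m V1 *m V1^T *m Vk)].
Proof.
move=> c0 hemb; pose W := Vk^T *m V1; pose G := W *m W^T.
have WT : W^T = V1^T *m Vk by rewrite trmx_mul trmxK.
have hGu u : c * sqn u <= dotp u (G *m u).
  by rewrite /G -mulmxA dotp_mulr dotp_vv WT -mulmxA.
have GT : G^T = G by rewrite trmx_mul trmxK.
have Gu : G \in unitmx.
  rewrite -unitmx_tr -row_free_unit -kermx_eq0; apply/rowV0P => v.
  move=> /sub_kermxP hv; have := hGu v^T.
  rewrite -[G *m _]trmxK trmx_mul trmxK hv trmx0 /dotp mulmx0 mxE.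
  rewrite pmulr_rle0 // => h; rewrite -[v]trmxK (@sqn_eq0 _ _ v^T) ?trmx0 //.
  by apply/eqP; rewrite eq_le h sqn_ge0.
pose H := invmx G; have GH : G *m H = 1%:M by rewrite mulmxV.
have HT : H^T = H by rewrite trmx_inv GT.
have hb z : 0 <= dotp (H *m z) z <= c^-1 * sqn z.
  have := hGu (H *m z); rewrite mulmxA GH mul1mx => h1.
  have h0 : 0 <= dotp (H *m z) z.
    by apply: le_trans h1; rewrite mulr_ge0 ?sqn_ge0 // ltW.
  rewrite h0 /=; have [->|d0] := eqVneq (dotp (H *m z) z) 0.
    by rewrite mulr_ge0 ?sqn_ge0 ?invr_ge0 ?ltW.
  have dp : 0 < dotp (H *m z) z by rewrite lt_neqAle eq_sym d0.
  rewrite mulrC ler_pdivlMr // -(ler_pM2r dp) -mulrA mulrC mulrAC -mulrA -expr2.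
  apply: le_trans (ler_wpM2l (ltW c0) (dotp_sqr_le _ _)) _.
  by rewrite mulrA (mulrC (sqn z)) ler_wpM2r ?sqn_ge0.
have hH z : sqn (H *m z) <= c^-2 * sqn z.
  have := hGu (H *m z); rewrite mulmxA GH mul1mx => h1.
  have /andP[_ h2] := hb z.
  have := le_trans h1 h2; rewrite mulrC -ler_pdivlMr // mulrAC => /le_trans; apply.
  by rewrite expr2 invfM.
exists (W^T *m H); split.
- by rewrite mulmxA -/W -/G.
- move=> z; rewrite -mulmxA -dotp_vv dotp_mulr trmxK mulmxA -/G mulmxA GH mul1mx.
  by rewrite dotpC; case/andP: (hb z).
- move=> p E.
  have -> : E *m V1 *m (W^T *m H) = (E *m V1 *m V1^T *m Vk) *m H.
    by rewrite WT !mulmxA.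
  rewrite -fsq_tr trmx_mul HT -[in leRHS]fsq_tr; exact: fsq_mull_le.
Qed.

(* The part of [A] beyond its [r] leading singular directions, expressed in
   the (at most [rho]) left singular directions that matter. *)
Definition tail_mx m n (rho r : nat) (A : 'M[R]_(m, n)) : 'M[R]_(rho, n) :=
  rdiag_mx rho n (fun i => if (i < r)%N then 0 else (svd A).1.2 i)
    *m (svd A).2^T.

Definition top_vecs m n (k : nat) (A : 'M[R]_(m, n)) : 'M[R]_(n, k) :=
  (svd A).2 *m isel n k.

Section Tail.
Variables (m n rho : nat) (A : 'M[R]_(m, n)) (hrho : \rank A = rho).

Let hsvd := svdP A.
Let s := (svd A).1.2.
Let V := (svd A).2.
Let hV : orthomx V. Proof. by case: hsvd. Qed.

Let tail_sv0 r i : (minn rho n <= i)%N -> (if (i < r)%N then 0 else s i) = 0.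
Proof.
rewrite geq_min => hi; case: ifP => // _; case/orP: hi => hi.
  by apply: (svd_rank hsvd); rewrite hrho.
by case: hsvd => _ _ _ hs _; apply: hs; rewrite geq_min hi orbT.
Qed.

Lemma tail_sqn r x : sqn (tail_mx rho r A *m x) =
  \sum_(j < n) (if (j < r)%N then 0 else s j) ^+ 2 * (V^T *m x) j 0 ^+ 2.
Proof. by rewrite -mulmxA sqn_rdiag //; apply: tail_sv0. Qed.

Lemma tail_fsq r : fsq (tail_mx rho r A) = fsq (A - trunc_svd A r).
Proof.
rewrite fsq_sub_trunc fsq_orthor // fsq_rdiag; last exact: tail_sv0.
by apply: eq_bigr => j _; case: ifP => _; rewrite ?expr0n.
Qed.

Lemma tail_sqn_le r x : sqn (tail_mx rho r A *m x) <= s r ^+ 2 * sqn x.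
Proof.
rewrite tail_sqn -(orthomx_sqn x hV) sqnE mulr_sumr; apply: ler_sum => j _.
rewrite ler_wpM2r ?sqr_ge0 //; case: ltnP => hj; first by rewrite expr0n sqr_ge0.
by rewrite ler_pXn2r ?nnegrE ?(svd_ge0 _ hsvd) // (svd_mono hsvd).
Qed.

Lemma tail_top r k : (k <= r)%N -> tail_mx rho r A *m top_vecs k A = 0.
Proof.
move=> kr; rewrite /tail_mx /top_vecs -!mulmxA (mulmxA V^T) hV mul1mx.
apply/matrixP => i j; rewrite mxE [RHS]mxE big1 // => a _; rewrite !mxE.
case: eqP => [->|_]; last by rewrite mulr0n mul0r.
case: eqP => [->|_]; last by rewrite mulr0n mulr0.
by rewrite (leq_trans (ltn_ord j) kr) mul0rn mul0r.
Qed.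

Lemma top_gram k : (k <= n)%N -> (top_vecs k A)^T *m top_vecs k A = 1%:M.
Proof.
by move=> kn; rewrite trmx_mul mulmxA -(mulmxA _ V^T) hV mulmx1 isel_gram.
Qed.

End Tail.

End Deterministic.

(** * Deterministic bounds *)

Section QRBounds.
Context {R : realType}.

Lemma sum_shift_le N d (f g : nat -> R) : (forall i, 0 <= g i) ->
  (forall i, f (i + d)%N <= g i) ->
  \sum_(j < N) (if (j < d)%N then 0 else f j) <= \sum_(i < N) g i.
Proof.
move=> g0 h; rewrite -(big_mkord xpredT (fun j => if (j < d)%N then 0 else f j)).
rewrite -(big_mkord xpredT g).
case: (leqP N d) => hN.
  rewrite big_nat big1 ?sumr_ge0 // => i /andP[_ hi].
  by rewrite (leq_trans hi hN).
rewrite (big_cat_nat (n := d)) ?(ltnW hN) //= big_nat big1 ?add0r; last first.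
  by move=> i /andP[_ ->].
rewrite -{1}[d]add0n big_addn.
apply: (@le_trans _ _ (\sum_(0 <= i < N - d) g i)).
  by apply: ler_sum => i _; rewrite ltnNge leq_addl; apply: h.
rewrite [leRHS](big_cat_nat (n := N - d)) ?leq_subr //= lerDl.
by apply: sumr_ge0.
Qed.

Section Fixed.
Variables (m n k l rho d : nat) (hm : (l <= m)%N) (hn : (l <= n)%N).
Variables (A : 'M[R]_(m, n)) (V1 : 'M[R]_(n, l)) (Q : 'M[R]_m) (T : 'M[R]_(m, n)).
Variables (hrho : \rank A = rho) (hkd : (k + d <= n)%N).
Hypothesis hqr : rand_qr hn A V1 Q T.
Variables (Wd : 'M[R]_(l, k)).
Hypothesis hWd : (top_vecs k A)^T *m V1 *m Wd = 1%:M.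

Let s := (svd A).1.2.
Let V := (svd A).2.
Let hsvd : is_svd A (svd A).1.1 s V := svdP A.
Let hV : orthomx V. Proof. by case: hsvd. Qed.
Let E := tail_mx rho (k + d) A.
Let Vk := top_vecs k A.
Let R22 := trail_block l T.
Let Pr : 'M[R]_n := 1%:M - V1 *m Wd *m Vk^T.

Let hkn : (k <= n)%N. Proof. exact: leq_trans (leq_addr _ _) hkd. Qed.

Let proj_lead (x : 'cV[R]_n) (j : 'I_n) : (j < k)%N -> (V^T *m (Pr *m x)) j 0 = 0.
Proof.
move=> jk; have : Vk^T *m (Pr *m x) = 0.
  by rewrite mulmxA mulmxBr mulmx1 !mulmxA hWd mul1mx subrr mul0mx.
move/colP => /(_ (Ordinal jk)); rewrite /Vk /top_vecs trmx_mul isel_tr -mulmxA.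
by rewrite isel_mulE extcE [X in _ = X -> _]mxE.
Qed.

(* [A Pr] kills the top [k] directions; imposing [d] more constraints leaves
   only the tail [E]. *)
Lemma R22_sv_compare (V2 : 'M[R]_(n, n - l)) (Q2 : 'M[R]_(m, m - l)) p
    (K : 'M[R]_(p, n - l)) U1 s1 W1 U2 s2 W2 :
  Q2^T *m Q2 = 1%:M -> Q2^T *m A *m V1 = 0 ->
  is_svd (Q2^T *m A *m V2) U1 s1 W1 -> is_svd K U2 s2 W2 ->
  (forall w, sqn (K *m w) = sqn (E *m (Pr *m (V2 *m w)))) ->
  forall i, s1 (i + d)%N <= s2 i.
Proof.
move=> hQ2 h0 h1 h2 hK.
(* [rs] reads the coordinates [k, ..., k + d - 1]. Requiring that they vanish on [V^T Pr x] removes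
   the directions between [Vk] and the tail. *)
pose rs : 'M[R]_(d, n) := \matrix_(a, b) ((k + a == b)%N%:R).
have rsE (x : 'cV[R]_n) (a : 'I_d) (j : 'I_n) : j = (k + a)%N :> nat -> (rs *m x) a 0 = x j 0.
  move=> hj; rewrite mxE (bigD1 j) //= mxE -hj eqxx mul1r big1 ?addr0 // => b hb.
  rewrite mxE -hj; case: eqP => [/val_inj h|]; last by rewrite mul0r.
  by rewrite h eqxx in hb.
apply: (sv_compare (N := rs *m V^T *m Pr *m V2) h1 h2) => w hw.
rewrite hK; set x := V2 *m w.
have -> : Q2^T *m A *m V2 *m w = Q2^T *m (A *m (Pr *m x)).
  by rewrite !mulmxA mulmxBr mulmx1 !mulmxA h0 !mul0mx subr0 /x ?mulmxA.
apply: le_trans (proj_sqn_le _ hQ2) _.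
rewrite (svd_sqn _ hsvd) (tail_sqn hrho); apply: ler_sum => j _.
case: ltnP => hj; last by [].
suff -> : (V^T *m (Pr *m x)) j 0 = 0 by rewrite expr0n !mulr0.
case: (ltnP j k) => hjk; first exact: proj_lead.
have had : (j - k < d)%N by rewrite ltn_subLR.
rewrite -(rsE _ (Ordinal had)) /= ?subnKC //.
by rewrite [_ *m (_ *m (_ *m _))]mulmxA /x 2!mulmxA hw mxE.
Qed.

Let E_top : E *m Vk = 0. Proof. by apply: tail_top; apply: leq_addr. Qed.

(** The rows of [E] are orthogonal to [Vk], so in [E Pr = E - (E V1 Wd) Vk^T] the cross terms vanish
    and squared norms add. Nothing is lost in front of [fsq E], as a bound of the form [1 + C eps]
    demands. *)
Lemma R22_fsq_le :
  fsq (R22 - trunc_svd R22 d) <= fsq E + fsq (E *m V1 *m Wd).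
Proof.
have [V2 [Q2 [hV2 hQ2 h0 hR _]]] := rand_qr_blocks hm hqr.
pose K := E *m Pr *m V2.
have hsv : forall i, (svd R22).1.2 (i + d)%N <= (svd K).1.2 i.
  move: (svdP R22); rewrite /R22 hR => h1.
  apply: (R22_sv_compare hQ2 h0 h1 (svdP K)) => w.
  by rewrite !mulmxA.
rewrite fsq_sub_trunc.
apply: (@le_trans _ _ (\sum_(i < n - l) (svd K).1.2 i ^+ 2)).
  apply: (@sum_shift_le _ _ (fun j => (svd R22).1.2 j ^+ 2)
           (fun j => (svd K).1.2 j ^+ 2)) => i; first exact: sqr_ge0.
  by rewrite ler_pXn2r ?nnegrE ?(svd_ge0 _ (svdP _)).
rewrite -(fsq_svd (svdP K)) -fsq_tr trmx_mul.
apply: le_trans (fsq_mull_le (c := 1) _ _) _.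
  by move=> v; rewrite mul1r; apply: proj_sqn_le.
rewrite mul1r fsq_tr -fsq_tr fsq_trace trmxK.
pose Y := E *m V1 *m Wd.
have -> : E *m Pr = E - Y *m Vk^T by rewrite mulmxBr mulmx1 !mulmxA.
have hVk : Vk^T *m Vk = 1%:M by apply: top_gram.
have -> : (E - Y *m Vk^T)^T = E^T - Vk *m Y^T.
  by rewrite -[Vk in RHS]trmxK -trmx_mul; apply/matrixP => i j; rewrite !mxE.
rewrite mulmxBr !mulmxBl.
have -> : E *m (Vk *m Y^T) = 0 by rewrite mulmxA E_top mul0mx.
have -> : Y *m Vk^T *m E^T = 0 by rewrite -mulmxA -trmx_mul E_top trmx0 mulmx0.
have -> : Y *m Vk^T *m (Vk *m Y^T) = Y *m Y^T.
  by rewrite mulmxA -(mulmxA Y) hVk mulmx1.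
rewrite subr0 sub0r opprK raddfD /=.
by rewrite -[fsq E]fsq_tr -[fsq (_ *m Wd)]fsq_tr !fsq_trace !trmxK.
Qed.

(** A constant factor is allowed here, so the two parts of [E Pr] are estimated separately in
    operator norm. *)
Lemma R22_sv_le b c : 0 <= b -> 0 <= c ->
  (forall z, sqn (Wd *m z) <= c * sqn z) ->
  (forall z, sqn (E *m V1 *m z) <= b * sqn z) ->
  (svd R22).1.2 d ^+ 2 <= 2%:R * s (k + d)%N ^+ 2 + 2%:R * (b * c).
Proof.
move=> b0 c0 hc hb.
have [V2 [Q2 [hV2 hQ2 h0 hR _]]] := rand_qr_blocks hm hqr.
pose K := E *m Pr *m V2.
have : (svd R22).1.2 (0 + d)%N <= (svd K).1.2 0%N.
  move: (svdP R22); rewrite /R22 hR => h1.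
  apply: (R22_sv_compare hQ2 h0 h1 (svdP K)) => w.
  by rewrite !mulmxA.
rewrite add0n => h.
apply: (@le_trans _ _ ((svd K).1.2 0%N ^+ 2)).
  by rewrite ler_pXn2r ?nnegrE ?(svd_ge0 _ (svdP _)).
have hVk : Vk^T *m Vk = 1%:M by apply: top_gram.
apply: svd_top_le (svdP K) _ _ => [|v].
  by apply: addr_ge0; apply: mulr_ge0; rewrite ?ler0n ?sqr_ge0 ?(mulr_ge0 b0).
set x := V2 *m v.
have hx : sqn x = sqn v by rewrite (sqn_mul_gram _ hV2) mul1r.
have -> : K *m v = E *m x + (-1) *: (E *m V1 *m (Wd *m (Vk^T *m x))).
  have -> : K *m v = E *m (Pr *m x) by rewrite !mulmxA.
  have -> : Pr *m x = x - V1 *m (Wd *m (Vk^T *m x)).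
    by rewrite mulmxBl mul1mx !mulmxA.
  by rewrite scaleN1r mulmxBr !mulmxA.
apply: le_trans (sqnD_le _ _) _.
rewrite sqnZ sqrrN expr1n mul1r [leRHS]mulrDl; apply: lerD; rewrite -mulrA ler_pM2l //.
  by rewrite -hx; apply: tail_sqn_le.
apply: le_trans (hb _) _; rewrite -mulrA ler_wpM2l //.
apply: le_trans (hc _) _; rewrite ler_wpM2l // -hx.
exact: proj_sqn_le.
Qed.

End Fixed.

Section Leading.
Variables (m n k l : nat) (hm : (l <= m)%N) (hn : (l <= n)%N).
Variables (A : 'M[R]_(m, n)) (V1 : 'M[R]_(n, l)) (Q : 'M[R]_m) (T : 'M[R]_(m, n)).
Hypothesis hkn : (k <= n)%N.
Hypothesis hqr : rand_qr hn A V1 Q T.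
Let Q1 := lead_cols hm Q.
Let s := (svd A).1.2.
Let V := (svd A).2.
Let hsvd : is_svd A (svd A).1.1 s V := svdP A.
Let hV : orthomx V. Proof. by case: hsvd. Qed.
Let s' := (svd (Q1 *m Q1^T *m A)).1.2.

Lemma lead_sv_le i : s' i <= s i.
Proof.
have [V2 [Q2 [_ _ _ _ [hQ1 _]]]] := rand_qr_blocks hm hqr.
apply: (sv_le (svdP _) hsvd) => v; rewrite -!mulmxA (sqn_mul_gram _ hQ1) mul1r.
exact: proj_sqn_le.
Qed.

(** The test vectors [Y a] lie in the range of [Q1]. The scaling [Z] makes their first [i + 1]
    coordinates in the left singular basis equal to [a] and the others below [k] zero, while those
    from [k] on carry a factor at most [s k]. So [A^T] stretches [a] to length at least [s i |a|],
    although [|Y a|^2] is at most [(1 + r) |a|^2]. *)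
Lemma lead_sv_ge (Wd : 'M[R]_(l, k)) ka c i : (i < k)%N -> 0 < s i ->
  0 <= ka -> 0 <= c ->
  (top_vecs k A)^T *m V1 *m Wd = 1%:M ->
  (forall z, sqn (V1 *m z) <= ka * sqn z) ->
  (forall z, sqn (Wd *m z) <= c * sqn z) ->
  s i <= s' i * (1 + Num.sqrt (ka * c) * (s k / s i)).
Proof.
move=> ik si0 ka0 c0 hWd hV1 hc.
have [V2 [Q2 [_ _ _ _ [hQ1 hP]]]] := rand_qr_blocks hm hqr.
set P := Q1 *m Q1^T in hP.
have PT : P^T = P by rewrite trmx_mul trmxK.
pose Z := rdiag_mx k i.+1 (fun j => if (j <= i)%N then (s j)^-1 else 0).
pose Y := A *m V1 *m Wd *m Z.
have PY : P *m Y = Y by rewrite /Y -(mulmxA _ Wd) mulmxA hP.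
have sj0 j : (j <= i)%N -> 0 < s j.
  by move=> ji; apply: lt_le_trans si0 (svd_mono hsvd ji).
have im : (i < minn m n)%N.
  rewrite ltnNge; apply/negP; case: hsvd => _ _ _ hs _ /hs h.
  by rewrite h ltxx in si0.
have ZE a j : (j < k)%N ->
    extc (Z *m a) j = if (j <= i)%N then (s j)^-1 * extc a j else 0.
  move=> jk; have /= -> := extcE (Z *m a) (Ordinal jk); rewrite rdiag_mulE /=.
  by case: ifP => _; rewrite ?mul0r.
pose x (a : 'cV[R]_i.+1) := V^T *m (V1 *m (Wd *m (Z *m a))).
have YE a : Y *m a = (svd A).1.1 *m (rdiag_mx m n s *m x a).
  by rewrite /Y /x; case: hsvd => _ _ _ _ {1}->; rewrite !mulmxA.
have x_lo a j : (j < k)%N -> extc (x a) j = extc (Z *m a) j.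
  move=> jk; rewrite -[in RHS](mul1mx (Z *m a)) -hWd.
  have /= -> := extcE ((top_vecs k A)^T *m V1 *m Wd *m (Z *m a)) (Ordinal jk).
  by rewrite /top_vecs trmx_mul isel_tr -!mulmxA isel_mulE.
have hZ a : sqn (Z *m a) <= (s i ^+ 2)^-1 * sqn a.
  rewrite sqn_rdiag; last first.
    by move=> j; rewrite (minn_idPr _) // => hj; rewrite leqNgt hj.
  rewrite sqnE mulr_sumr; apply: ler_sum => j _.
  rewrite -ltnS ltn_ord ler_wpM2r ?sqr_ge0 // exprVn lef_pV2 ?posrE ?exprn_gt0 //.
  - by rewrite ler_pXn2r ?nnegrE ?(svd_ge0 _ hsvd) // (svd_mono hsvd) // -ltnS.
  - by apply: sj0; rewrite -ltnS.
set r := ka * c * (s k / s i) ^+ 2.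
have hx a : s k ^+ 2 * sqn (x a) <= r * sqn a.
  rewrite orthomx_sqn // /r exprMn exprVn.
  have : sqn (V1 *m (Wd *m (Z *m a))) <= ka * (c * ((s i ^+ 2)^-1 * sqn a)).
    apply: le_trans (hV1 _) _; rewrite ler_wpM2l //.
    by apply: le_trans (hc _) _; rewrite ler_wpM2l.
  move=> /(ler_wpM2l (sqr_ge0 (s k))) /le_trans; apply.
  by rewrite le_eqVlt; apply/orP; left; apply/eqP; ring.
have hU : orthomx (svd A).1.1 by case: hsvd.
have hY a : sqn (Y *m a) <= (1 + r) * sqn a.
  rewrite YE sqn_ortho // sqn_rdiag; last by case: hsvd.
  rewrite mulrDl mul1r.
  apply: le_trans (lerD (lexx _) (hx a)).
  have -> : sqn a = \sum_(j < n) extc a j ^+ 2.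
    rewrite sqnE; under eq_bigr => j _ do rewrite -extcE.
    rewrite (@sum_ord_trunc _ i.+1 n (fun j => extc a j ^+ 2)) // => j.
    rewrite (minn_idPl _); last by apply: leq_trans ik hkn.
    by move=> hj; rewrite extc_out // expr0n.
  rewrite sqnE mulr_sumr -big_split /=; apply: ler_sum => j _.
  case: (ltnP j k) => jk; last first.
    apply: le_trans (_ : s k ^+ 2 * x a j 0 ^+ 2 <= _); last first.
      by rewrite lerDr sqr_ge0.
    by rewrite ler_wpM2r ?sqr_ge0 // ler_pXn2r ?nnegrE ?(svd_ge0 _ hsvd) // (svd_mono hsvd).
  apply: le_trans (_ : extc a j ^+ 2 <= _); last first.
    by rewrite lerDl mulr_ge0 ?sqr_ge0.
  rewrite -[x a j 0]extcE x_lo // ZE //; case: leqP => ji.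
    by rewrite -exprMn mulrA divff ?mul1r // gt_eqF // sj0.
  by rewrite expr0n mulr0 sqr_ge0.
have hAY a : s i ^+ 2 * sqn a <= sqn ((P *m A)^T *m (Y *m a)).
  rewrite trmx_mul PT -mulmxA (mulmxA P) PY (svd_sqn _ (svd_tr hsvd)).
  have -> : sqn a = \sum_(j < m) extc a j ^+ 2.
    rewrite sqnE; under eq_bigr => j _ do rewrite -extcE.
    rewrite (@sum_ord_trunc _ i.+1 m (fun j => extc a j ^+ 2)) // => j.
    rewrite (minn_idPl _); last by move: im; rewrite leq_min => /andP[].
    by move=> hj; rewrite extc_out // expr0n.
  rewrite mulr_sumr; apply: ler_sum => j _.
  case: (leqP j i) => ji; last first.
    by rewrite extc_out // expr0n mulr0 mulr_ge0 ?sqr_ge0.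
  apply: ler_pM; rewrite ?sqr_ge0 //.
    by rewrite ler_pXn2r ?nnegrE ?(svd_ge0 _ hsvd) // (svd_mono hsvd).
  rewrite YE mulmxA hU mul1mx rdiag_mulE x_lo ?(leq_ltn_trans ji) // ZE ?(leq_ltn_trans ji) //.
  by rewrite ji mulrA divff ?mul1r // gt_eqF // sj0.
have := sv_lower (svd_tr (svdP (P *m A))) hAY hY; rewrite -/s' => h.
set q := Num.sqrt (ka * c) * (s k / s i).
have q0 : 0 <= q.
  by rewrite mulr_ge0 ?sqrtr_ge0 // divr_ge0 ?(svd_ge0 _ hsvd) // ltW.
have rq : r = q ^+ 2 by rewrite /q exprMn sqr_sqrtr // mulr_ge0.
have s'0 : 0 <= s' i by apply: svd_ge0 (svdP _).
(* Squares are compared through [1 + q^2 <= (1 + q)^2]. *)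
rewrite -(ler_pXn2r (n := 2)) ?nnegrE ?(ltW si0) ?mulr_ge0 ?addr_ge0 //.
apply: le_trans h _; rewrite exprMn ler_wpM2l ?sqr_ge0 // rq sqrrD expr1n mul1r.
by rewrite -addrA lerD2l lerDr mulrn_wge0.
Qed.

End Leading.
End QRBounds.

(** * Trace powers under rank-one updates *)

Section TracePotential.
Context {R : realType}.

Definition spectral k (B U : 'M[R]_k) (la : 'I_k -> R) :=
  [/\ orthomx U, (forall j, 0 <= la j) & B = U *m diag_mx (\row_j la j) *m U^T].

(** An SVD of [G] diagonalizes [G G^T]. Every matrix in the potentials is such a Gram matrix or a
    shift of one, so this is the source of all the eigenvalues below. *)
Lemma spectral_gram k p (G : 'M[R]_(k, p)) U s V : is_svd G U s V ->
  spectral (G *m G^T) U (fun j => s j ^+ 2).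
Proof.
case=> hU hV _ hs hG; split=> // [j|]; first exact: sqr_ge0.
have -> : G *m G^T = U *m (rdiag_mx k p s *m (rdiag_mx k p s)^T) *m U^T.
  rewrite {1 2}hG !trmx_mul trmxK !mulmxA; congr (_ *m _).
  by rewrite -!mulmxA (mulmxA V^T) hV mul1mx.
congr (_ *m _ *m _); apply/matrixP => i j; rewrite !mxE.
case: (ltnP i p) => hi; last first.
  rewrite (hs i); last by rewrite geq_min hi orbT.
  rewrite expr0n mul0rn big1 // => a _; rewrite mxE hs ?mul0rn ?mul0r //.
  by rewrite geq_min hi orbT.
rewrite (bigD1 (Ordinal hi)) //= !mxE /= eqxx mulr1n big1 ?addr0; last first.
  move=> a ha; rewrite !mxE; case: eqP => [h|]; rewrite ?mulr0n ?mul0r //.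
  by case/eqP: ha; apply: val_inj.
rewrite eq_sym -val_eqE /=; case: eqP => [->|_]; first by rewrite !mulr1n expr2.
by rewrite !mulr0n mulr0.
Qed.

Lemma spectral_shift k (B U : 'M[R]_k) la h : 0 <= h -> spectral B U la ->
  spectral (h%:M + B) U (fun j => h + la j).
Proof.
move=> h0 [hU hl hB]; split=> // [j|]; first by rewrite addr_ge0.
rewrite hB.
have -> : h%:M = U *m h%:M *m U^T by rewrite mul_mx_scalar -scalemxAl (mulmx1C hU) scalemx1.
rewrite -mulmxDl -mulmxDr; congr (_ *m _ *m _).
apply/matrixP => i j; rewrite !mxE.
by case: eqP => _; rewrite ?mulr1n ?mulr0n ?addr0.
Qed.

Lemma spectral_pow k (B U : 'M[R]_k) la i : spectral B U la ->
  B ^+ i = U *m diag_mx (\row_j la j ^+ i) *m U^T.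
Proof.
case=> hU _ hB; elim: i => [|i IH].
  rewrite expr0 -[1]/(1%:M : 'M[R]_k) -(mulmx1C hU) -{1}[U]mulmx1.
  by congr (_ *m _ *m _); apply/matrixP => i j; rewrite !mxE expr0.
rewrite exprS IH -[_ * _]/(B *m _) {1}hB -!mulmxA (mulmxA U^T) hU mul1mx.
congr (_ *m _); rewrite !mulmxA; congr (_ *m _); rewrite mulmx_diag.
by congr diag_mx; apply/rowP => j; rewrite !mxE exprS.
Qed.

Lemma spectral_qf k (B U : 'M[R]_k) la v : spectral B U la -> forall i,
  dotp v (B ^+ i *m v) = \sum_j la j ^+ i * (U^T *m v) j 0 ^+ 2.
Proof.
move=> hB i; rewrite (spectral_pow _ hB) -!mulmxA dotp_mulr dotpE.
apply: eq_bigr => j _; rewrite mul_diag_mx !mxE; ring.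
Qed.

Lemma spectral_tr k (B U : 'M[R]_k) la i : spectral B U la ->
  \tr (B ^+ i) = \sum_j la j ^+ i.
Proof.
move=> hB; rewrite (spectral_pow _ hB) mxtrace_mulC mulmxA.
have -> : U^T *m U = 1%:M by case: hB.
by rewrite mul1mx mxtrace_diag; apply: eq_bigr => j _; rewrite mxE.
Qed.

Lemma sqn_dim_gt0 n (v : 'cV[R]_n) : 0 < sqn v -> (0 < n)%N.
Proof. by case: n v => // v; rewrite sqnE big_ord0 ltxx. Qed.

Lemma exists_max n (f : 'I_n -> R) : (0 < n)%N -> exists j, forall i, f i <= f j.
Proof.
case: n f => // n f _; exists [arg max_(j > (ord0 : 'I_n.+1)) f j]%O => i.
by case: arg_maxP => // j _ h; apply: h.
Qed.

(** A Rayleigh quotient is at most the largest eigenvalue, whose power is one term of the trace.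
    Through this a bad direction makes the potential large, ready for Markov's inequality. *)
Lemma spectral_qf_le k (B U : 'M[R]_k) la v i : spectral B U la -> (0 < i)%N ->
  0 < sqn v -> (dotp v (B *m v) / sqn v) ^+ i <= \tr (B ^+ i).
Proof.
move=> hB i0 v0; have [hU hl _] := hB.
rewrite (spectral_tr _ hB).
have [j hj] := exists_max la (sqn_dim_gt0 v0).
apply: (@le_trans _ _ (la j ^+ i)).
  have hq : dotp v (B *m v) = \sum_j la j * (U^T *m v) j 0 ^+ 2.
    have := spectral_qf v hB 1; rewrite expr1 => ->.
    by apply: eq_bigr => ? _; rewrite expr1.
  rewrite lerXn2r ?nnegrE //; last first.
    rewrite ler_pdivrMr // hq -(orthomx_sqn v hU) sqnE mulr_sumr.
    by apply: ler_sum => a _; rewrite ler_wpM2r ?sqr_ge0.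
  rewrite divr_ge0 ?sqn_ge0 // hq; apply: sumr_ge0 => a _.
  by rewrite mulr_ge0 ?sqr_ge0.
by rewrite (bigD1 j) //= lerDl; apply: sumr_ge0 => a _; apply: exprn_ge0.
Qed.

(* Chebyshev's sum inequality for the spectral measure of [v]. *)
Lemma qf_cheb k (B U : 'M[R]_k) la v i j : spectral B U la ->
  dotp v (B ^+ i *m v) * dotp v (B ^+ j *m v) <=
  sqn v * dotp v (B ^+ (i + j) *m v).
Proof.
move=> hB; have [hU hl _] := hB.
rewrite -(orthomx_sqn v hU) sqnE !(spectral_qf _ hB).
set w := fun a => (U^T *m v) a 0 ^+ 2.
rewrite !big_distrlr /=; rewrite -subr_ge0.
set S1 := \sum_a _; set S2 := \sum_a _.
suff h2 : 0 <= (S1 - S2) *+ 2 by lra.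
rewrite mulr2n.
have e1 : S1 = \sum_a \sum_b w b * (la a ^+ (i + j) * w a) by rewrite /S1 exchange_big.
have e2 : S2 = \sum_a \sum_b la b ^+ i * w b * (la a ^+ j * w a).
  by rewrite /S2 exchange_big.
have -> : S1 - S2 + (S1 - S2) =
   \sum_a \sum_b w a * w b * ((la a ^+ i - la b ^+ i) * (la a ^+ j - la b ^+ j)).
  rewrite {2}e1 {2}e2 /S1 /S2 -!sumrB -big_split /=; apply: eq_bigr => a _.
  rewrite -!sumrB -big_split /=; apply: eq_bigr => b _.
  rewrite /w !exprD; ring.
apply: sumr_ge0 => a _; apply: sumr_ge0 => b _.
apply: mulr_ge0; first by rewrite mulr_ge0 ?sqr_ge0.
case: (leP (la a) (la b)) => h.
  by rewrite -mulrNN !opprB mulr_ge0 // subr_ge0 lerXn2r ?nnegrE.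
by rewrite mulr_ge0 // subr_ge0 lerXn2r ?nnegrE // ltW.
Qed.

Lemma spectral_qf_ge0 k (B U : 'M[R]_k) la v i : spectral B U la ->
  0 <= dotp v (B ^+ i *m v).
Proof.
move=> hB; have [_ hl _] := hB; rewrite (spectral_qf _ hB).
by apply: sumr_ge0 => j _; rewrite mulr_ge0 ?sqr_ge0 ?exprn_ge0.
Qed.

Lemma spectral_sym k (B U : 'M[R]_k) la i : spectral B U la -> (B ^+ i)^T = B ^+ i.
Proof.
by move=> hB; rewrite (spectral_pow _ hB) !trmx_mul trmxK tr_diag_mx mulmxA.
Qed.

Section RankOne.
Variables (k : nat) (B U B' U' : 'M[R]_k) (la la' : 'I_k -> R) (v : 'cV[R]_k) (sg : R).
Hypothesis hB : spectral B U la.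
Hypothesis hB' : spectral B' U' la'.
Hypothesis B'E : B' = B + sg *: (v *m v^T).

Let a i := dotp v (B ^+ i *m v).
Let b i := dotp v (B' ^+ i *m v).
(** Mixed powers [B^i B'^s] interpolate between [B^p] and [B'^p]: exchanging one factor at a time
    produces only products of quadratic forms in [v], although [B] and [v v^T] need not commute. *)
Let c i s := dotp v (B ^+ i *m (B' ^+ s *m v)).
Let t i s := \tr (B ^+ i *m B' ^+ s).

Let c0 i : c i 0 = a i. Proof. by rewrite /c expr0 mul1mx. Qed.
Let c0s s : c 0 s = b s. Proof. by rewrite /c expr0 mul1mx. Qed.

Let BB' i s : B ^+ i *m B' ^+ s.+1 =
  B ^+ i.+1 *m B' ^+ s + sg *: (B ^+ i *m v *m (v^T *m B' ^+ s)).
Proof.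
rewrite [B' ^+ s.+1]exprS -[B' * _]/(B' *m _) {1}B'E mulmxA mulmxDr mulmxDl exprSr.
by rewrite -scalemxAr -scalemxAl !mulmxA.
Qed.

Let cS i s : c i s.+1 = c i.+1 s + sg * (a i * b s).
Proof.
rewrite /c !mulmxA BB' mulmxDl dotpDr -scalemxAl dotpZr; congr (_ + _ * _).
rewrite -!mulmxA [v^T *m _]mx11_scalar mul_mx_scalar -scalemxAr dotpZr mulrC.
by congr (_ * _).
Qed.

Let tS i s : t i s.+1 = t i.+1 s + sg * c i s.
Proof.
rewrite /t BB' mxtraceD mxtraceZ; congr (_ + _ * _).
rewrite mxtrace_mulC -!mulmxA /c.
have -> : \tr (v^T *m (B' ^+ s *m (B ^+ i *m v))) = dotp v (B' ^+ s *m (B ^+ i *m v)).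
  by rewrite /dotp /mxtrace big_ord1.
by rewrite dotp_mulr (spectral_sym _ hB') dotp_mulr (spectral_sym _ hB) dotpC.
Qed.

Let a_ge0 i : 0 <= a i. Proof. exact: spectral_qf_ge0 hB. Qed.
Let b_ge0 i : 0 <= b i. Proof. exact: spectral_qf_ge0 hB'. Qed.

Hypothesis v1 : sqn v <= 1.

Let aM i j : a i * a j <= a (i + j)%N.
Proof. by apply: le_trans (qf_cheb v i j hB) _; apply: ler_piMl v1; apply: a_ge0. Qed.

(** A second-order expansion: the upper bound [c_le] feeds the lower bound [c_ge], which feeds the
    upper bound on the trace. Chebyshev's inequality [aM] collapses each product [a i * a s] into
    one moment. For [p <= 1] the truncated predecessors come with coefficient zero. *)
Lemma trace_pow_sub p : sg = -1 ->
  \tr (B' ^+ p) <= \tr (B ^+ p) - p%:R * a p.-1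
     + p%:R * (p%:R - 1) / 2%:R * a p.-2.
Proof.
move=> hsg.
have c_le i s : c i s <= a (i + s)%N.
  elim: s i => [|s IH] i; first by rewrite c0 addn0.
  rewrite cS hsg mulN1r -addSnnS; apply: le_trans (IH _).
  by rewrite gerBl mulr_ge0.
have c_ge i s : a (i + s)%N - s%:R * a (i + s).-1 <= c i s.
  elim: s i => [|s IH] i; first by rewrite c0 addn0 mul0r subr0.
  rewrite cS hsg mulN1r -addSnnS /=.
  have h1 := IH i.+1; rewrite addSn /= in h1.
  have h2 : a i * b s <= a (i + s)%N.
    by apply: le_trans (aM _ _); rewrite ler_wpM2l // -c0s; apply: c_le.
  rewrite -natr1 mulrDl mul1r addSn; lra.
have t_le i s : t i s <= t (i + s)%N 0 - s%:R * a (i + s).-1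
     + s%:R * (s%:R - 1) / 2%:R * a (i + s).-2.
  elim: s i => [|s IH] i; first by rewrite addn0 !mul0r subr0 addr0.
  rewrite tS hsg mulN1r -addSnnS.
  have h1 := IH i.+1; have h2 := c_ge i s; rewrite !addSn /= in h1 *.
  rewrite -natr1; set x := s%:R in h1 h2 *; set y := a (i + s)%N in h1 h2 *.
  set z := a (i + s).-1 in h1 h2 *.
  have -> : (x + 1) * (x + 1 - 1) / 2%:R * z = x * (x - 1) / 2%:R * z + x * z by field.
  rewrite [(x + 1) * y]mulrDl mul1r; lra.
have := t_le 0 p; rewrite /t !expr0 !mulmx1 add0n.
by rewrite mul1mx.
Qed.

(** Now the higher-order terms have the unfavourable sign. With all eigenvalues at least [h], each
    of them loses a factor [h^-1], and together they cost [(1 + h^-1)^p]. *)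
Lemma trace_pow_add h p : sg = 1 -> 1 <= h -> (forall j, h <= la j) ->
  \tr (B' ^+ p) <= \tr (B ^+ p) + p%:R * (1 + h^-1) ^+ p * a p.-1.
Proof.
move=> hsg h1 hla; have h0 : 0 < h by apply: lt_le_trans h1.
have aS i : a i <= h^-1 * a i.+1.
  rewrite mulrC ler_pdivlMr // /a !(spectral_qf _ hB) mulr_suml.
  apply: ler_sum => j _; have [_ hl _] := hB.
  by rewrite mulrAC ler_wpM2r ?sqr_ge0 // exprSr ler_wpM2l ?exprn_ge0.
set q := 1 + h^-1; have q1 : 1 <= q by rewrite lerDl invr_ge0 ltW.
have q0 : 0 <= q by apply: le_trans q1.
have c_le i s : c i s <= q ^+ s * a (i + s)%N.
  elim: s i => [|s IH] i; first by rewrite c0 addn0 mul1r.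
  rewrite cS hsg mul1r addnS exprS {1}/q mulrDl mul1r mulrDl.
  apply: lerD; first by have := IH i.+1; rewrite addSn.
  apply: le_trans (_ : a i * (q ^+ s * a s) <= _).
    by rewrite ler_wpM2l // -c0s; apply: IH.
  rewrite mulrCA (mulrC h^-1) -mulrA ler_wpM2l ?exprn_ge0 //.
  exact: le_trans (aM _ _) (aS _).
have t_le i s : t i s <= t (i + s)%N 0 + s%:R * q ^+ s * a (i + s).-1.
  elim: s i => [|s IH] i; first by rewrite addn0 !mul0r addr0.
  rewrite tS hsg mul1r.
  have h2 := IH i.+1; have h3 := c_le i s; rewrite !addnS !addSn /= in h2 *.
  have h4 : q ^+ s * a (i + s)%N <= q ^+ s.+1 * a (i + s)%N.
    by rewrite ler_wpM2r // exprS ler_peMl ?exprn_ge0.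
  have h5 : s%:R * (q ^+ s * a (i + s)%N) <= s%:R * (q ^+ s.+1 * a (i + s)%N).
    by rewrite ler_wpM2l.
  rewrite -natr1 -mulrA mulrDl mul1r; rewrite -mulrA in h2; lra.
have := t_le 0 p; rewrite /t !expr0 !mulmx1 add0n.
by rewrite mul1mx.
Qed.

End RankOne.
End TracePotential.

(** * Uniform probabilities and subset averages *)

Section Averages.
Context {R : realType}.

Definition avg (T : finType) (F : T -> R) : R := (\sum_w F w) / #|T|%:R.

Lemma unif_probE (T : finType) (E : T -> Prop) :
  unif_prob E = avg (fun w => (`[< E w >])%:R) :> R.
Proof.
rewrite /unif_prob /avg; congr (_ / _); rewrite -sum1_card natr_sum.
rewrite big_mkcond /=; apply: eq_bigr => w _; rewrite inE.
by case: asbool.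
Qed.

Lemma avg_le (T : finType) (F G : T -> R) : (forall w, F w <= G w) -> avg F <= avg G.
Proof.
by move=> h; rewrite /avg ler_wpM2r ?invr_ge0 // ler_sum.
Qed.

Lemma avgD (T : finType) (F G : T -> R) : avg (fun w => F w + G w) = avg F + avg G.
Proof. by rewrite /avg big_split mulrDl. Qed.

Lemma avgZ (T : finType) a (F : T -> R) : avg (fun w => a * F w) = a * avg F.
Proof. by rewrite /avg -mulr_sumr mulrA. Qed.

Lemma avg_cst (T : finType) (a : R) : (0 < #|T|)%N -> avg (fun _ : T => a) = a.
Proof.
by move=> h; rewrite /avg sumr_const -[X in X / _]mulr_natr mulfK // pnatr_eq0 -lt0n.
Qed.

Lemma avg_sum (T : finType) (I : Type) (r : seq I) (P : pred I) (F : I -> T -> R) :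
  avg (fun w => \sum_(i <- r | P i) F i w) = \sum_(i <- r | P i) avg (F i).
Proof. by rewrite /avg exchange_big /= mulr_suml. Qed.

Lemma unif_prob_ge0 (T : finType) (E : T -> Prop) : 0 <= unif_prob E :> R.
Proof. by rewrite /unif_prob divr_ge0. Qed.

Lemma unif_prob_le (T : finType) (E F : T -> Prop) : (forall w, E w -> F w) ->
  unif_prob E <= unif_prob F :> R.
Proof.
move=> h; rewrite !unif_probE; apply: avg_le => w.
by case: asboolP => // /h hF; case: asboolP.
Qed.

Lemma unif_prob_or (T : finType) (E F : T -> Prop) :
  unif_prob (fun w => E w \/ F w) <= unif_prob E + unif_prob F :> R.
Proof.
rewrite !unif_probE -avgD; apply: avg_le => w.
case: asboolP => [[h|h]|_]; rewrite ?addr_ge0 //.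
  by rewrite (asboolT h) lerDl.
by rewrite (asboolT h) lerDr.
Qed.

Lemma unif_prob_exists (T : finType) n (E : 'I_n -> T -> Prop) x :
  (forall j, unif_prob (E j) <= x) ->
  unif_prob (fun w => exists j, E j w) <= n%:R * x :> R.
Proof.
move=> h; apply: (@le_trans _ _ (\sum_(j < n) unif_prob (E j))); last first.
  apply: le_trans (ler_sum _ (fun j _ => h j)) _.
  by rewrite sumr_const card_ord mulr_natl.
rewrite unif_probE; under eq_bigr => j _ do rewrite unif_probE.
rewrite -avg_sum; apply: avg_le => w; case: asboolP => [[j hj]|_].
  by rewrite (bigD1 j) //= (asboolT hj) lerDl sumr_ge0.
by rewrite sumr_ge0.
Qed.

Lemma unif_prob_not (T : finType) (Bad E : T -> Prop) x : (0 < #|T|)%N ->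
  (forall w, ~ Bad w -> E w) -> unif_prob Bad <= x -> 1 - x <= unif_prob E :> R.
Proof.
move=> T0 h hx; rewrite lerBlDr; apply: le_trans (lerD (lexx _) hx).
rewrite -[leLHS](@avg_cst T) // !unif_probE -avgD; apply: avg_le => w.
case: (asboolP (Bad w)) => hB; first by rewrite lerDr.
by rewrite (asboolT (h _ hB)) lerDl.
Qed.

Lemma markov_avg (T : finType) (E : T -> Prop) (F : T -> R) c : 0 < c ->
  (forall w, 0 <= F w) -> (forall w, E w -> c <= F w) ->
  unif_prob E <= avg F / c.
Proof.
move=> c0 F0 h; rewrite ler_pdivlMr // mulrC unif_probE -avgZ; apply: avg_le => w.
case: asboolP => hE; first by rewrite mulr1; apply: h.
by rewrite mulr0.
Qed.

Lemma avg_pair (T1 T2 : finType) (F : T1 * T2 -> R) :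
  avg F = avg (fun b => avg (fun a => F (a, b))).
Proof.
rewrite /avg -mulr_suml -mulrA -invfM -natrM card_prod; congr (_ / _).
by rewrite exchange_big pair_big; apply: eq_bigr => -[].
Qed.

Lemma unif_prob_snd (T1 T2 : finType) (B : T2 -> Prop) : (0 < #|T1|)%N ->
  unif_prob (fun w : T1 * T2 => B w.2) = unif_prob B :> R.
Proof.
by move=> h; rewrite !unif_probE avg_pair; congr avg; apply/funext => b; rewrite /= avg_cst.
Qed.

Lemma unif_prob_pair (T1 T2 : finType) (E : T1 * T2 -> Prop) x : (0 < #|T2|)%N ->
  (forall b, unif_prob (fun a => E (a, b)) <= x) -> unif_prob E <= x :> R.
Proof.
move=> h hx; rewrite unif_probE avg_pair -[x](@avg_cst T2) //; apply: avg_le => b.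
by apply: le_trans (hx b); rewrite unif_probE.
Qed.

(** In the applications the second component is the sign vector: [Bad] says that the signs fail to
    flatten the columns, and for all other signs the random sample alone is responsible. *)
Lemma unif_prob_cond (T1 T2 : finType) (E : T1 * T2 -> Prop) (Bad : T2 -> Prop) x :
  (0 < #|T1|)%N -> (0 < #|T2|)%N -> 0 <= x ->
  (forall b, ~ Bad b -> unif_prob (fun a => E (a, b)) <= x) ->
  unif_prob E <= unif_prob Bad + x :> R.
Proof.
move=> h1 h2 x0 h; rewrite -(unif_prob_snd Bad h1).
apply: (@le_trans _ _ (unif_prob (fun w => Bad w.2 \/ (E w /\ ~ Bad w.2)))).
  by apply: unif_prob_le => w hE; case: (pselect (Bad w.2)); [left|right].
apply: le_trans (unif_prob_or _ _) _; rewrite lerD2l.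
apply: unif_prob_pair => // b; case: (pselect (Bad b)) => hb; last first.
  by apply: le_trans (h b hb); apply: unif_prob_le => a [].
rewrite unif_probE [avg _](_ : _ = 0) // /avg big1 ?mul0r // => a _.
by case: asboolP => // -[].
Qed.

Definition savg n s (F : {set 'I_n} -> R) : R :=
  (\sum_(S : {set 'I_n} | #|S| == s) F S) / 'C(n, s)%:R.

Definition sprob n s (E : {set 'I_n} -> Prop) : R :=
  savg s (fun S => (`[< E S >])%:R).

Lemma savg_le n s (F G : {set 'I_n} -> R) :
  (forall S : {set 'I_n}, #|S| = s -> F S <= G S) -> savg s F <= savg s G.
Proof.
move=> h; rewrite /savg; apply: ler_wpM2r; rewrite ?invr_ge0 //.
by apply: ler_sum => S /eqP; apply: h.
Qed.

Lemma savgZD n s (F : {set 'I_n} -> R) a b : (s <= n)%N ->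
  savg s (fun S => a * F S + b) = a * savg s F + b.
Proof.
move=> sn; rewrite /savg big_split mulrDl -mulr_sumr mulrA; congr (_ + _).
rewrite sumr_const -cardsE card_draws card_ord -[X in X / _]mulr_natr mulfK //.
by rewrite pnatr_eq0 -lt0n bin_gt0.
Qed.

Lemma savgZ n s (F : {set 'I_n} -> R) a :
  savg s (fun S => a * F S) = a * savg s F.
Proof. by rewrite /savg -mulr_sumr mulrA. Qed.

Lemma savg0 n (F : {set 'I_n} -> R) : savg 0 F = F finset.set0.
Proof.
rewrite /savg bin0 divr1 (bigD1 finset.set0) ?cards0 //= big1 ?addr0 // => S.
by rewrite cards_eq0 => /andP[/eqP ->]; rewrite eqxx.
Qed.

(** Pairs of an [s]-set and a new index correspond to pairs of an [(s+1)]-set and one of its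
    elements. Hence a uniform [(s+1)]-set is a uniform [s]-set plus a uniform new index, and this is
    the induction step of every potential argument. *)
Lemma savgS n s (F : {set 'I_n} -> R) : (s < n)%N ->
  savg s.+1 F = savg s (fun S => (\sum_(j | j \notin S) F (j |: S)) / (n - s)%:R).
Proof.
move=> sn; rewrite /savg -mulr_suml -mulrA -invfM -natrM.
have -> : ((n - s) * 'C(n, s) = s.+1 * 'C(n, s.+1))%N by rewrite -mul_bin_left.
rewrite natrM invfM mulrA; congr (_ / _).
apply: (canRL (mulfK _)); first by rewrite pnatr_eq0.
rewrite mulr_suml.
transitivity (\sum_(T : {set 'I_n} | #|T| == s.+1) \sum_(j in T) F T).
  by apply: eq_bigr => T /eqP hT; rewrite sumr_const hT mulr_natr.
rewrite !pair_big_dep /=.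
rewrite (reindex_onto (fun p : {set 'I_n} * 'I_n => (p.2 |: p.1, p.2))
          (fun p => (p.1 :\ p.2, p.2))) /=; last first.
  by move=> [T j] /= /andP[_ h]; rewrite finset.setD1K.
apply: eq_big => [[S j]|[S j] _] //=.
rewrite finset.setU11 andbT; apply/andP/andP => -[].
  move=> h1 /eqP [h2]; have hj : j \notin S by rewrite -h2 !inE eqxx.
  by rewrite hj; move: h1; rewrite cardsU1 hj.
move=> /eqP h1 h2; rewrite cardsU1 h2 h1 eqxx; split=> //.
by rewrite finset.setU1K.
Qed.

Lemma savg_compl n s (F : {set 'I_n} -> R) : (s <= n)%N ->
  savg (n - s)%N F = savg s (fun S => F (~: S)).
Proof.
move=> sn; rewrite /savg bin_sub //; congr (_ / _).
rewrite (reindex_inj (inv_inj (@finset.setCK _))) /=; apply: eq_bigl => S.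
rewrite cardsCs finset.setCK card_ord; have := max_card S; rewrite card_ord => h.
by move: h; set c := #|S|; move=> h; apply/eqP/eqP; lia.
Qed.

Lemma markov_savg n s (E : {set 'I_n} -> Prop) (F : {set 'I_n} -> R) c : 0 < c ->
  (forall S, 0 <= F S) -> (forall S : {set 'I_n}, #|S| = s -> E S -> c <= F S) ->
  sprob s E <= savg s F / c.
Proof.
move=> c0 F0 h; rewrite ler_pdivlMr // mulrC /sprob -savgZ; apply: savg_le => S hS.
case: asboolP => hE; first by rewrite mulr1; apply: h.
by rewrite mulr0.
Qed.

Definition inj_space s n := {f : {ffun 'I_s -> 'I_n} | injectiveb f}.

Definition samp s n (f : inj_space s n) : {set 'I_n} := val f @: finset.setT.

Lemma card_inj_space s n : #|{: inj_space s n}| = (n ^_ s)%N.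
Proof.
by rewrite card_sig -[in RHS](card_ord n) -[in RHS](card_ord s) -card_inj_ffuns
           cardsE; apply: eq_card => f; rewrite !inE.
Qed.

(** Each [s]-set is the image of exactly [s!] injections, so the ordered sample induces the uniform
    law on subsets. *)
Lemma avg_samp s n (F : {set 'I_n} -> R) : (s <= n)%N ->
  avg (fun f : inj_space s n => F (samp f)) = savg s F.
Proof.
move=> sn; rewrite /avg card_inj_space.
have -> : \sum_(f : inj_space s n) F (samp f) =
    \sum_(f : {ffun 'I_s -> 'I_n} | injectiveb f) F (f @: finset.setT).
  rewrite (reindex_omap (val : inj_space s n -> _) insub) => [|f hf]; last by rewrite insubT.
  by apply: eq_bigl => f; rewrite (valP f) /= valK eqxx.
rewrite (partition_big (fun f : {ffun 'I_s -> 'I_n} => f @: finset.setT)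
           (fun S => #|S| == s)) /=; last first.
  by move=> f /injectiveP fi; rewrite card_imset // cardsT card_ord.
have -> : \sum_(S : {set 'I_n} | #|S| == s)
      \sum_(f : {ffun 'I_s -> 'I_n} | injectiveb f && (f @: finset.setT == S)) F (f @: finset.setT)
   = \sum_(S : {set 'I_n} | #|S| == s) (s`!)%:R * F S.
  apply: eq_bigr => S /eqP hS.
  rewrite (eq_bigr (fun=> F S)) => [|f /andP[_ /eqP -> //]].
  rewrite sumr_const mulr_natl; congr (_ *+ _).
  have := card_inj_ffuns_on 'I_s (mem S); rewrite card_ord hS ffactnn => <-.
  rewrite cardsE; apply: eq_card => f; rewrite -!topredE /= andbC [in RHS]andbC.
  case: (boolP (injectiveb f)) => [/injectiveP fi|]; rewrite ?andbF ?andbT //=.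
  apply/eqP/ffun_onP => [hf i|hf].
    by rewrite -hf; apply: imset_f.
  apply/eqP; rewrite eqEcard hS card_imset // cardsT card_ord leqnn andbT.
  by apply/fintype.subsetP => _ /imsetP[i _ ->]; apply: hf.
rewrite -mulr_sumr /savg -bin_ffact natrM (mulrC (s`!)%:R) -mulf_div divff ?mulr1 //.
Qed.

Lemma unif_prob_samp s n (E : {set 'I_n} -> Prop) : (s <= n)%N ->
  unif_prob (fun f : inj_space s n => E (samp f)) = sprob s E :> R.
Proof. by move=> sn; rewrite unif_probE /sprob -avg_samp. Qed.

End Averages.

(** * Sampling without replacement: lower tail *)

Section Sampling.
Context {R : realType}.

Lemma expR_half_le : expR (2%:R^-1) <= 2%:R :> R.
Proof.
have := expR_ge1Dx (- 2%:R^-1 : R); rewrite expRN => h.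
have e0 := expR_gt0 (2%:R^-1 : R).
rewrite -[leLHS]invrK -[leRHS]invrK lef_pV2 ?posrE ?invr_gt0 ?ltr0n //.
by apply: le_trans h; lra.
Qed.

Lemma expR1_le4 : expR 1 <= 4%:R :> R.
Proof.
rewrite [X in expR X](_ : 1 = 2%:R^-1 + 2%:R^-1 :> R); last by lra.
rewrite expRD (_ : 4%:R = 2%:R * 2%:R :> R); last by rewrite -natrM.
by rewrite ler_pM ?expR_ge0 ?expR_half_le.
Qed.

(** Since [16 >= e^2], a Markov threshold 16 times the base level turns moment growth [e^p] into a
    probability [e^-p]. *)
Lemma expR2n_le p : expR (2%:R * p%:R) <= 16%:R ^+ p :> R.
Proof.
rewrite mulrC expRM_natl lerXn2r ?nnegrE ?expR_ge0 //.
rewrite -[2%:R]mulr1 expRM_natl (_ : 16%:R = 4%:R ^+ 2 :> R); last by rewrite -natrX.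
by rewrite lerXn2r ?nnegrE ?expR_ge0 ?expR1_le4.
Qed.

Lemma exprB1_le x l : x <= 1 -> (1 - x) ^+ l <= expR (- (l%:R * x)) :> R.
Proof.
move=> x1; rewrite -mulrN expRM_natl lerXn2r ?nnegrE ?expR_ge0 ?subr_ge0 //.
exact: expR_ge1Dx.
Qed.

Section Covariance.
Variables (n k : nat) (v : 'I_n -> 'cV[R]_k).
Implicit Types S : {set 'I_n}.

(** Columns outside [S] are set to zero instead of deleted, so that all subsets share one matrix
    type. *)
Definition gmx S : 'M[R]_(k, n) := \matrix_(i, j) (if j \in S then v j i 0 else 0).

Definition covmx S : 'M[R]_k := gmx S *m (gmx S)^T.

Lemma gmx_trE S u j : ((gmx S)^T *m u) j 0 = if j \in S then dotp (v j) u else 0.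
Proof.
rewrite mxE dotpE; case: ifP => hj.
  by apply: eq_bigr => i _; rewrite !mxE hj.
by rewrite big1 // => i _; rewrite !mxE hj mul0r.
Qed.

Lemma gmx_sqn S u : sqn ((gmx S)^T *m u) = \sum_(j in S) dotp (v j) u ^+ 2.
Proof.
rewrite sqnE [RHS]big_mkcond; apply: eq_bigr => j _; rewrite gmx_trE.
by case: ifP => // _; rewrite expr0n.
Qed.

Lemma covE S : covmx S = \sum_(j in S) v j *m (v j)^T.
Proof.
apply/matrixP => a b; rewrite mxE summxE [RHS]big_mkcond; apply: eq_bigr => j _.
by rewrite !mxE; case: ifP => _; rewrite ?mul0r // big_ord1 !mxE.
Qed.

Lemma covmx_qf S u : dotp u (covmx S *m u) = \sum_(j in S) dotp (v j) u ^+ 2.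
Proof. by rewrite -gmx_sqn /covmx -mulmxA dotp_mulr dotp_vv. Qed.

Lemma covmx_setC_add S j : j \notin S ->
  covmx (~: (j |: S)) = covmx (~: S) + (-1) *: (v j *m (v j)^T).
Proof.
move=> hj; rewrite !covE [in RHS](big_setD1 j) ?inE //= scaleN1r.
have -> : (~: S) :\ j = ~: (j |: S).
  by apply/setP => i; rewrite !inE negb_or.
by rewrite addrAC subrr add0r.
Qed.

Lemma covmx_add S j : j \notin S ->
  covmx (j |: S) = covmx S + 1 *: (v j *m (v j)^T).
Proof. by move=> hj; rewrite !covE big_setU1 //= scale1r addrC. Qed.

Definition cov_eig S (j : 'I_k) : R := (svd (gmx S)).1.2 j ^+ 2.

Lemma cov_spectral S : spectral (covmx S) (svd (gmx S)).1.1 (cov_eig S).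
Proof. exact: spectral_gram (svdP _). Qed.

Lemma cov_eig_mono S S' j : S \subset S' -> cov_eig S j <= cov_eig S' j.
Proof.
move=> hS; rewrite /cov_eig lerXn2r ?nnegrE ?(svd_ge0 _ (svdP _)) //.
apply: sv_le (svd_tr (svdP _)) (svd_tr (svdP _)) _ _ => u.
rewrite !gmx_sqn [leLHS]big_mkcond [leRHS]big_mkcond; apply: ler_sum => i _.
case: ifP => hi; first by rewrite (fintype.subsetP hS).
by case: ifP => _ //; rewrite sqr_ge0.
Qed.

Lemma card_notin S s : #|S| = s -> #|[pred j | j \notin S]| = (n - s)%N.
Proof.
move=> hS; have := cardC (mem S); rewrite card_ord hS => h.
have -> : #|[pred j | j \notin S]| = #|[predC mem S]| by apply: eq_card => j; rewrite !inE.
apply: (@addnI s); rewrite h subnKC //.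
by rewrite -h leq_addr.
Qed.

Hypothesis v1 : forall j, sqn (v j) <= 1.

Section Lower.
Variables (N : R) (p : nat).
Hypothesis hN : covmx finset.setT = N%:M.
Hypothesis N0 : 0 < N.
Hypothesis p2 : (2 <= p)%N.

Let B S := covmx (~: S).
Let f S := \tr (B S ^+ p).
Let K : R := k%:R * p%:R ^+ p.

Let fE S : f S = \sum_j cov_eig (~: S) j ^+ p.
Proof. exact: spectral_tr (cov_spectral _). Qed.

Let f_ge0 S : 0 <= f S.
Proof. by rewrite fE sumr_ge0 // => j _; rewrite exprn_ge0 // sqr_ge0. Qed.

Let sum_qf S i :
  \sum_(j | j \notin S) dotp (v j) (B S ^+ i *m v j) = \tr (B S ^+ i.+1).
Proof.
rewrite exprSr -[_ * B S]/(_ *m B S) {3}/B covE mulmx_sumr raddf_sum /=.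
apply: eq_big => [j|j _]; first by rewrite !inE.
by rewrite mulmxA mxtrace_mulC /dotp /mxtrace big_ord1 mulmxA.
Qed.

(** The undrawn vectors have covariance exactly [B S], so the first-order terms sum to [p * f S] and
    the second-order ones to [(p - 1) / 2] times [p * \tr (B S ^+ p.-1)]. The latter trace term is
    at most [f S + K], where [K] pays for the eigenvalues below [p]. *)
Let f_step S s : #|S| = s ->
  \sum_(j | j \notin S) f (j |: S) <= (n - s)%:R * f S - p%:R / 2%:R * (f S - K).
Proof.
move=> hS.
apply: (@le_trans _ _ (\sum_(j | j \notin S) (f S
   - p%:R * dotp (v j) (B S ^+ p.-1 *m v j)
   + p%:R * (p%:R - 1) / 2%:R * dotp (v j) (B S ^+ p.-2 *m v j)))).
  apply: ler_sum => j hj.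
  exact: (trace_pow_sub (cov_spectral _) (cov_spectral _) (covmx_setC_add hj)).
rewrite big_split sumrB /= -!mulr_sumr !sum_qf sumr_const.
rewrite (card_notin hS) !prednK ?(ltn_trans _ p2) //; last by rewrite -ltnS prednK // (ltn_trans _ p2).
rewrite -[f S *+ _]mulr_natl -/(f S) -!addrA lerD2l.
have hkey : p%:R * \tr (B S ^+ p.-1) <= f S + K.
  rewrite (spectral_tr _ (cov_spectral _)) fE mulr_sumr.
  have -> : K = \sum_(j < k) p%:R ^+ p by rewrite sumr_const card_ord /K mulr_natl.
  rewrite -big_split /=; apply: ler_sum => j _; set x := cov_eig _ _.
  have x0 : 0 <= x by apply: sqr_ge0.
  have pE : p = p.-1.+1 by rewrite prednK // (ltn_trans _ p2).
  case: (leP p%:R x) => hx.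
    apply: le_trans (_ : x ^+ p <= _); last by rewrite lerDl exprn_ge0.
    rewrite [in leRHS]pE exprS. by apply: ler_wpM2r => //; apply: exprn_ge0.
  apply: le_trans (_ : p%:R ^+ p <= _); last by rewrite lerDr exprn_ge0.
  rewrite [X in _ <= _ ^+ X]pE exprS; apply: ler_wpM2l => //.
  by apply: lerXn2r; rewrite ?nnegrE // ltW.
have p1 : (2%:R : R) <= p%:R by rewrite ler_nat.
have fp := f_ge0 S; have K0 : 0 <= K by rewrite mulr_ge0 ?exprn_ge0.
set y := \tr (B S ^+ p.-1) in hkey *.
have : (p%:R - 1) / 2%:R * (p%:R * y) <= (p%:R - 1) / 2%:R * (f S + K).
  by rewrite ler_wpM2l //; lra.
rewrite mulrA [_ / _ * p%:R]mulrC mulrA => h1.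
have h2 : 0 <= f S + K by rewrite addr_ge0.
apply: le_trans (lerD (lexx _) h1) _; nra.
Qed.

Let f_mono S j : f (j |: S) <= f S.
Proof.
rewrite !fE; apply: ler_sum => i _; rewrite lerXn2r ?nnegrE ?sqr_ge0 //.
by apply: cov_eig_mono; rewrite finset.setCS finset.subsetUr.
Qed.

(** Above [K] the excess of the mean contracts by [1 - p / (2 n)] at each draw; once the mean is
    below [K], monotonicity of [f] keeps it there. *)
Lemma trace_lower_avg s : (s <= n)%N -> (p <= 2 * n)%N ->
  savg s f <= K + k%:R * N ^+ p * (1 - p%:R / (2%:R * n%:R)) ^+ s.
Proof.
move=> sn pn; elim: s sn => [_|s IH sn].
  have K0 : 0 <= K by rewrite mulr_ge0 ?exprn_ge0.
  rewrite savg0 expr0 mulr1 fE; apply: le_trans (_ : k%:R * N ^+ p <= _); last by rewrite lerDr.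
  rewrite -fE /f /B finset.setC0 hN.
  have -> : (N%:M : 'M[R]_k) ^+ p = (N ^+ p)%:M.
    elim: p => [|q IHq]; first by rewrite !expr0.
    by rewrite !exprS IHq -[_ * _ in LHS]/(_ *m _) -scalar_mxM.
  by rewrite mxtrace_scalar mulr_natl.
have {IH} := IH (ltnW sn); set a := savg s f; set c := 1 - _ => IH.
have ns0 : (0 : R) < (n - s)%:R by rewrite ltr0n subn_gt0.
have h1 : savg s.+1 f <= a.
  rewrite savgS //; apply: savg_le => S hS; rewrite ler_pdivrMr //.
  apply: le_trans (ler_sum _ (fun j _ => f_mono S j)) _.
  by rewrite sumr_const (card_notin hS) mulr_natr.
have h2 : savg s.+1 f <= (1 - p%:R / 2%:R / (n - s)%:R) * a + p%:R / 2%:R / (n - s)%:R * K.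
  rewrite savgS // -savgZD ?(ltnW sn) //; apply: savg_le => S hS.
  rewrite ler_pdivrMr //; apply: le_trans (f_step hS) _.
  rewrite le_eqVlt; apply/orP; left; apply/eqP; field.
  by rewrite gt_eqF.
have n0 : (0 : R) < n%:R by rewrite ltr0n (leq_ltn_trans _ sn).
have c0 : 0 <= c.
  rewrite subr_ge0 ler_pdivrMr ?mulr_gt0 // mul1r -natrM ler_nat //.
have rhs0 : 0 <= k%:R * N ^+ p * c ^+ s.+1 by rewrite !mulr_ge0 ?exprn_ge0 // ltW.
case: (leP a K) => haK; first by apply: le_trans h1 _; apply: le_trans haK _; rewrite lerDl.
apply: le_trans h2 _.
apply: (@le_trans _ _ (K + c * (a - K))).
  have : p%:R / (2%:R * n%:R) <= p%:R / 2%:R / (n - s)%:R :> R.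
    rewrite invfM mulrA ler_wpM2l // ?divr_ge0 // lef_pV2 ?posrE // ler_nat.
    exact: leq_subr.
  rewrite /c; set q1 := _ / _ / _; set q2 := _ / (_ * _); nra.
rewrite lerD2l exprSr mulrA mulrC ler_wpM2r //; lra.
Qed.

(** A sample that is short in direction [u] leaves nearly all of [N |u|^2] to its complement, so
    [f S] is at least [(N (1 - y))^p]. The condition [p <= N / 2] makes [K] comparable with the
    decaying term. With [x = l / n] and [y = x / 16], the gain [exp (- p x / 2)] loses
    [exp (p x / 8)], whence the exponent [3/8]. *)
Lemma chernoff_lower l : (l <= n)%N -> p%:R <= N / 2%:R -> (p <= 2 * n)%N ->
  sprob l (fun S => exists2 u, u != 0 &
     \sum_(j in S) dotp (v j) u ^+ 2 < l%:R / (16%:R * n%:R) * N * sqn u)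
  <= 2%:R * k%:R * expR (- (3%:R * (p%:R * (l%:R / n%:R)) / 8%:R)) :> R.
Proof.
move=> ln pN pn.
have n0 : (0 : R) < n%:R by rewrite ltr0n; lia.
set x := l%:R / n%:R.
have x0 : 0 <= x by rewrite divr_ge0.
have x1 : x <= 1 by rewrite ler_pdivrMr // mul1r ler_nat.
have -> : l%:R / (16%:R * n%:R) = x / 16%:R by rewrite /x invfM mulrCA mulrC.
set y := x / 16%:R; have y0 : 0 <= y by rewrite /y; lra.
have y1 : y <= 2%:R^-1 by rewrite /y; lra.
have Ny : 0 < N * (1 - y) by rewrite mulr_gt0 //; lra.
apply: le_trans (markov_savg (F := f) (c := (N * (1 - y)) ^+ p) _ _ _) _ => //.
- exact: exprn_gt0.
- move=> S _ [u u0 hu]; have up := sqn_gt0 u0.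
  apply: le_trans (spectral_qf_le (i := p) (cov_spectral _) _ up); last by lia.
  rewrite lerXn2r ?nnegrE ?(ltW Ny) ?divr_ge0 ?(ltW up) //.
    by rewrite covmx_qf; apply: sumr_ge0 => i _; apply: sqr_ge0.
  rewrite ler_pdivlMr // covmx_qf.
  have : dotp u (covmx finset.setT *m u) = N * sqn u.
    by rewrite hN mul_scalar_mx dotpZr.
  rewrite covmx_qf (big_setID S) /= finset.setTI finset.setTD => h.
  have : \sum_(j in S) dotp (v j) u ^+ 2 < y * N * sqn u by [].
  lra.
have pos : (0 : R) < 1 - y by lra.
rewrite ler_pdivrMr ?exprn_gt0 //.
apply: le_trans (trace_lower_avg ln pn) _.
have e1 : K <= k%:R * N ^+ p * expR (- (p%:R * x / 2%:R)).
  rewrite /K -mulrA ler_wpM2l //.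
  apply: (@le_trans _ _ ((N / 2%:R) ^+ p)).
    by apply: lerXn2r; rewrite ?nnegrE //; rewrite divr_ge0 // ltW.
  rewrite exprMn ler_wpM2l ?exprn_ge0 ?(ltW N0) //.
  apply: (@le_trans _ _ (expR (- 2%:R^-1) ^+ p)).
    rewrite lerXn2r ?nnegrE ?expR_ge0 ?invr_ge0 //.
    by rewrite expRN lef_pV2 ?posrE ?expR_gt0 // expR_half_le.
  rewrite -expRM_natl ler_expR mulrN lerN2 mulrAC -mulrA ler_wpM2l //; lra.
have e2 : (1 - p%:R / (2%:R * n%:R)) ^+ l <= expR (- (p%:R * x / 2%:R)).
  apply: le_trans (exprB1_le _ _) _.
    by rewrite ler_pdivrMr ?mulr_gt0 // mul1r -natrM ler_nat.
  rewrite ler_expR lerN2 le_eqVlt; apply/orP; left; apply/eqP; rewrite /x; field.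
  by rewrite gt_eqF.
have e3 : expR (- (p%:R * x / 8%:R)) <= (1 - y) ^+ p.
  have -> : - (p%:R * x / 8%:R) = p%:R * (- (2%:R * y)) :> R by rewrite /y; lra.
  rewrite expRM_natl lerXn2r ?nnegrE ?expR_ge0 ?(ltW pos) //.
  have := expR_ge1Dx (2%:R * y); have := expR_gt0 (2%:R * y).
  rewrite expRN; set E := expR _ => E0 E1.
  rewrite -[leRHS]invrK lef_pV2 ?posrE ?invr_gt0 //.
  apply: le_trans E1; rewrite -[leRHS]mulr1 -ler_pdivrMl; last lra.
  rewrite -invfM -[leRHS]invr1 lef_pV2 ?posrE ?mulr_gt0 //; nra.
rewrite exprMn.
have kN : 0 <= k%:R * N ^+ p by rewrite mulr_ge0 ?exprn_ge0 // ltW.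
apply: (@le_trans _ _ (2%:R * (k%:R * N ^+ p * expR (- (p%:R * x / 2%:R))))).
  by apply: le_trans (lerD e1 (ler_wpM2l kN e2)) _; lra.
apply: (@le_trans _ _ (2%:R * k%:R * expR (- (3%:R * (p%:R * x) / 8%:R))
    * (N ^+ p * expR (- (p%:R * x / 8%:R))))); last first.
  rewrite ler_wpM2l ?mulr_ge0 ?expR_ge0 // ler_wpM2l ?exprn_ge0 //; exact: ltW.
have -> : - (p%:R * x / 2%:R) = - (3%:R * (p%:R * x) / 8%:R) - p%:R * x / 8%:R :> R by lra.
rewrite expRD le_eqVlt; apply/orP; left; apply/eqP; ring.
Qed.

End Lower.

End Covariance.
End Sampling.

(** * Sampling without replacement: upper tail and vector Bernstein *)

Section Sampling2.
Context {R : realType}.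

Section Upper.
Variables (n k : nat) (v : 'I_n -> 'cV[R]_k) (T : R) (p : nat).
Hypothesis v1 : forall j, sqn (v j) <= 1.
Hypothesis hT : forall u, \sum_j dotp (v j) u ^+ 2 <= T * sqn u.
Hypothesis T0 : 0 <= T.
Hypothesis p0 : (0 < p)%N.
Implicit Types S : {set 'I_n}.

(** The shift keeps all eigenvalues at least [p]. Then the factor in [trace_pow_add] is
    [(1 + 1/p)^p <= e], and [p] times the trace of [B^(p-1)] is at most that of [B^p]. *)
Let B S : 'M[R]_k := (p%:R)%:M + covmx v S.
Let U S : 'M[R]_k := (svd (gmx v S)).1.1.
Let la S (j : 'I_k) : R := p%:R + cov_eig v S j.
Let f S : R := \tr (B S ^+ p).

Let B_spectral S : spectral (B S) (U S) (la S).
Proof. by apply: spectral_shift => //; apply: cov_spectral. Qed.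

Let la_ge S j : p%:R <= la S j.
Proof. by rewrite lerDl sqr_ge0. Qed.

Let la0 S j : 0 <= la S j.
Proof. exact: le_trans (la_ge S j). Qed.

Let fE S : f S = \sum_j la S j ^+ p.
Proof. exact: spectral_tr (B_spectral _). Qed.

Let f_ge0 S : 0 <= f S.
Proof. by rewrite fE sumr_ge0 // => j _; rewrite exprn_ge0. Qed.

Let sum_qf S i :
  \sum_(j | j \notin S) dotp (v j) (B S ^+ i *m v j) <= T * \tr (B S ^+ i).
Proof.
apply: (@le_trans _ _ (\sum_j dotp (v j) (B S ^+ i *m v j))).
  rewrite [leLHS]big_mkcond; apply: ler_sum => j _; case: ifP => // _.
  exact: spectral_qf_ge0 (B_spectral S).
under eq_bigr => j _ do rewrite (spectral_qf _ (B_spectral S)).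
rewrite (spectral_tr _ (B_spectral S)) exchange_big mulr_sumr.
apply: ler_sum => a _; rewrite -mulr_sumr mulrC ler_wpM2r ?exprn_ge0 //.
have [hU _ _] := B_spectral S.
have := hT (U S *m delta_mx a 0); rewrite sqn_ortho // sqn_delta mulr1.
apply: le_trans; rewrite le_eqVlt; apply/orP; left; apply/eqP.
apply: eq_bigr => j _; congr (_ ^+ 2).
rewrite dotp_mulr dotpE (bigD1 a) //= [delta_mx a 0 a 0]mxE !eqxx mulr1 big1 ?addr0 // => i0 hi.
by rewrite [delta_mx a 0 i0 0]mxE (negbTE hi) mulr0.
Qed.

Let f_step S s : #|S| = s ->
  \sum_(j | j \notin S) f (j |: S) <= (n - s)%:R * f S + 4%:R * T * f S.
Proof.
move=> hS; have p1 : (1 : R) <= p%:R by rewrite ler1n.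
apply: (@le_trans _ _ (\sum_(j | j \notin S) (f S
   + 4%:R * (p%:R * dotp (v j) (B S ^+ p.-1 *m v j))))).
  apply: ler_sum => j hj.
  have hB' : B (j |: S) = B S + 1 *: (v j *m (v j)^T).
    by rewrite /B (covmx_add _ hj) addrA.
  apply: le_trans (trace_pow_add (B_spectral S) (B_spectral _) hB' (v1 j) p
    erefl p1 (la_ge S)) _.
  rewrite lerD2l -mulrA [leRHS]mulrCA ler_wpM2l //.
  rewrite ler_wpM2r ?(spectral_qf_ge0 _ _ (B_spectral S)) //.
  apply: le_trans expR1_le4; rewrite -[X in expR X](mulfV (x := p%:R)) ?pnatr_eq0 -?lt0n //.
  rewrite expRM_natl lerXn2r ?nnegrE ?expR_ge0 ?addr_ge0 ?invr_ge0 //.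
  exact: expR_ge1Dx.
rewrite big_split /= sumr_const (card_notin hS) -[f S *+ _]mulr_natl lerD2l.
rewrite -!mulr_sumr -mulrA ler_wpM2l //.
apply: le_trans (ler_wpM2l _ (sum_qf S _)) _ => //.
rewrite mulrCA ler_wpM2l // fE (spectral_tr _ (B_spectral S)) mulr_sumr.
apply: ler_sum => j _; have pE : p = p.-1.+1 by rewrite prednK.
by rewrite [X in _ <= _ ^+ X]pE exprS ler_wpM2r ?exprn_ge0.
Qed.

(** At least half of the indices remain before each draw, so the increment [4 T] of one step becomes
    the relative growth [8 T / n]. *)
Lemma trace_upper_avg s : (2 * s <= n)%N ->
  savg s f <= k%:R * p%:R ^+ p * expR (s%:R * (8%:R * T / n%:R)).
Proof.
elim: s => [_|s IH sn].
  rewrite savg0 mul0r expR0 mulr1 fE /la.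
  under eq_bigr => j _.
    have -> : cov_eig v finset.set0 j = 0.
      rewrite /cov_eig (_ : gmx v finset.set0 = 0).
        by rewrite (svd_uniq (svdP _) (@svd0 R k n)) expr0n.
      by apply/matrixP => a b; rewrite !mxE inE.
    rewrite addr0; over.
  by rewrite sumr_const card_ord mulr_natl.
have {IH} IH := IH ltac:(lia).
have sn' : (s < n)%N by lia.
have ns0 : (0 : R) < (n - s)%:R by rewrite ltr0n subn_gt0.
have n0 : (0 : R) < n%:R by rewrite ltr0n; lia.
have ns : n%:R / 2%:R <= (n - s)%:R :> R.
  by rewrite ler_pdivrMr // -natrM ler_nat; lia.
rewrite -natr1 mulrDl mul1r expRD mulrA.
apply: le_trans (ler_wpM2r (expR_ge0 _) IH).
set t := 8%:R * T / n%:R; have t0 : 0 <= t by rewrite divr_ge0 ?mulr_ge0.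
apply: (@le_trans _ _ ((1 + t) * savg s f + 0)).
  rewrite savgS // -savgZD ?(ltnW sn') //; apply: savg_le => S hS.
  rewrite ler_pdivrMr //; apply: le_trans (f_step hS) _.
  have -> : ((1 + t) * f S + 0) * (n - s)%:R = (n - s)%:R * f S + t * (n - s)%:R * f S by ring.
  rewrite lerD2l ler_wpM2r //.
  apply: (@le_trans _ _ (t * (n%:R / 2%:R))); last by rewrite ler_wpM2l.
  rewrite /t le_eqVlt; apply/orP; left; apply/eqP; field.
  by rewrite gt_eqF.
rewrite addr0 mulrC ler_wpM2l ?expR_ge1Dx //.
by rewrite /savg divr_ge0 // sumr_ge0.
Qed.

Lemma chernoff_upper l : (2 * l <= n)%N -> 8%:R * T * l%:R / n%:R <= p%:R ->
  sprob l (fun S => exists2 u, u != 0 &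
     15%:R * p%:R * sqn u < \sum_(j in S) dotp (v j) u ^+ 2)
  <= k%:R * expR (- p%:R) :> R.
Proof.
move=> ln hp.
have pp : (0 : R) < p%:R by rewrite ltr0n.
apply: le_trans (markov_savg (F := f) (c := (16%:R * p%:R) ^+ p) _ _ _) _ => //.
- by rewrite exprn_gt0 // mulr_gt0.
- move=> S _ [u u0 hu]; have up := sqn_gt0 u0.
  apply: le_trans (spectral_qf_le (i := p) (B_spectral _) _ up) => //.
  (* The shift contributes one more [p] to the 15 of the event, which gives the threshold 16. *)
  have h : 16%:R * p%:R <= dotp u (B S *m u) / sqn u.
    rewrite ler_pdivlMr // /B mulmxDl dotpDr mul_scalar_mx dotpZr dotp_vv covmx_qf; lra.
  have h0 : 0 <= 16%:R * p%:R :> R by rewrite mulr_ge0.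
  by apply: lerXn2r; rewrite ?nnegrE //; apply: le_trans h.
rewrite ler_pdivrMr ?exprn_gt0 ?mulr_gt0 //.
apply: le_trans (trace_upper_avg ln) _.
rewrite -!mulrA ler_wpM2l // exprMn mulrCA mulrC [leRHS]mulrA ler_wpM2r ?exprn_ge0 //.
apply: (@le_trans _ _ (expR (- p%:R) * expR (2%:R * p%:R))).
  rewrite -expRD ler_expR; apply: le_trans (_ : p%:R <= _); last by lra.
  by apply: le_trans hp; rewrite le_eqVlt; apply/orP; left; apply/eqP; ring.
by rewrite ler_wpM2l ?expR_ge0 ?expR2n_le.
Qed.

End Upper.

Lemma poly_bernoulli p (x : R) : (0 < p)%N -> `|x| <= p%:R^-1 ->
  (1 + x) ^+ p <= 1 + p%:R * x + p%:R ^+ 2 * x ^+ 2.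
Proof.
move=> p0 hx; have pp : (0 : R) < p%:R by rewrite ltr0n.
have hx1 : - p%:R^-1 <= x <= p%:R^-1 by rewrite -ler_norml.
suff : forall q, (q <= p)%N -> (1 + x) ^+ q <= 1 + q%:R * x + q%:R ^+ 2 * x ^+ 2.
  by apply.
elim=> [_|q IH qp]; first by rewrite expr0; lra.
have {IH} := IH (ltnW qp).
have p1 : p%:R^-1 <= 1 :> R by rewrite invf_le1 // ler1n.
have hx0 : 0 <= 1 + x by case/andP: hx1 => h _; lra.
move=> /(ler_wpM2l hx0); rewrite -exprS => /le_trans; apply.
have qx : q%:R * x <= 1.
  case/andP: hx1 => _ h; apply: le_trans (ler_wpM2l _ h) _ => //.
  by rewrite ler_pdivrMr // mul1r ler_nat ltnW.
rewrite -natr1; set a := q%:R in qx *.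
have a0 : 0 <= a :> R by [].
have x2 : 0 <= x ^+ 2 by apply: sqr_ge0.
have h1 : a * x ^+ 2 * (a * x) <= a * x ^+ 2 * 1 by rewrite ler_wpM2l // mulr_ge0.
nra.
Qed.

Section Bernstein.
Variables (n d : nat) (x : 'I_n -> 'cV[R]_d) (b V h : R) (p : nat).
Hypothesis sum0 : \sum_j x j = 0.
Hypothesis xb : forall j, sqn (x j) <= b.
Hypothesis xV : \sum_j sqn (x j) <= V.
Hypothesis p0 : (0 < p)%N.
Hypothesis h0 : 0 < h.
Hypothesis hb : 9%:R * p%:R ^+ 2 * b <= h.
Implicit Types S : {set 'I_n}.

Let Z S := \sum_(j in S) x j.
Let w S := h + sqn (Z S).
Let f S := w S ^+ p.

Let w_ge S : h <= w S.
Proof. by rewrite lerDl sqn_ge0. Qed.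

Let w_gt0 S : 0 < w S.
Proof. exact: lt_le_trans (w_ge S). Qed.

Let V0 : 0 <= V.
Proof. by apply: le_trans xV; apply: sumr_ge0 => j _; apply: sqn_ge0. Qed.

(** The offset [h >= 9 p^2 b] keeps the relative change [y / w S] within [1 / p], the range where
    [poly_bernoulli] bounds the power by a quadratic. The linear term in [Z S] is kept apart because
    only its sum over [j] has a sign. *)
Let f_stepj S j : j \notin S ->
  f (j |: S) <= f S + f S / w S * (p%:R * (2%:R * dotp (Z S) (x j)))
    + f S * (10%:R * p%:R ^+ 2 / h) * sqn (x j).
Proof.
move=> hj; have pp : (1 : R) <= p%:R by rewrite ler1n.
have ww := w_gt0 S; have hw := w_ge S.
pose y := 2%:R * dotp (Z S) (x j) + sqn (x j).
have wE : w (j |: S) = w S * (1 + y / w S).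
  rewrite mulrDr mulr1 mulrCA divff ?mulr1 ?gt_eqF //.
  rewrite /y /w /Z big_setU1 //= sqnD (dotpC (x j)); ring.
set D := dotp (Z S) (x j); set q := sqn (x j).
have q0 : 0 <= q by apply: sqn_ge0.
have qb : 9%:R * p%:R ^+ 2 * q <= h.
  by apply: le_trans hb; rewrite ler_wpM2l ?xb // mulr_ge0 ?sqr_ge0.
have hD : D ^+ 2 <= w S * q.
  apply: le_trans (dotp_sqr_le _ _) _; rewrite ler_wpM2r //.
  by rewrite /w lerDr ltW.
have qw : q <= w S / 9%:R.
  have : 1 * q <= p%:R ^+ 2 * q by rewrite ler_wpM2r // expr_ge1 // (le_trans _ pp).
  lra.
have y2 : y ^+ 2 <= 9%:R * w S * q.
  have h1 : y ^+ 2 <= 8%:R * D ^+ 2 + 2%:R * q ^+ 2.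
    rewrite /y -/D -/q; have := sqr_ge0 (2%:R * D - q); lra.
  have : q * q <= w S / 9%:R * q by rewrite ler_wpM2r.
  have := mulr_ge0 (ltW ww) q0; lra.
have hy : `|y / w S| <= p%:R^-1.
  rewrite -(ler_pXn2r (n := 2)) ?nnegrE ?invr_ge0 // real_normK ?num_real //.
  rewrite expr_div_n ler_pdivrMr ?exprn_gt0 // exprVn mulrC ler_pdivlMr; last first.
    by rewrite exprn_gt0 // (lt_le_trans _ pp).
  apply: le_trans (ler_wpM2r (sqr_ge0 _) y2) _.
  have -> : 9%:R * w S * q * p%:R ^+ 2 = w S * (9%:R * p%:R ^+ 2 * q) by ring.
  by rewrite expr2 ler_wpM2l ?(ltW ww) // (le_trans qb hw).
have f0 : 0 <= f S by rewrite exprn_ge0 // ltW.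
rewrite {1}/f wE exprMn -/(f S).
apply: le_trans (ler_wpM2l f0 (poly_bernoulli p0 hy)) _.
rewrite 2!mulrDr mulr1 -!addrA lerD2l.
have -> : f S * (p%:R * (y / w S)) = f S / w S * (p%:R * (2%:R * D)) + f S * (p%:R * q / w S).
  rewrite /y -/D -/q; ring.
rewrite -addrA lerD2l -mulrDr -[leRHS]mulrA ler_wpM2l //.
apply: (@le_trans _ _ (p%:R ^+ 2 * q / w S + p%:R ^+ 2 * (9%:R * q / w S))).
  apply: lerD.
    rewrite ler_wpM2r ?invr_ge0 ?(ltW ww) // ler_wpM2r // expr2 ler_peMl //.
  rewrite ler_wpM2l ?sqr_ge0 // expr_div_n ler_pdivrMr ?exprn_gt0 //.
  apply: le_trans y2 _; rewrite le_eqVlt; apply/orP; left; apply/eqP; field.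
  by rewrite gt_eqF.
have -> : p%:R ^+ 2 * q / w S + p%:R ^+ 2 * (9%:R * q / w S) =
   10%:R * p%:R ^+ 2 * q / w S by ring.
rewrite mulrAC ler_wpM2r // ler_wpM2l ?mulr_ge0 ?sqr_ge0 //.
by rewrite lef_pV2 ?posrE.
Qed.

Let f_step S s : #|S| = s ->
  \sum_(j | j \notin S) f (j |: S) <= (n - s)%:R * f S + 10%:R * p%:R ^+ 2 * V / h * f S.
Proof.
move=> hS; apply: le_trans (ler_sum _ (fun j hj => f_stepj hj)) _.
rewrite 2!big_split /= sumr_const (card_notin hS) -[f S *+ _]mulr_natl -addrA lerD2l.
have f0 : 0 <= f S by rewrite exprn_ge0 // ltW.
have ZN : \sum_(j | j \notin S) x j = - Z S.
  apply/eqP; rewrite -addr_eq0 addrC /Z -[X in _ == X]sum0.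
  by rewrite [X in _ == X](bigID (mem S)).
rewrite -[leRHS]add0r; apply: lerD.
  rewrite -mulr_sumr mulr_ge0_le0 ?divr_ge0 ?(ltW (w_gt0 _)) //.
  rewrite -mulr_sumr mulr_ge0_le0 // -mulr_sumr mulr_ge0_le0 //.
  have -> : \sum_(j | j \notin S) dotp (Z S) (x j) = dotp (Z S) (\sum_(j | j \notin S) x j).
    by rewrite /dotp mulmx_sumr summxE.
  by rewrite ZN -scaleN1r dotpZr mulN1r oppr_le0 dotp_vv sqn_ge0.
rewrite -mulr_sumr -mulrA [leRHS]mulrC ler_wpM2l //.
rewrite [leRHS]mulrAC; apply: ler_wpM2l.
  by rewrite !mulr_ge0 ?sqr_ge0 ?invr_ge0 ?(ltW h0).
apply: le_trans xV; rewrite [leLHS]big_mkcond; apply: ler_sum => j _.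
by case: ifP => // _; rewrite sqn_ge0.
Qed.

Lemma moment_avg s : (2 * s <= n)%N ->
  savg s f <= h ^+ p * expR (s%:R * (20%:R * p%:R ^+ 2 * V / h / n%:R)).
Proof.
elim: s => [_|s IH sn].
  by rewrite savg0 mul0r expR0 mulr1 /f /w /Z big_set0 sqn0 addr0.
have {IH} IH := IH ltac:(lia).
have sn' : (s < n)%N by lia.
have ns0 : (0 : R) < (n - s)%:R by rewrite ltr0n subn_gt0.
have n0 : (0 : R) < n%:R by rewrite ltr0n; lia.
have ns : n%:R / 2%:R <= (n - s)%:R :> R.
  by rewrite ler_pdivrMr // -natrM ler_nat; lia.
have f0 S : 0 <= f S by rewrite exprn_ge0 // ltW.
rewrite -natr1 mulrDl mul1r expRD mulrA.
apply: le_trans (ler_wpM2r (expR_ge0 _) IH).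
set t := _ / n%:R.
have t0 : 0 <= t by rewrite !divr_ge0 ?mulr_ge0 ?sqr_ge0 ?(ltW h0).
apply: (@le_trans _ _ ((1 + t) * savg s f + 0)).
  rewrite savgS // -savgZD ?(ltnW sn') //; apply: savg_le => S hS.
  rewrite ler_pdivrMr //; apply: le_trans (f_step hS) _.
  have -> : ((1 + t) * f S + 0) * (n - s)%:R = (n - s)%:R * f S + t * (n - s)%:R * f S by ring.
  rewrite lerD2l ler_wpM2r //.
  apply: (@le_trans _ _ (t * (n%:R / 2%:R))); last by rewrite ler_wpM2l.
  rewrite /t le_eqVlt; apply/orP; left; apply/eqP; field.
  by rewrite !gt_eqF.
rewrite addr0 mulrC ler_wpM2l ?expR_ge1Dx //.
by rewrite /savg divr_ge0 // sumr_ge0.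
Qed.

Let bernstein_half l : (2 * l <= n)%N -> 20%:R * p%:R * V * l%:R / n%:R <= h ->
  sprob l (fun S => 16%:R * h <= sqn (Z S)) <= expR (- p%:R) :> R.
Proof.
move=> ln hp.
have pp : (0 : R) < p%:R by rewrite ltr0n.
have f0 S : 0 <= f S by rewrite exprn_ge0 // ltW.
apply: le_trans (markov_savg (F := f) (c := (16%:R * h) ^+ p) _ _ _) _ => //.
- by rewrite exprn_gt0 // mulr_gt0.
- move=> S _ hS; rewrite lerXn2r ?nnegrE ?mulr_ge0 ?(ltW h0) ?(ltW (w_gt0 _)) //.
  by apply: le_trans hS _; rewrite lerDr ltW.
rewrite ler_pdivrMr ?exprn_gt0 ?mulr_gt0 //.
apply: le_trans (moment_avg ln) _.
rewrite exprMn [leRHS]mulrA [leLHS]mulrC ler_wpM2r ?exprn_ge0 ?(ltW h0) //.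
apply: (@le_trans _ _ (expR (- p%:R) * expR (2%:R * p%:R))).
  rewrite -expRD ler_expR; apply: le_trans (_ : p%:R <= _); last by lra.
  have -> : l%:R * (20%:R * p%:R ^+ 2 * V / h / n%:R) =
     p%:R * (20%:R * p%:R * V * l%:R / n%:R / h) by ring.
  rewrite -[leRHS]mulr1 ler_wpM2l // ler_pdivrMr ?mul1r //.
by rewrite ler_wpM2l ?expR_ge0 ?expR2n_le.
Qed.

(** A set and its complement have opposite sums, so a sample of more than half of the indices is
    traded for its smaller complement. *)
Lemma bernstein l : (l <= n)%N -> 20%:R * p%:R * V * l%:R / n%:R <= h ->
  sprob l (fun S => 16%:R * h <= sqn (\sum_(j in S) x j)) <= expR (- p%:R) :> R.
Proof.
move=> ln hp; case: (leqP (2 * l) n) => hl; first exact: bernstein_half.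
have n0 : (0 : R) < n%:R by rewrite ltr0n; lia.
rewrite /sprob -[l](subKn ln) savg_compl ?leq_subr //.
apply: le_trans (bernstein_half (l := n - l) _ _); [|by lia|].
  apply: savg_le => S _; rewrite /Z.
  have -> : \sum_(j in ~: S) x j = (-1) *: \sum_(j in S) x j.
    rewrite scaleN1r; apply/eqP; rewrite -addr_eq0 addrC -[X in _ == X]sum0.
    rewrite [X in _ == X](bigID (mem S)); apply/eqP; congr (_ + _).
    by apply: eq_bigl => j; rewrite inE.
  by rewrite sqnZ sqrrN expr1n mul1r.
apply: le_trans hp; rewrite ler_wpM2r ?invr_ge0 // ler_wpM2l ?mulr_ge0 //.
by rewrite ler_nat; lia.
Qed.

End Bernstein.
End Sampling2.

(** * Rademacher sums *)

Section Signs.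
Import numFieldNormedType.Exports.
Local Open Scope classical_set_scope.
Context {R : realType}.

Lemma dotpBr n (u v w : 'cV[R]_n) : dotp u (v - w) = dotp u v - dotp u w.
Proof. by rewrite -scaleN1r dotpDr dotpZr mulN1r. Qed.

Lemma dotpBl n (u v w : 'cV[R]_n) : dotp (v - w) u = dotp v u - dotp w u.
Proof. by rewrite !(dotpC _ u) dotpBr. Qed.

Lemma double_fact_ge k : (2 ^ k * k`! <= (2 * k)`!)%N.
Proof.
elim: k => // k IH; rewrite mulnS !factS expnS.
have -> : (2 * 2 ^ k * (k.+1 * k`!) = (2 * k.+1) * (2 ^ k * k`!))%N by lia.
rewrite (_ : (2 * k).+2 = 2 * k.+1)%N; last by lia.
by rewrite leq_mul2l (leq_trans IH) // leq_pmull.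
Qed.

Lemma exp_coeff_even_le (t : R) n :
  \sum_(0 <= k < 2 * n) (exp_coeff t k + exp_coeff (- t) k)
    <= 2%:R * series (exp_coeff (t ^+ 2 / 2%:R)) n.
Proof.
rewrite /series /=.
elim: n => [|n IH]; first by rewrite !big_nil mulr0.
rewrite mulnS !big_nat_recr //= [in leRHS]mulrDr -addrA; apply: lerD IH _.
rewrite /exp_coeff /= exprSr (exprSr (- t)).
have e1 : (- t) ^+ (2 * n) = (t ^+ 2) ^+ n by rewrite exprM sqrrN.
have e2 : t ^+ (2 * n) = (t ^+ 2) ^+ n by rewrite exprM.
rewrite e1 e2 mulrN mulNr subrr addr0 expr_div_n.
set X := (t ^+ 2) ^+ n; set a := (_`!)%:R.
have -> : X / a + X / a = 2%:R * (X / a) by ring.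
rewrite ler_wpM2l // -mulrA ler_wpM2l ?(exprn_ge0 _ (sqr_ge0 t)) //.
rewrite -invfM lef_pV2 ?posrE ?mulr_gt0 ?exprn_gt0 ?ltr0n ?fact_gt0 //.
by rewrite -natrX -natrM ler_nat double_fact_ge.
Qed.

(** Odd terms cancel in the power series, and the even ones are compared by [2^k k! <= (2k)!]. *)
Lemma cosh_le (t : R) : expR t + expR (- t) <= 2%:R * expR (t ^+ 2 / 2%:R).
Proof.
have hc x : (series (exp_coeff x) : nat -> R) @ \oo --> expR x.
  exact: is_cvg_series_exp_coeff.
have hlim : (series (exp_coeff t) + series (exp_coeff (- t)) : nat -> R) @ \oo
    --> expR t + expR (- t).
  by apply: cvgD; apply: hc.
have hle n : series (exp_coeff (t ^+ 2 / 2%:R)) n <= expR (t ^+ 2 / 2%:R).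
  apply: nondecreasing_cvgn_le; last exact: is_cvg_series_exp_coeff.
  apply: nondecreasing_series => i _ _; rewrite /exp_coeff /=.
  by rewrite mulr_ge0 ?invr_ge0 ?exprn_ge0 ?divr_ge0 ?sqr_ge0.
rewrite -(cvg_lim _ hlim) //.
apply: limr_le; first by apply: cvgP hlim.
near=> n.
apply: (@le_trans _ _ (2%:R * series (exp_coeff (t ^+ 2 / 2%:R)) n)); last first.
  by rewrite ler_wpM2l.
have term_ge0 k : 0 <= exp_coeff t k + exp_coeff (- t) k.
  rewrite /exp_coeff /= -mulrDl divr_ge0 // exprNn.
  rewrite -signr_odd; case hk: (odd k); rewrite ?expr1 ?expr0 ?mulN1r ?subrr //.
  have -> : t ^+ k = (t ^+ k./2) ^+ 2.
    by rewrite -exprM muln2 -[in LHS](odd_double_half k) hk.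
  by rewrite mul1r addr_ge0 ?sqr_ge0.
(* Doubling the number of terms only adds nonnegative pairs, and it matches [2 n] terms of the left
   series with [n] terms in [t^2 / 2]. *)
apply: (@le_trans _ _ (\sum_(0 <= k < 2 * n) (exp_coeff t k + exp_coeff (- t) k))).
  have -> : (series (exp_coeff t) + series (exp_coeff (- t))) n =
      \sum_(0 <= k < n) (exp_coeff t k + exp_coeff (- t) k) by rewrite big_split.
  rewrite [leRHS](big_cat_nat (n := n)) //=; last by lia.
  by rewrite lerDl sumr_ge0.
exact: exp_coeff_even_le.
Unshelve. all: by end_near.
Qed.


Section Walk.
Variables (n d : nat) (b : 'I_n -> 'cV[R]_d).
Implicit Types (e : {ffun 'I_n -> bool}).

Definition sgn e j : R := (-1) ^+ e j.

(** Partial Rademacher sums on one fixed sample space of signs, so that inductions can reveal the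
    signs in index order. *)
Definition walk (i : nat) e : 'cV[R]_d := \sum_(j < n | (j < i)%N) sgn e j *: b j.

Definition flip (i : 'I_n) e : {ffun 'I_n -> bool} :=
  [ffun j => if j == i then ~~ e j else e j].

Lemma flipK i : involutive (flip i).
Proof. by move=> e; apply/ffunP => j; rewrite !ffunE; case: eqP; rewrite ?negbK. Qed.

Lemma sgn_flip i e j : sgn (flip i e) j = if j == i then - sgn e j else sgn e j.
Proof. by rewrite /sgn ffunE; case: eqP => // _; rewrite signrN. Qed.

Lemma walk0 e : walk 0 e = 0.
Proof. by rewrite /walk big1. Qed.

Lemma walkS (i : 'I_n) e : walk i.+1 e = walk i e + sgn e i *: b i.
Proof.
rewrite /walk (bigD1 i) //= addrC; congr (_ + _); apply: eq_bigl => j.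
by rewrite ltnS (ltn_neqAle j i) andbC.
Qed.

Lemma walk_flip (i : 'I_n) e : walk i (flip i e) = walk i e.
Proof.
apply: eq_bigr => j ji; rewrite sgn_flip; case: eqP => // h.
by rewrite h ltnn in ji.
Qed.

(** Flipping sign [i] preserves the uniform law and leaves [walk i] unchanged, so the average over
    that sign is taken by symmetrization. *)
Lemma avg_walkS (i : 'I_n) (phi : 'cV[R]_d -> R) :
  avg (fun e => phi (walk i.+1 e)) =
  avg (fun e => (phi (walk i e + b i) + phi (walk i e - b i)) / 2%:R).
Proof.
have h : avg (fun e => phi (walk i.+1 e)) = avg (fun e => phi (walk i.+1 (flip i e))).
  by rewrite /avg (reindex_inj (inv_inj (flipK i))).
have -> : avg (fun e => phi (walk i.+1 e)) =
  2%:R^-1 * (avg (fun e => phi (walk i.+1 e)) + avg (fun e => phi (walk i.+1 (flip i e)))).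
  rewrite -h; lra.
rewrite -avgD -avgZ; congr avg; apply/funext => e.
rewrite mulrC !walkS walk_flip sgn_flip eqxx /sgn.
case: (e i); rewrite ?expr1 ?expr0 ?opprK ?scaleN1r ?scale1r //.
by rewrite [X in X / _]addrC.
Qed.

(* [Q] plays the role of an inverse of [N], up to the inequality [QNQ <= Q]. *)
Lemma walk_mgf (al : R) (i : nat) : 0 < al -> (i <= n)%N -> forall Q N : 'M[R]_d,
  Q^T = Q -> N^T = N -> (forall u, dotp u (Q *m N *m Q *m u) <= dotp u (Q *m u)) ->
  (forall u, al * sqn u <= dotp u (N *m u)
     - \sum_(j < n | (j < i)%N) dotp (b j) u ^+ 2) ->
  avg (fun e => expR (dotp (walk i e) (Q *m walk i e) / 2%:R))
    <= expR (\sum_(j < n | (j < i)%N) sqn (b j) / al / 2%:R).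
Proof.
move=> al0; elim: i => [_|i IH hi] Q N QT NT hJ hA.
  rewrite [leLHS](_ : _ = avg (fun _ : {ffun 'I_n -> bool} => 1)).
    rewrite avg_cst; first by rewrite -expR0 ler_expR sumr_ge0.
    by rewrite card_ffun card_bool expn_gt0.
  by congr avg; apply/funext => e; rewrite walk0 mulmx0 /dotp mulmx0 mxE mul0r expR0.
have -> : \sum_(j < n | (j < i.+1)%N) sqn (b j) / al / 2%:R =
    sqn (b (Ordinal hi)) / al / 2%:R + \sum_(j < n | (j < i)%N) sqn (b j) / al / 2%:R.
  rewrite (bigD1 (Ordinal hi)) //=; congr (_ + _); apply: eq_bigl => j.
  by rewrite ltnS (ltn_neqAle j i) andbC.
have sumS u : \sum_(j < n | (j < i.+1)%N) dotp (b j) u ^+ 2 =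
    dotp (b (Ordinal hi)) u ^+ 2 + \sum_(j < n | (j < i)%N) dotp (b j) u ^+ 2.
  rewrite (bigD1 (Ordinal hi)) //=; congr (_ + _); apply: eq_bigl => j.
  by rewrite ltnS (ltn_neqAle j i) andbC.
set bi := b (Ordinal hi) in sumS *.
have hN u : al * sqn u <= dotp u (N *m u).
  by apply: le_trans (hA u) _; rewrite gerBl sumr_ge0 // => j _; apply: sqr_ge0.
have Qsym u v : dotp u (Q *m v) = dotp (Q *m u) v by rewrite dotp_mulr QT.
have Qal u : al * sqn (Q *m u) <= dotp u (Q *m u).
  apply: le_trans (hN _) _; apply: le_trans (hJ u).
  by rewrite -!mulmxA [leRHS]Qsym.
have cQ : dotp bi (Q *m bi) <= sqn bi / al.
  have h0 : 0 <= dotp bi (Q *m bi).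
    by apply: le_trans (Qal _); rewrite mulr_ge0 ?sqn_ge0 // ltW.
  have h1 := dotp_sqr_le bi (Q *m bi).
  have h2 : sqn bi * (al * sqn (Q *m bi)) <= sqn bi * dotp bi (Q *m bi).
    by rewrite ler_wpM2l ?sqn_ge0.
  rewrite ler_pdivlMr //; case: (eqVneq (dotp bi (Q *m bi)) 0) => [->|hne].
    by rewrite mul0r sqn_ge0.
  have h3 : 0 < dotp bi (Q *m bi) by rewrite lt_neqAle eq_sym hne.
  rewrite -(ler_pM2r h3); nra.
set q := Q *m bi; set c := dotp bi q in cQ *.
have c0 : 0 <= c by apply: le_trans (Qal _); rewrite mulr_ge0 ?sqn_ge0 // ltW.
(* Averaging over the sign of [bi] yields a cosh, bounded by the exponential of [t^2 / 2] with
   [t = dotp q z]; the update [Q'] absorbs it. If [Q] inverts [N], Sherman-Morrison gives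
   [Q + q q^T / (1 - c)] as the inverse of [N']. Omitting the denominator is what an inequality in
   place of an inverse permits. *)
pose Q' := Q + q *m q^T; pose N' := N - bi *m bi^T.
have outerE (x u : 'cV[R]_d) : x *m x^T *m u = dotp x u *: x.
  by rewrite -mulmxA [x^T *m u]mx11_scalar mul_mx_scalar.
have Q'E u : Q' *m u = Q *m u + dotp q u *: q by rewrite mulmxDl outerE.
have N'E u : N' *m u = N *m u - dotp bi u *: bi by rewrite mulmxBl outerE.
have Q'T : Q'^T = Q' by rewrite /Q' raddfD /= QT trmx_mul trmxK.
have N'T : N'^T = N' by rewrite /N' raddfB /= NT trmx_mul trmxK.
rewrite (avg_walkS (Ordinal hi) (fun z => expR (dotp z (Q *m z) / 2%:R))) /= -/bi.
rewrite expRD.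
apply: le_trans (_ : avg (fun e => expR (c / 2%:R) *
   expR (dotp (walk i e) (Q' *m walk i e) / 2%:R)) <= _).
  apply: avg_le => e; set z := walk i e; set t := dotp q z.
  have e1 : dotp (z + bi) (Q *m (z + bi)) = dotp z (Q *m z) + 2%:R * t + c.
    rewrite mulmxDr !dotpDl !dotpDr -/q (Qsym bi z) -/q -/t (dotpC z q) -/t -/c; ring.
  have e2 : dotp (z - bi) (Q *m (z - bi)) = dotp z (Q *m z) - 2%:R * t + c.
    rewrite mulmxBr !dotpBl !dotpBr.
    rewrite -/q (Qsym bi z) -/q -/t (dotpC z q) -/t -/c; ring.
  have e3 : dotp z (Q' *m z) = dotp z (Q *m z) + t ^+ 2.
    by rewrite Q'E dotpDr dotpZr (dotpC z q) -/t expr2.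
  rewrite e1 e2 e3 -expRD.
  have -> : (dotp z (Q *m z) + 2%:R * t + c) / 2%:R = (dotp z (Q *m z) + c) / 2%:R + t by lra.
  have -> : (dotp z (Q *m z) - 2%:R * t + c) / 2%:R = (dotp z (Q *m z) + c) / 2%:R - t by lra.
  have -> : c / 2%:R + (dotp z (Q *m z) + t ^+ 2) / 2%:R =
     (dotp z (Q *m z) + c) / 2%:R + t ^+ 2 / 2%:R by lra.
  rewrite !expRD -mulrDr -mulrA ler_wpM2l ?expR_ge0 //.
  by rewrite ler_pdivrMr // mulrC cosh_le.
rewrite avgZ; apply: ler_pM; rewrite ?expR_ge0 //.
- by rewrite /avg divr_ge0 // sumr_ge0 // => e _; apply: expR_ge0.
- by rewrite ler_expR ler_wpM2r.
apply: (IH (ltnW hi) Q' N') => // u; last first.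
  have := hA u; rewrite sumS N'E dotpBr dotpZr (dotpC u bi); lra.
pose K := Q - Q *m N *m Q.
have Ksym x y : dotp x (K *m y) = dotp (K *m x) y.
  rewrite dotp_mulr; congr (dotp (_ *m _) _).
  by rewrite /K raddfB /= !trmx_mul QT NT mulmxA.
have K0 x : 0 <= dotp x (K *m x).
  by rewrite /K mulmxBl dotpBr subr_ge0.
have QNQ x : Q *m (N *m (Q *m x)) = Q *m x - K *m x.
  by rewrite /K mulmxBl !mulmxA opprB addrC subrK.
(* [Q' - Q'N'Q' = (1 + q b^T) K (1 + b q^T) + (c + c^2) q q^T] *)
have key : dotp u (Q' *m u) - dotp u (Q' *m N' *m Q' *m u) =
   dotp (u + dotp q u *: bi) (K *m (u + dotp q u *: bi)) + (c + c ^+ 2) * dotp q u ^+ 2.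
  set r := dotp q u.
  have -> : dotp u (Q' *m N' *m Q' *m u) = dotp (Q' *m u) (N' *m (Q' *m u)).
    by rewrite -!mulmxA dotp_mulr Q'T.
  set y := u + r *: bi.
  have yE : Q' *m u = Q *m y by rewrite Q'E mulmxDr -scalemxAr.
  rewrite yE N'E dotpBr dotpZr -(Qsym y) QNQ dotpBr.
  have -> : dotp bi (Q *m y) = r * (1 + c).
    by rewrite Qsym -/q /y dotpDr dotpZr (dotpC q bi) -/c -/r; ring.
  have -> : dotp (Q *m y) bi = r * (1 + c).
    by rewrite -Qsym -/q /y dotpDl dotpZl -/c (dotpC u q) -/r; ring.
  have -> : dotp u (Q *m y) = dotp u (Q *m u) + r ^+ 2.
    by rewrite /y mulmxDr -scalemxAr dotpDr dotpZr -/q (dotpC u q) -/r; ring.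
  have -> : dotp y (Q *m y) = dotp u (Q *m u) + 2%:R * r ^+ 2 + r ^+ 2 * c.
    rewrite /y mulmxDr -scalemxAr dotpDl !dotpDr !dotpZl !dotpZr -/q (Qsym bi u) -/q.
    by rewrite (dotpC u q) -/r -/c; ring.
  ring.
rewrite -subr_ge0 key addr_ge0 ?K0 // mulr_ge0 ?sqr_ge0 // addr_ge0 ?sqr_ge0 //.
Qed.

(** Exponential Markov with scalar [Q] and [N]. The choice [al = be f / g] makes [F / al] and
    [s (f + g)^2] equal to [f g / be] and [(f + g) g / be]; half of their difference is
    [- g^2 / (2 be) = - 4 L]. *)
Lemma walk_tail (L be : R) : 0 < L -> 0 < be -> 0 < \sum_j sqn (b j) ->
  (forall u, \sum_j dotp (b j) u ^+ 2 <= be * sqn u) ->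
  unif_prob (fun e => (Num.sqrt (\sum_j sqn (b j)) + Num.sqrt (8%:R * L * be)) ^+ 2
     <= sqn (\sum_j sgn e j *: b j)) <= expR (- (4%:R * L)).
Proof.
move=> L0 be0 F0 hbe; set F := \sum_j _ in F0 *.
set f := Num.sqrt F; set g := Num.sqrt _.
have f0 : 0 < f by rewrite sqrtr_gt0.
have g0 : 0 < g by rewrite sqrtr_gt0 !mulr_gt0.
have f2 : f ^+ 2 = F by rewrite sqr_sqrtr // ltW.
have g2 : g ^+ 2 = 8%:R * L * be by rewrite sqr_sqrtr // !mulr_ge0 // ltW.
pose al := be * f / g; have al0 : 0 < al by rewrite divr_gt0 // mulr_gt0.
pose s := (al + be)^-1; have ab0 : 0 < al + be by rewrite addr_gt0.
have s0 : 0 < s by rewrite invr_gt0.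
have walkn e : walk n e = \sum_j sgn e j *: b j.
  by apply: eq_bigl => j; rewrite ltn_ord.
have sumn (h : 'I_n -> R) : \sum_(j < n | (j < n)%N) h j = \sum_j h j.
  by apply: eq_bigl => j; rewrite ltn_ord.
have hm := walk_mgf al0 (leqnn n) (Q := s%:M) (N := (al + be)%:M).
have {hm} : avg (fun e => expR (dotp (walk n e) (s%:M *m walk n e) / 2%:R)) <=
    expR (\sum_(j < n | (j < n)%N) sqn (b j) / al / 2%:R).
  apply: hm; rewrite ?tr_scalar_mx // => u.
    rewrite -!scalar_mxM !mul_scalar_mx !dotpZr.
    by rewrite mulVf ?gt_eqF // mul1r.
  by rewrite sumn mul_scalar_mx dotpZr dotp_vv mulrDl -addrA lerDl subr_ge0.
rewrite sumn -!mulr_suml -/F => hm.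
apply: le_trans (markov_avg (F := fun e => expR (dotp (walk n e) (s%:M *m walk n e) / 2%:R))
   (c := expR (s * (f + g) ^+ 2 / 2%:R)) _ _ _) _.
- exact: expR_gt0.
- by move=> e; apply: expR_ge0.
- move=> e he; rewrite ler_expR ler_wpM2r // mul_scalar_mx dotpZr dotp_vv walkn.
  by rewrite ler_wpM2l // ltW.
rewrite -expRN; apply: le_trans (ler_wpM2r (expR_ge0 _) hm) _.
rewrite -expRD ler_expR.
have fg0 : 0 < f + g by rewrite addr_gt0.
have -> : F / al / 2%:R = f * g / be / 2%:R.
  by rewrite -f2 /al; field; rewrite !gt_eqF.
have -> : s * (f + g) ^+ 2 / 2%:R = (f + g) * g / be / 2%:R.
  have se : s = g / (be * (f + g)).
    have abE : al + be = be * (f + g) / g by rewrite /al; field; rewrite gt_eqF.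
    by rewrite /s abE invf_div.
  by rewrite se; field; rewrite !gt_eqF.
have -> : f * g / be / 2%:R - (f + g) * g / be / 2%:R = - (g ^+ 2 / be / 2%:R).
  by field; rewrite gt_eqF.
rewrite g2 lerN2 le_eqVlt; apply/orP; left; apply/eqP; field.
by rewrite gt_eqF.
Qed.

(** A Khintchine bound with the Gaussian constant 3, the input of the Paley-Zygmund argument for
    [k = 1]. *)
Lemma walk_moments (u : 'cV[R]_d) (i : nat) : (i <= n)%N ->
  let s := \sum_(j < n | (j < i)%N) dotp u (b j) ^+ 2 in
  avg (fun e => dotp u (walk i e) ^+ 2) = s /\
  avg (fun e => dotp u (walk i e) ^+ 4) <= 3%:R * s ^+ 2.
Proof.
elim: i => [_|i IH hi] /=.
  rewrite big1 // expr0n mulr0; split.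
    by rewrite /avg big1 ?mul0r // => e _; rewrite walk0 /dotp mulmx0 mxE expr0n.
  by rewrite /avg big1 ?mul0r // => e _; rewrite walk0 /dotp mulmx0 mxE expr0n.
have [h2 h4] := IH (ltnW hi).
have -> : \sum_(j < n | (j < i.+1)%N) dotp u (b j) ^+ 2 =
    dotp u (b (Ordinal hi)) ^+ 2 + \sum_(j < n | (j < i)%N) dotp u (b j) ^+ 2.
  rewrite (bigD1 (Ordinal hi)) //=; congr (_ + _); apply: eq_bigl => j.
  by rewrite ltnS (ltn_neqAle j i) andbC.
set s := \sum_(_ | _) _ in h2 h4 *; set c := dotp u _.
have n0 : (0 < #|{ffun 'I_n -> bool}|)%N by rewrite card_ffun card_bool expn_gt0.
have dB z : dotp u (z - b (Ordinal hi)) = dotp u z - c by rewrite dotpBr.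
split.
  rewrite (avg_walkS (Ordinal hi) (fun z => dotp u z ^+ 2)) /=.
  transitivity (avg (fun e => dotp u (walk i e) ^+ 2 + c ^+ 2)).
    by congr avg; apply/funext => e; rewrite dotpDr dB -/c; field.
  by rewrite avgD h2 avg_cst // addrC.
rewrite (avg_walkS (Ordinal hi) (fun z => dotp u z ^+ 4)) /=.
have -> : avg (fun e => (dotp u (walk i e + b (Ordinal hi)) ^+ 4
    + dotp u (walk i e - b (Ordinal hi)) ^+ 4) / 2%:R) =
  avg (fun e => dotp u (walk i e) ^+ 4 + (6%:R * c ^+ 2 * dotp u (walk i e) ^+ 2 + c ^+ 4)).
  by congr avg; apply/funext => e; rewrite dotpDr dB -/c; field.
rewrite avgD avgD avgZ h2 avg_cst //.
have := sqr_ge0 (c ^+ 2); nra.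
Qed.

End Walk.

End Signs.

(** * The subsampled randomized Hadamard transform *)

Section SRHTFacts.
Context {R : realType}.

Lemma outer_mulE r (x u : 'cV[R]_r) : x *m x^T *m u = dotp x u *: x.
Proof. by rewrite -mulmxA [x^T *m u]mx11_scalar mul_mx_scalar. Qed.

Lemma castmx_gram a b (e : a = b) (A : 'M[R]_a) c : A^T *m A = c%:M ->
  (castmx (e, e) A)^T *m castmx (e, e) A = c%:M.
Proof. by case: b / e; rewrite castmx_id. Qed.

Lemma hadamard_gram q : (hadamard q)^T *m hadamard q = ((2 ^ q)%:R : R)%:M.
Proof.
elim: q => [|q IH] /=.
  apply/matrixP => i j; rewrite !mxE big_ord1 !mxE mulr1.
  by rewrite (ord1 (i : 'I_1)) (ord1 (j : 'I_1)).
apply: castmx_gram; rewrite tr_block_mx mulmx_block.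
have -> : (- hadamard q)^T = - (hadamard q)^T :> 'M[R]_(2 ^ q).
  by apply/matrixP => i j; rewrite !mxE.
rewrite !mulNmx !mulmxN opprK.
rewrite IH !subrr [RHS]scalar_mx_block; congr block_mx.
  by rewrite -raddfD -natrD exp2S.
by rewrite -raddfD -natrD exp2S.
Qed.

Lemma hadamard_sq q i j : (hadamard q i j : R) ^+ 2 = 1.
Proof.
elim: q i j => [|q IH] i j /=; first by rewrite mxE expr1n.
rewrite castmxE; move: (cast_ord _ i) (cast_ord _ j) => a b.
have ea : a = fintype.unsplit (fintype.split a) by rewrite fintype.splitK.
have eb : b = fintype.unsplit (fintype.split b) by rewrite fintype.splitK.
rewrite ea eb; case: (fintype.split a) => a'; case: (fintype.split b) => b' /=.
- by rewrite block_mxEul.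
- by rewrite block_mxEur.
- by rewrite block_mxEdl.
- by rewrite block_mxEdr mxE sqrrN.
Qed.

Section Fixed.
Variable q : nat.
Let n := (2 ^ q)%N.

Let n0 : (0 : R) < n%:R. Proof. by rewrite ltr0n expn_gt0. Qed.

(* The rotated matrix [X D H^T]; its columns are the vectors that the SRHT
   samples. *)
Definition mixed r (X : 'M[R]_(r, n)) (e : {ffun 'I_n -> bool}) (j : 'I_n) : 'cV[R]_r :=
  \sum_a sgn e a *: (((Num.sqrt n%:R)^-1 * hadamard q j a) *: col a X).

Definition hd (e : {ffun 'I_n -> bool}) : 'M[R]_n :=
  ((Num.sqrt n%:R)^-1 *: hadamard q) *m diag_mx (\row_j (-1) ^+ e j).

Let sqn0' : Num.sqrt n%:R ^+ 2 = n%:R :> R. Proof. by rewrite sqr_sqrtr // ltW. Qed.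

Let sq0 : Num.sqrt n%:R != 0 :> R. Proof. by rewrite sqrtr_eq0 -ltNge. Qed.

Lemma hd_ortho e : orthomx (hd e).
Proof.
rewrite /orthomx /hd trmx_mul linearZ /= tr_diag_mx -!mulmxA (mulmxA (_ *: _)).
rewrite -scalemxAl -scalemxAr scalerA hadamard_gram scale_scalar_mx.
have -> : (Num.sqrt n%:R)^-1 * (Num.sqrt n%:R)^-1 * (2 ^ q)%:R = 1 :> R.
  by rewrite -invfM -expr2 sqn0' mulVf // gt_eqF.
rewrite mul1mx mulmx_diag; apply/matrixP => i j; rewrite !mxE.
by case: eqP => // _; rewrite -expr2 sqrr_sign.
Qed.

Lemma mixedE r (X : 'M[R]_(r, n)) e j : mixed X e j = col j (X *m (hd e)^T).
Proof.
apply/colP => i; rewrite /mixed summxE mxE mxE; apply: eq_bigr => a _.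
by rewrite /hd mul_mx_diag !mxE /sgn; ring.
Qed.

Lemma mixed_gram r t (X : 'M[R]_(r, n)) (Z : 'M[R]_(t, n)) e :
  \sum_j mixed X e j *m (mixed Z e j)^T = X *m Z^T.
Proof.
have -> : X *m Z^T = (X *m (hd e)^T) *m (Z *m (hd e)^T)^T.
  move: (hd e) (hd_ortho e) => W hW.
  by rewrite trmx_mul trmxK mulmxA -(mulmxA X) hW mulmx1.
apply/matrixP => a b; rewrite summxE mxE; apply: eq_bigr => j _.
by rewrite !mixedE mxE big_ord1 !mxE.
Qed.

Lemma mixed_qf r (X : 'M[R]_(r, n)) e u :
  \sum_j dotp (mixed X e j) u ^+ 2 = sqn (X^T *m u).
Proof.
transitivity (dotp u ((\sum_j mixed X e j *m (mixed X e j)^T) *m u)).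
  rewrite mulmx_suml /dotp mulmx_sumr summxE; apply: eq_bigr => j _.
  by rewrite outer_mulE -/(dotp u _) dotpZr (dotpC u) expr2.
by rewrite mixed_gram -mulmxA dotp_mulr dotp_vv.
Qed.

Lemma mixed_fsq r (X : 'M[R]_(r, n)) e : \sum_j sqn (mixed X e j) = fsq X.
Proof.
under eq_bigr => j _ do rewrite mixedE.
rewrite -fsq_col; apply: fsq_orthor; exact: hd_ortho.
Qed.

Let coef_sq j a : ((Num.sqrt n%:R)^-1 * hadamard q j a : R) ^+ 2 = n%:R^-1.
Proof. by rewrite exprMn hadamard_sq mulr1 exprVn sqn0'. Qed.

Lemma mixed_sqn_sum r (X : 'M[R]_(r, n)) j :
  \sum_a sqn (((Num.sqrt n%:R)^-1 * hadamard q j a) *: col a X) = n%:R^-1 * fsq X.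
Proof.
rewrite fsq_col mulr_sumr; apply: eq_bigr => a _; by rewrite sqnZ coef_sq.
Qed.

Lemma mixed_dotp_sum r (X : 'M[R]_(r, n)) j u :
  \sum_a dotp (((Num.sqrt n%:R)^-1 * hadamard q j a) *: col a X) u ^+ 2
    = n%:R^-1 * sqn (X^T *m u).
Proof.
rewrite sqnE mulr_sumr; apply: eq_bigr => a _.
rewrite dotpZl exprMn coef_sq; congr (_ * _ ^+ 2).
by rewrite dotpE mxE; apply: eq_bigr => i _; rewrite !mxE.
Qed.

(** [n] times the squared length that a column of the rotated [X] reaches with probability at most
    [exp (- 4 L)]; here [be] bounds the squared operator norm of [X]. *)
Definition rowbound r (X : 'M[R]_(r, n)) (be L : R) : R :=
  (Num.sqrt (fsq X) + Num.sqrt (8%:R * L * be)) ^+ 2.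

Lemma mixed_tail r (X : 'M[R]_(r, n)) be L : 0 < L -> 0 < be -> 0 < fsq X ->
  (forall u, sqn (X^T *m u) <= be * sqn u) ->
  unif_prob (fun e => exists j, rowbound X be L / n%:R <= sqn (mixed X e j))
    <= n%:R * expR (- (4%:R * L)).
Proof.
move=> L0 be0 F0 hbe; apply: unif_prob_exists => j.
pose b a := ((Num.sqrt n%:R)^-1 * hadamard q j a) *: col a X.
have hF := mixed_sqn_sum X j.
apply: le_trans (walk_tail (b := b) (be := be / n%:R) L0 _ _ _); last 3 first.
- by rewrite divr_gt0.
- by rewrite /b hF mulr_gt0 // invr_gt0.
- move=> u; rewrite /b mixed_dotp_sum mulrC mulrAC ler_wpM2r ?invr_ge0 ?(ltW n0) //.
apply: unif_prob_le => e; rewrite /b hF /mixed -/(b) => h.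
apply: le_trans h; rewrite mulrA sqrtrM ?invr_ge0 ?(ltW n0) //.
rewrite [X in _ + X]sqrtrM ?mulr_ge0 ?(ltW L0) ?(ltW be0) // [X in X + _]mulrC -mulrDl.
by rewrite exprMn sqr_sqrtr ?invr_ge0 ?(ltW n0).
Qed.

Lemma mixed_moments r (X : 'M[R]_(r, n)) j u :
  avg (fun e => (dotp u (mixed X e j)) ^+ 2) = n%:R^-1 * sqn (X^T *m u) /\
  avg (fun e => (dotp u (mixed X e j)) ^+ 4) <= 3%:R * (n%:R^-1 * sqn (X^T *m u)) ^+ 2.
Proof.
pose b a := ((Num.sqrt n%:R)^-1 * hadamard q j a) *: col a X.
have /= := walk_moments b u (leqnn n).
have -> : \sum_(a < n | (a < n)%N) dotp u (b a) ^+ 2 = n%:R^-1 * sqn (X^T *m u).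
  rewrite -(mixed_dotp_sum X j); apply: eq_big => [a|a _]; first by rewrite ltn_ord.
  by rewrite dotpC.
have -> // : walk b n = fun e => mixed X e j.
by apply/funext => e; apply: eq_bigl => a; rewrite ltn_ord.
Qed.

Section Sample.
Variables (l : nat) (w : srht_space l n).
Hypothesis l0 : (0 < l)%N.

Let ka : R := n%:R / l%:R.
Let ka0 : 0 <= ka. Proof. by rewrite divr_ge0. Qed.

Lemma srht_row (i : 'I_l) r (X : 'M[R]_(r, n)) :
  col i (X *m (srht w)^T) = Num.sqrt ka *: mixed X w.2 (val w.1 i).
Proof.
rewrite mixedE; apply/colP => a; rewrite !mxE mulr_sumr; apply: eq_bigr => b _.
rewrite mulrCA; congr (_ * _); rewrite [LHS]mxE /srht -mulmxA -/(hd w.2) mxE.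
congr (_ * _); rewrite mxE (bigD1 (val w.1 i)) //= mxE eqxx mul1r big1 ?addr0 ?mxE //.
by move=> c hc; rewrite mxE eq_sym (negbTE hc) mul0r.
Qed.

Let sample_inj : injective (val w.1). Proof. by apply/injectiveP; apply: (valP w.1). Qed.

Lemma srht_sum_samp (F : 'I_n -> R) :
  \sum_(i < l) F (val w.1 i) = \sum_(j in samp w.1) F j.
Proof.
rewrite /samp big_imset /=; first by apply: eq_bigl => i; rewrite inE.
by move=> i j _ _; apply: sample_inj.
Qed.

Lemma srht_sqn r (X : 'M[R]_(r, n)) u :
  sqn (srht w *m (X^T *m u)) = ka * \sum_(j in samp w.1) dotp (mixed X w.2 j) u ^+ 2.
Proof.
rewrite -srht_sum_samp mulr_sumr sqnE; apply: eq_bigr => i _.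
have -> : (srht w *m (X^T *m u)) i 0 = dotp (col i (X *m (srht w)^T)) u.
  rewrite mulmxA -{1}[srht w]trmxK -trmx_mul mxE dotpE.
  by apply: eq_bigr => a _; rewrite !mxE.
by rewrite srht_row dotpZl exprMn sqr_sqrtr.
Qed.

(** A sampled matrix product: extended over all indices, the sum of outer products would be [X Z^T]
    by [mixed_gram]. *)
Lemma srht_cross r t (X : 'M[R]_(r, n)) (Z : 'M[R]_(t, n)) :
  X *m (srht w)^T *m srht w *m Z^T =
  ka *: \sum_(j in samp w.1) mixed X w.2 j *m (mixed Z w.2 j)^T.
Proof.
have -> : X *m (srht w)^T *m srht w *m Z^T = (X *m (srht w)^T) *m (Z *m (srht w)^T)^T.
  by rewrite trmx_mul trmxK !mulmxA.
apply/matrixP => a b; rewrite mxE [RHS]mxE summxE.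
rewrite -(srht_sum_samp (fun j => (mixed X w.2 j *m (mixed Z w.2 j)^T) a b)).
rewrite mulr_sumr; apply: eq_bigr => i _.
have /colP /(_ a) := srht_row i X; have /colP /(_ b) := srht_row i Z.
rewrite !mxE big_ord1 !mxE => -> ->; rewrite mulrACA -expr2 sqr_sqrtr //.
Qed.

Lemma srht_tr_sqn z : sqn ((srht w)^T *m z) = ka * sqn z.
Proof.
have : (srht w : 'M[R]_(l, n)) *m (srht w)^T = ka%:M.
  apply/matrixP => i i'.
  have h (c : 'I_l) a : srht w c a = Num.sqrt ka * hd w.2 (val w.1 c) a :> R.
    have /colP /(_ a) := srht_row c 1%:M.
    by rewrite mul1mx mixedE mul1mx !mxE.
  rewrite mxE.
  transitivity (\sum_a ka * (hd w.2 (val w.1 i) a * hd w.2 (val w.1 i') a)).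
    apply: eq_bigr => a _; rewrite [X in _ * X]mxE !h mulrACA -expr2 sqr_sqrtr //.
  rewrite -mulr_sumr mxE.
  have -> : \sum_a hd w.2 (val w.1 i) a * hd w.2 (val w.1 i') a = (i == i')%:R.
    move: (hd w.2) (hd_ortho w.2) => W /mulmx1C /matrixP.
    move=> /(_ (val w.1 i) (val w.1 i')).
    rewrite mxE [X in _ = X -> _]mxE (inj_eq sample_inj) => <-.
    by apply: eq_bigr => a _; rewrite [X in _ = _ * X]mxE.
  by case: eqP; rewrite ?mulr1 ?mulr0.
by move=> h; rewrite (sqn_mul_gram (c := ka)) // trmxK.
Qed.

End Sample.
End Fixed.
End SRHTFacts.

(** * Probability of a good embedding *)

Section Events.
Context {R : realType}.

Lemma unif_prob_pair_fst (T1 T2 : finType) (E : T1 * T2 -> Prop) x : (0 < #|T1|)%N ->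
  (forall a, unif_prob (fun b => E (a, b)) <= x) -> unif_prob E <= x :> R.
Proof.
move=> h hx; rewrite unif_probE.
have -> : avg (fun w => (`[< E w >])%:R) =
    avg (fun a : T1 => avg (fun b : T2 => (`[< E (a, b) >])%:R)) :> R.
  rewrite /avg -mulr_suml -mulrA -invfM -natrM card_prod mulnC; congr (_ / _).
  by rewrite pair_big; apply: eq_bigr => -[].
rewrite -[x](@avg_cst R T1) //; apply: avg_le => a.
by apply: le_trans (hx a); rewrite unif_probE.
Qed.

Lemma sum_sqr_le l (a : 'I_l -> R) : (\sum_i a i) ^+ 2 <= l%:R * \sum_i a i ^+ 2.
Proof.
have := dotp_sqr_le (const_mx 1) (\col_i a i).
rewrite dotpE !sqnE.
under eq_bigr => i _ do rewrite !mxE mul1r.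
under [X in _ <= X * _]eq_bigr => i _ do rewrite mxE expr1n.
under [X in _ <= _ * X]eq_bigr => i _ do rewrite mxE.
by rewrite sumr_const card_ord.
Qed.

Lemma sqn_tr_le m n (X : 'M[R]_(m, n)) be : 0 <= be ->
  (forall u, sqn (X^T *m u) <= be * sqn u) -> forall z, sqn (X *m z) <= be * sqn z.
Proof.
move=> be0 h z.
have h1 := dotp_sqr_le z (X^T *m (X *m z)).
rewrite dotp_mulr trmxK dotp_vv in h1.
case: (eqVneq (sqn (X *m z)) 0) => [->|hne]; first by rewrite mulr_ge0 ?sqn_ge0.
have p0 : 0 < sqn (X *m z) by rewrite lt_neqAle eq_sym hne sqn_ge0.
rewrite -(ler_pM2r p0) -expr2; apply: le_trans h1 _.
by rewrite -mulrA mulrCA ler_wpM2l ?sqn_ge0.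
Qed.

Lemma fsq_op_le m n (X : 'M[R]_(m, n)) z : sqn (X *m z) <= fsq X * sqn z.
Proof.
rewrite sqnE /fsq mulr_suml; apply: ler_sum => i _.
have := dotp_sqr_le (row i X)^T z; rewrite dotpE sqnE.
under eq_bigr => j _ do rewrite !mxE.
under [X in _ <= X * _]eq_bigr => j _ do rewrite !mxE.
by rewrite mxE.
Qed.

Lemma fsq_outer m n (x : 'cV[R]_m) (y : 'cV[R]_n) : fsq (x *m y^T) = sqn x * sqn y.
Proof.
rewrite /fsq !sqnE mulr_suml; apply: eq_bigr => i _; rewrite mulr_sumr.
by apply: eq_bigr => j _; rewrite !mxE big_ord1 mxE exprMn.
Qed.

Lemma fsq_vec m n (X : 'M[R]_(m, n)) : sqn ((mxvec X)^T) = fsq X.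
Proof.
rewrite sqnE /fsq pair_big /= (reindex _ (curry_mxvec_bij m n)) /=.
by apply: eq_bigr => -[i j] _ /=; rewrite mxE mxvecE.
Qed.

Lemma expR_Nln (x : R) p : 0 < x -> expR (- (p%:R * ln x)) = x ^- p.
Proof. by move=> x0; rewrite expRN expRM_natl lnK. Qed.

Lemma ln2_ge : 2%:R^-1 <= ln 2%:R :> R.
Proof.
rewrite -ler_expR lnK ?posrE ?ltr0n //; exact: expR_half_le.
Qed.

Lemma dim1_span k : k = 1%N ->
  exists2 u0 : 'cV[R]_k, sqn u0 = 1 & forall u, exists a, u = a *: u0.
Proof.
move=> ->; exists (delta_mx 0 0); first exact: sqn_delta.
by move=> u; exists (u 0 0); apply/colP => i; rewrite !mxE (ord1 i) !eqxx mulr1.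
Qed.

Section Fixed.
Variables (q l : nat) (delta : R).
Let n := (2 ^ q)%N.
Hypothesis ln_ : (l <= n)%N.
Hypothesis l0 : (0 < l)%N.
Hypothesis d01 : 0 < delta < 1.

Let L : R := ln (n%:R / delta).
Let n1 : (1 : R) <= n%:R. Proof. by rewrite ler1n expn_gt0. Qed.
Let n0 : (0 : R) < n%:R. Proof. exact: lt_le_trans n1. Qed.
Let d0 : 0 < delta. Proof. by case/andP: d01. Qed.
Let d1 : delta < 1. Proof. by case/andP: d01. Qed.
Let l0R : (0 : R) < l%:R. Proof. by rewrite ltr0n. Qed.

Let nd0 : 0 < n%:R / delta. Proof. exact: divr_gt0. Qed.

Let L0 : 0 < L.
Proof. by rewrite ln_gt0 // ltr_pdivlMr // mul1r (lt_le_trans d1). Qed.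

(** The exponent 4 survives the union over [n] columns with a surplus [(delta / n)^3], so flatness
    spends only a fraction of [delta]. *)
Lemma row_prob_eq : n%:R * expR (- (4%:R * L)) = delta * (delta / n%:R) ^+ 3.
Proof.
by rewrite (expR_Nln 4 nd0) -exprVn invf_div; field; rewrite gt_eqF.
Qed.

Let cardf : (0 < #|{: inj_space l n}|)%N. Proof. by rewrite card_inj_space ffact_gt0. Qed.

Let cards : (0 < #|{ffun 'I_n -> bool}|)%N.
Proof. by rewrite card_ffun card_bool expn_gt0. Qed.

Section Embedding.
Variables (k : nat) (X : 'M[R]_(k, n)).
Hypothesis k0 : (0 < k)%N.
Hypothesis kl : (k <= l)%N.
Hypothesis XX : X *m X^T = 1%:M.

Let M : R := (Num.sqrt k%:R + Num.sqrt (8%:R * L)) ^+ 2.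
Let La : R := ln (k%:R / delta).
Hypothesis hl : 60%:R * M * La <= l%:R.

Definition embeds (w : srht_space l n) : Prop :=
  forall u, 16%:R^-1 * sqn u <= sqn (srht w *m (X^T *m u)).

Let k1 : (1 : R) <= k%:R. Proof. by rewrite ler1n. Qed.

Lemma coherence_ge1 : 1 <= M.
Proof.
rewrite -[leLHS](expr1n _ 2) lerXn2r ?nnegrE ?addr_ge0 ?sqrtr_ge0 //.
apply: le_trans (_ : Num.sqrt k%:R <= _); last by rewrite lerDl sqrtr_ge0.
by rewrite -[leLHS]sqrtr1 ler_wsqrtr.
Qed.

Let fsqX : fsq X = k%:R.
Proof. by rewrite -fsq_tr fsq_trace trmxK XX mxtrace1. Qed.

Let sqX u : sqn (X^T *m u) = sqn u.
Proof. by rewrite (sqn_mul_gram (c := 1)) ?mul1r // trmxK. Qed.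

Lemma top_rows_prob :
  unif_prob (fun e => exists j, M / n%:R <= sqn (mixed X e j))
    <= delta * (delta / n%:R) ^+ 3.
Proof.
rewrite -row_prob_eq.
have -> : M = rowbound X 1 L by rewrite /rowbound fsqX mulr1.
apply: mixed_tail => //; first by rewrite fsqX (lt_le_trans _ k1).
by move=> u; rewrite sqX mul1r.
Qed.

Let kd0 : 0 < k%:R / delta. Proof. by rewrite divr_gt0 // (lt_le_trans _ k1). Qed.

(** Scaling the flat columns by the square root of [N = n / M] gives vectors of length at most 1
    with covariance [N]. With [p >= N / 3], the factor 60 in [hl] makes the Chernoff exponent at
    least [60/8 La >= 7 La], hence a failure of [2 delta (delta / k)^6]. The assumption
    [delta / k <= 3/4] lets this and the flatness failure fit into [delta]. *)
Let emb_case_spread : delta / k%:R <= 3%:R / 4%:R ->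
  unif_prob (fun w => ~ embeds w) <= delta.
Proof.
move=> hdk; have kp : (0 : R) < k%:R by apply: lt_le_trans k1.
have La_ge : 4%:R^-1 <= La.
  rewrite /La -ler_expR lnK ?posrE //.
  have h := expR_ge1Dx (- 4%:R^-1 : R); rewrite expRN in h.
  have e0 := expR_gt0 (4%:R^-1 : R).
  have h1 : 3%:R / 4%:R <= (expR (4%:R^-1))^-1 :> R by apply: le_trans h; lra.
  have := le_trans hdk h1; rewrite -[delta / _]invf_div lef_pV2 ?posrE //.
pose N : R := n%:R / M.
have M1 := coherence_ge1; have M0 : 0 < M by apply: lt_le_trans M1.
have lnR : l%:R <= n%:R :> R by rewrite ler_nat.
have N15 : 15%:R <= N.
  rewrite ler_pdivlMr //; apply: le_trans lnR; apply: le_trans hl.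
  have : 60%:R * M * 4%:R^-1 <= 60%:R * M * La by rewrite ler_wpM2l // mulr_ge0 // ltW.
  lra.
have N0 : 0 < N by apply: lt_le_trans N15.
(* [N >= 15] guarantees [p >= 2] and, despite the rounding, [p >= N / 3]. *)
pose p := Num.truncn (N / 2%:R).
have /andP[p_le p_gt] : p%:R <= N / 2%:R < p.+1%:R.
  by apply: truncn_itv; rewrite divr_ge0 // ltW.
rewrite -[p.+1%:R]natr1 in p_gt.
have p2 : (2 <= p)%N by rewrite -(ler_nat R); lra.
have Nn : N <= n%:R by rewrite ler_pdivrMr // ler_peMr // ltW.
have pn : (p <= 2 * n)%N.
  rewrite -(ler_nat R); apply: (@le_trans _ _ n%:R); first lra.
  by rewrite ler_nat leq_pmull.
pose small (e : {ffun 'I_n -> bool}) := exists j, M / n%:R <= sqn (mixed X e j).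
apply: le_trans (unif_prob_cond (Bad := small) cardf cards (x := 2%:R * delta * (delta / k%:R) ^+ 6) _ _) _.
- by rewrite !mulr_ge0 ?exprn_ge0 ?divr_ge0 // ltW.
- move=> e hgood.
  pose v j := Num.sqrt N *: mixed X e j.
  have v1 j : sqn (v j) <= 1.
    rewrite sqnZ sqr_sqrtr ?(ltW N0) // /N mulrC -ler_pdivlMr ?divr_gt0 // mul1r invf_div.
    by rewrite leNgt; apply/negP => /ltW h; apply: hgood; exists j.
  have hcov : covmx v finset.setT = N%:M.
    rewrite covE.
    transitivity (N *: \sum_j mixed X e j *m (mixed X e j)^T).
      rewrite scaler_sumr; apply: eq_big => [j|j _]; first by rewrite inE.
      rewrite /v linearZ /= -scalemxAl -scalemxAr scalerA -expr2.
      by rewrite sqr_sqrtr // ltW.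
    by rewrite mixed_gram XX scalemx1.
  have := chernoff_lower v1 hcov N0 p2 ln_ p_le pn.
  rewrite -unif_prob_samp // => hch.
  apply: le_trans (le_trans _ hch) _.
    apply: unif_prob_le => f /existsNP [u /negP]; rewrite -ltNge.
    rewrite srht_sqn //= => hu; exists u.
      apply: contraTneq hu => ->.
      rewrite sqn0 mulr0 -leNgt mulr_ge0 ?divr_ge0 ?sumr_ge0 // => j _.
      exact: sqr_ge0.
    under eq_bigr => j _ do rewrite dotpZl exprMn sqr_sqrtr ?(ltW N0) //.
    rewrite -mulr_sumr [X in _ < X]mulrAC [X in _ < X]mulrC ltr_pM2l //.
    move: hu; rewrite mulrAC ltr_pdivrMr // => hu.
    rewrite invfM !mulrA -(ltr_pM2l n0).
    have -> : n%:R * (l%:R / 16%:R / n%:R * sqn u) = l%:R / 16%:R * sqn u.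
      by field; rewrite gt_eqF.
    apply: lt_le_trans hu _; lra.
  have hexp : 7%:R * La <= 3%:R * (p%:R * (l%:R / n%:R)) / 8%:R.
    have pN : N / 3%:R <= p%:R by lra.
    have : N / 3%:R * (l%:R / n%:R) <= p%:R * (l%:R / n%:R).
      by rewrite ler_wpM2r // divr_ge0 // ltW.
    have -> : N / 3%:R * (l%:R / n%:R) = l%:R / M / 3%:R.
      by rewrite /N; field; rewrite !gt_eqF.
    have : 60%:R * La <= l%:R / M by rewrite ler_pdivlMr // mulrAC.
    have : 0 <= La by apply: le_trans La_ge.
    lra.
  apply: (@le_trans _ _ (2%:R * k%:R * expR (- (7%:R * La)))).
    by rewrite ler_wpM2l ?mulr_ge0 // ler_expR lerN2.
  rewrite (expR_Nln 7 kd0) -exprVn invf_div exprS le_eqVlt; apply/orP; left; apply/eqP.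
  by field; rewrite gt_eqF.
apply: le_trans (lerD top_rows_prob (lexx _)) _.
have kn : k%:R <= n%:R :> R by rewrite ler_nat (leq_trans kl).
have hdn : delta / n%:R <= 3%:R / 4%:R.
  apply: le_trans hdk; rewrite ler_wpM2l ?(ltW d0) // lef_pV2 ?posrE //.
have e1 : (delta / n%:R) ^+ 3 <= (3%:R / 4%:R) ^+ 3.
  by rewrite lerXn2r ?nnegrE ?divr_ge0 // ltW.
have e2 : (delta / k%:R) ^+ 6 <= (3%:R / 4%:R) ^+ 6.
  by rewrite lerXn2r ?nnegrE ?divr_ge0 // ltW.
have : (delta / n%:R) ^+ 3 + 2%:R * (delta / k%:R) ^+ 6 <= 1 by lra.
move=> /(ler_wpM2l (ltW d0)); lra.
Qed.

(* Paley-Zygmund: for [k = 1] and [delta] close to 1 the Chernoff bound is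
   useless, but a fourth moment computation over the signs suffices. *)
Let emb_case_one : k = 1%N -> 3%:R / 4%:R < delta ->
  unif_prob (fun w => ~ embeds w) <= delta.
Proof.
move=> k1' hd.
have [u0 hu0 hspan] := dim1_span k1'.
apply: unif_prob_pair_fst => // f.
pose Z e := sqn (srht (f, e) *m (X^T *m u0)).
pose a (i : 'I_l) e := dotp u0 (mixed X e (val f i)).
have ZE e : Z e = n%:R / l%:R * \sum_i a i e ^+ 2.
  rewrite /Z srht_sqn //; congr (_ * _).
  rewrite -(srht_sum_samp (f, e) (fun j => dotp (mixed X e j) u0 ^+ 2)) /=.
  by apply: eq_bigr => i _; rewrite /a dotpC.
have hm i : avg (fun e => a i e ^+ 2) = n%:R^-1 /\
    avg (fun e => a i e ^+ 4) <= 3%:R * n%:R^-1 ^+ 2.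
  by have := mixed_moments X (val f i) u0; rewrite sqX hu0 mulr1.
have EZ : avg Z = 1.
  rewrite (_ : Z = fun e => n%:R / l%:R * \sum_i a i e ^+ 2); last exact/funext.
  rewrite avgZ avg_sum; under eq_bigr => i _ do rewrite (hm i).1.
  by rewrite sumr_const card_ord -[_ *+ l]mulr_natr; field; rewrite !gt_eqF.
have EZ2 : avg (fun e => Z e ^+ 2) <= 3%:R.
  (* Cauchy-Schwarz over the [l] rows reduces to fourth moments of single rows, so the dependence of
     the rows on common signs does no harm. *)
  apply: (@le_trans _ _ (avg (fun e => (n%:R / l%:R) ^+ 2 * l%:R * \sum_i a i e ^+ 4))).
    apply: avg_le => e; rewrite ZE exprMn -mulrA ler_wpM2l ?sqr_ge0 //.
    apply: le_trans (sum_sqr_le _) _; rewrite le_eqVlt; apply/orP; left; apply/eqP.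
    by congr (_ * _); apply: eq_bigr => i _; rewrite -exprM.
  rewrite avgZ avg_sum.
  apply: (@le_trans _ _ ((n%:R / l%:R) ^+ 2 * l%:R * \sum_(i < l) (3%:R * n%:R^-1 ^+ 2))).
    by rewrite ler_wpM2l ?mulr_ge0 ?sqr_ge0 //; apply: ler_sum => i _; case: (hm i).
  rewrite sumr_const card_ord -[_ *+ l]mulr_natr le_eqVlt; apply/orP; left; apply/eqP.
  by field; rewrite !gt_eqF.
(* The parabola [(Z - 49/16)^2 / 9] equals 1 at [1/16 = 49/16 - 3], so it dominates the indicator of
   [Z < 1/16]. With first moment 1 and second moment at most 3 its mean is below [3/4]. *)
apply: (@le_trans _ _ (avg (fun e =>
    9%:R^-1 * (Z e ^+ 2 + (- (49%:R / 8%:R) * Z e + (49%:R / 16%:R) ^+ 2))))).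
  rewrite unif_probE; apply: avg_le => e.
  have -> : 9%:R^-1 * (Z e ^+ 2 + (- (49%:R / 8%:R) * Z e + (49%:R / 16%:R) ^+ 2)) =
     9%:R^-1 * (Z e - 49%:R / 16%:R) ^+ 2 by field.
  have Z0 : 0 <= Z e by apply: sqn_ge0.
  case: asboolP => /= [|_]; last by rewrite mulr_ge0 ?sqr_ge0.
  move=> /existsNP [u]; have [t ->] := hspan u.
  rewrite -!scalemxAr !sqnZ hu0 mulr1 -/(Z e) mulrC => /negP; rewrite -ltNge => h.
  have t2 : 0 < t ^+ 2.
    by rewrite lt_neqAle sqr_ge0 andbT; apply: contraTneq h => <-; rewrite !mul0r ltxx.
  rewrite ltr_pM2l // in h.
  nra.
rewrite avgZ avgD avgD avgZ EZ avg_cst //.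
apply: le_trans (ltW hd); lra.
Qed.

Lemma embeds_prob : unif_prob (fun w => ~ embeds w) <= delta.
Proof.
case: (leP (delta / k%:R) (3%:R / 4%:R)) => h; first exact: emb_case_spread.
have kp : (0 : R) < k%:R by apply: lt_le_trans k1.
have ke : k = 1%N.
  apply/eqP; rewrite eqn_leq k0 andbT leqNgt; apply/negP => k2.
  have k2R : (2%:R : R) <= k%:R by rewrite ler_nat.
  have d1_ := d1; rewrite ltr_pdivlMr // in h; lra.
apply: emb_case_one => //; by rewrite ke divr1 in h.
Qed.

End Embedding.
End Fixed.
End Events.

(** * Probability of the tail events *)

Section TailEvents.
Context {R : realType}.
Variables (q l r : nat) (delta : R).
Let n := (2 ^ q)%N.
Hypothesis ln_ : (l <= n)%N.
Hypothesis l0 : (0 < l)%N.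
Hypothesis d0 : 0 < delta.
Hypothesis dhalf : delta < 2%:R^-1.
Variable E : 'M[R]_(r, n).

Let L : R := ln (n%:R / delta).
Let n1 : (1 : R) <= n%:R. Proof. by rewrite ler1n expn_gt0. Qed.
Let n0 : (0 : R) < n%:R. Proof. exact: lt_le_trans n1. Qed.
Let l0R : (0 : R) < l%:R. Proof. by rewrite ltr0n. Qed.
Let d01 : 0 < delta < 1. Proof. by rewrite d0 /=; have := dhalf; lra. Qed.

Let L0 : 0 < L.
Proof.
rewrite ln_gt0 // ltr_pdivlMr // mul1r; apply: lt_le_trans n1.
by case/andP: d01.
Qed.

Let cardf : (0 < #|{: inj_space l n}|)%N. Proof. by rewrite card_inj_space ffact_gt0. Qed.

Let cards : (0 < #|{ffun 'I_n -> bool}|)%N.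
Proof. by rewrite card_ffun card_bool expn_gt0. Qed.

Let row_small : delta * (delta / n%:R) ^+ 3 <= delta / 8%:R.
Proof.
have h : delta / n%:R <= 2%:R^-1.
  rewrite ler_pdivrMr //; apply: le_trans (ltW dhalf) _.
  by rewrite ler_peMr // invr_ge0.
rewrite ler_pM2l //; apply: (@le_trans _ _ (2%:R^-1 ^+ 3)); last by lra.
by rewrite lerXn2r ?nnegrE ?divr_ge0 ?invr_ge0 // ltW.
Qed.

Let ln_ge_half t : (0 < t)%N -> 2%:R^-1 <= ln (t%:R / delta).
Proof.
move=> t0; apply: le_trans ln2_ge _; rewrite ler_ln ?posrE ?divr_gt0 ?ltr0n //.
rewrite ler_pdivlMr //; have : (1 : R) <= t%:R by rewrite ler1n.
by have := dhalf; lra.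
Qed.

(** The extra 1 makes [exp (- p)] at most half of [exp (- y)], which leaves room in [delta] for the
    flatness failures. *)
Let round_up (y : R) : 0 <= y -> exists p : nat,
  [/\ (0 < p)%N, y + 1 <= p%:R & p%:R <= y + 2%:R].
Proof.
move=> y0; have /andP[h1 h2] := truncn_itv y0.
rewrite -[_.+1%:R]natr1 in h2.
exists (Num.truncn y).+2; rewrite -[_.+2%:R]natr1 -[_.+1%:R]natr1; split=> //; lra.
Qed.

Let expRN1_le : expR (-1) <= 2%:R^-1 :> R.
Proof.
rewrite expRN lef_pV2 ?posrE ?expR_gt0 //; have := expR_ge1Dx (1 : R); lra.
Qed.

Section Cross.
Variables (k : nat) (X : 'M[R]_(k, n)) (eps : R).
Hypothesis k0 : (0 < k)%N.
Hypothesis XX : X *m X^T = 1%:M.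
Hypothesis EX : E *m X^T = 0.

Let M : R := (Num.sqrt k%:R + Num.sqrt (8%:R * L)) ^+ 2.
Let La : R := ln (k%:R / delta).
Hypothesis e01 : 0 < eps < 6%:R^-1.
Hypothesis hl : 10%:R * M * La <= eps * l%:R.

(** Vectorizing the outer products turns the Frobenius norm into that of a sampled vector sum, whose
    total vanishes because [E X^T = 0]. The columns of [E] are flattened using its Frobenius norm as
    operator bound, which costs no more than the factor [M] of the top directions. *)
Lemma cross_prob :
  unif_prob (fun w : srht_space l n => 16%:R * (11%:R * eps) * fsq E <
     fsq (E *m (srht w)^T *m srht w *m X^T)) <= delta.
Proof.
have [e0 e6] := andP e01.
have [F0|Fne] := eqVneq (fsq E) 0.
  rewrite unif_probE [avg _](_ : _ = 0) ?(ltW d0) // /avg big1 ?mul0r // => w _.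
  case: asboolP => //; rewrite F0 mulr0 ltNge => /negP [].
  rewrite -!mulmxA -fsq_tr trmx_mul.
  apply: le_trans (fsq_mull_le (c := fsq ((srht w)^T *m (srht w *m X^T))^T) _ _) _.
    by move=> v; apply: fsq_op_le.
  by rewrite (fsq_tr E) F0 mulr0.
have F0 : 0 < fsq E by rewrite lt_neqAle eq_sym Fne fsq_ge0.
set F := fsq E in Fne F0 *.
have k1 : (1 : R) <= k%:R by rewrite ler1n.
have M1 : 1 <= M by apply: coherence_ge1.
have M0 : 0 < M by apply: lt_le_trans M1.
have La_half : 2%:R^-1 <= La by apply: ln_ge_half.
have y0 : 0 <= ln (1 / delta) by have := ln_ge_half (ltnSn 0); lra.
have [p [p0 p1 p2]] := round_up y0.
have yLa : ln (1 / delta) <= La.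
  by rewrite ler_ln ?posrE ?divr_gt0 ?ler_wpM2r ?invr_ge0 ?(ltW d0) // (lt_le_trans _ k1).
have pLa : p%:R <= 5%:R * La by lra.
have pp : (0 : R) < p%:R by rewrite ltr0n.
pose badE (e : {ffun 'I_n -> bool}) := exists j, rowbound E F L / n%:R <= sqn (mixed E e j).
pose badX (e : {ffun 'I_n -> bool}) := exists j, M / n%:R <= sqn (mixed X e j).
have hE : unif_prob badE <= delta / 8%:R.
  apply: le_trans row_small; rewrite -row_prob_eq //; apply: mixed_tail => // u.
  by apply: le_trans (fsq_op_le _ _) _; rewrite fsq_tr.
have hX : unif_prob badX <= delta / 8%:R.
  by apply: le_trans row_small; apply: top_rows_prob.
have rbE : rowbound E F L <= F * M.
  rewrite /rowbound -/F [8%:R * L * F]mulrC sqrtrM ?(ltW F0) //.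
  rewrite -[X in X + _]mulr1 -mulrDr exprMn sqr_sqrtr ?(ltW F0) // ler_wpM2l ?(ltW F0) //.
  rewrite lerXn2r ?nnegrE ?addr_ge0 ?sqrtr_ge0 // lerD2r -[leLHS]sqrtr1 ler_wsqrtr //.
apply: le_trans (unif_prob_cond (Bad := fun e => badE e \/ badX e) cardf cards
  (x := delta / 2%:R) _ _) _; last first.
- have h := le_trans (unif_prob_or badE badX) (lerD hE hX).
  by apply: le_trans (lerD h (lexx _)) _; move: d0; lra.
- move=> e hgood.
  have gE j : sqn (mixed E e j) <= F * M / n%:R.
    rewrite leNgt; apply/negP => h; apply: hgood; left; exists j.
    by apply: ltW; apply: le_lt_trans h; rewrite ler_wpM2r ?invr_ge0 ?(ltW n0).
  have gX j : sqn (mixed X e j) <= M / n%:R.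
    by rewrite leNgt; apply/negP => /ltW h; apply: hgood; right; exists j.
  pose x j := (mxvec (mixed E e j *m (mixed X e j)^T))^T.
  have xE j : sqn (x j) = sqn (mixed E e j) * sqn (mixed X e j).
    by rewrite /x fsq_vec fsq_outer.
  have sum0 : \sum_j x j = 0.
    by rewrite /x -!raddf_sum mixed_gram EX !raddf0.
  have xb j : sqn (x j) <= F * M / n%:R * (M / n%:R).
    by rewrite xE ler_pM ?sqn_ge0.
  have xV : \sum_j sqn (x j) <= F * (M / n%:R).
    rewrite /F -(mixed_fsq E e) mulr_suml; apply: ler_sum => j _.
    by rewrite xE ler_wpM2l ?sqn_ge0.
  set b := F * M / n%:R * (M / n%:R) in xb; set V := F * (M / n%:R) in xV.
  have Mn0 : 0 < M / n%:R by apply: divr_gt0.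
  have b0 : 0 < b by apply: mulr_gt0 => //; apply: divr_gt0 => //; apply: mulr_gt0.
  have V0 : 0 < V by apply: mulr_gt0.
  (* The sum of the two lower bounds that [bernstein] puts on its offset. *)
  pose h := 9%:R * p%:R ^+ 2 * b + 20%:R * p%:R * V * l%:R / n%:R.
  have t1 : 0 < 9%:R * p%:R ^+ 2 * b.
    by apply: mulr_gt0 => //; apply: mulr_gt0 => //; apply: exprn_gt0.
  have t2 : 0 < 20%:R * p%:R * V * l%:R / n%:R.
    by apply: divr_gt0 => //; do 3?apply: mulr_gt0 => //.
  have h0 : 0 < h by rewrite addr_gt0.
  have := @bernstein R n _ x b V h p sum0 xb xV p0 h0 _ l ln_ _.
  move=> /(_ _ _) hb.
  have {}hb := hb ltac:(by rewrite lerDl ltW) ltac:(by rewrite lerDr ltW).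
  rewrite -unif_prob_samp // in hb.
  apply: le_trans (le_trans _ hb) _.
    apply: unif_prob_le => f; rewrite srht_cross /= => hf.
    have -> : \sum_(j in samp f) x j = (mxvec (\sum_(j in samp f) mixed E e j *m (mixed X e j)^T))^T.
      by rewrite !raddf_sum.
    rewrite fsq_vec.
    move: hf; set S := \sum_(_ in _) _.
    have -> : fsq ((n%:R / l%:R) *: S) = (n%:R / l%:R) ^+ 2 * fsq S.
      by rewrite -!fsq_vec !linearZ /= sqnZ.
    move=> /ltW hf.
    have nl2 : 0 < (n%:R / l%:R : R) ^+ 2 by rewrite exprn_gt0 // divr_gt0.
    rewrite -(ler_pM2l nl2); apply: le_trans hf.
    have -> : (n%:R / l%:R) ^+ 2 * (16%:R * h) =
       16%:R * F * (9%:R * (p%:R * M / l%:R) ^+ 2 + 20%:R * (p%:R * M / l%:R)).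
      by rewrite /h /b /V; field; rewrite !gt_eqF.
    (* [p <= 5 La] and [hle] give [z <= eps / 2]; since [eps < 1/6], [9 z^2 + 20 z] is then below
       [11 eps]. *)
    set z := p%:R * M / l%:R.
    have z0 : 0 <= z by rewrite divr_ge0 ?mulr_ge0 ?(ltW pp) ?(ltW M0) ?(ltW l0R).
    have zle : z <= eps / 2%:R.
      rewrite ler_pdivrMr //.
      apply: (@le_trans _ _ (5%:R * La * M)); first by rewrite ler_wpM2r // ltW.
      have -> : 5%:R * La * M = 10%:R * M * La / 2%:R by field.
      by rewrite [leRHS]mulrAC ler_wpM2r.
    have z2 : z ^+ 2 <= eps / 2%:R * z by rewrite expr2 ler_wpM2r.
    rewrite [leRHS]mulrAC.
    rewrite ler_wpM2l ?mulr_ge0 ?(ltW F0) //; nra.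
  apply: (@le_trans _ _ (expR (- (ln (1 / delta) + 1)))); first by rewrite ler_expR lerN2.
  rewrite opprD expRD; have -> : expR (- ln (1 / delta)) = delta.
    by rewrite expRN lnK ?posrE ?divr_gt0 // div1r invrK.
  by rewrite ler_wpM2l // ltW.
by rewrite divr_ge0 // ltW.
Qed.

End Cross.

(** The column bound [G] mixes [F] with [L s2]; the hypothesis on [L * ln (r / delta)] absorbs the
    second part into a multiple of [s2]. The constants arise as [88 = 8 + 5 * 16] and [10 = 5 * 2].
    The dimension factor is the number [r] of rows of [E], later the rank. *)
Lemma op_prob s2 : 0 <= s2 -> (forall u, sqn (E^T *m u) <= s2 * sqn u) ->
  L * ln (r%:R / delta) <= l%:R -> (2 * l <= n)%N ->
  unif_prob (fun w : srht_space l n => exists z,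
    15%:R * (88%:R * s2 + 10%:R * (ln (r%:R / delta) / l%:R) * fsq E) * sqn z <
     sqn (E *m (srht w)^T *m z)) <= delta.
Proof.
move=> s20 hs2 hl ln2.
set La := ln _ in hl *.
have [F0|Fne] := eqVneq (fsq E) 0.
  rewrite unif_probE [avg _](_ : _ = 0) ?(ltW d0) // /avg big1 ?mul0r // => w _.
  case: asboolP => // -[z]; rewrite ltNge => /negP [].
  rewrite F0 mulr0 addr0 -mulmxA; apply: le_trans (fsq_op_le _ _) _.
  rewrite F0 mul0r; apply: mulr_ge0; last exact: sqn_ge0.
  by apply: mulr_ge0 => //; apply: mulr_ge0.
have F0 : 0 < fsq E by rewrite lt_neqAle eq_sym Fne fsq_ge0.
set F := fsq E in Fne F0 *.
have s2p : 0 < s2.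
  rewrite lt_neqAle s20 andbT; apply: contraTneq F0 => s2E.
  rewrite -leNgt /F -fsq_tr -[E^T]mulmx1.
  by apply: le_trans (fsq_mull_le _ hs2) _; rewrite -s2E mul0r.
have r0 : (0 < r)%N.
  rewrite lt0n; apply: contraTneq F0 => rE.
  rewrite -leNgt /F /fsq big1 // => i _; have := ltn_ord i; lia.
have La_half : 2%:R^-1 <= La by apply: ln_ge_half.
pose G := rowbound E s2 L.
have G0 : 0 < G.
  by rewrite /G /rowbound exprn_gt0 // ltr_wpDr ?sqrtr_ge0 // sqrtr_gt0.
have Gle : G <= 2%:R * F + 16%:R * L * s2.
  rewrite /G /rowbound -/F.
  have e1 : Num.sqrt F ^+ 2 = F by rewrite sqr_sqrtr // ltW.
  have e2 : Num.sqrt (8%:R * L * s2) ^+ 2 = 8%:R * L * s2.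
    by rewrite sqr_sqrtr // !mulr_ge0 // ltW.
  have := sqr_ge0 (Num.sqrt F - Num.sqrt (8%:R * L * s2)).
  move: e1 e2; set x := Num.sqrt F; set y := Num.sqrt _ => e1 e2; nra.
(* [p] has to exceed the mean level [8 T l / n], which is [8 s2 l / G], and also [La], which pays
   for the dimension factor [r]. *)
have y0 : 0 <= 8%:R * s2 * l%:R / G + La.
  rewrite addr_ge0 ?divr_ge0 ?mulr_ge0 ?(ltW G0) ?(ltW l0R) //; lra.
have [p [p0 p1 p2]] := round_up y0.
have tG : 0 <= 8%:R * s2 * l%:R / G.
  by rewrite divr_ge0 ?mulr_ge0 ?(ltW G0) ?(ltW l0R).
pose T := n%:R * s2 / G.
have nG : 0 < n%:R / G by rewrite divr_gt0.
pose bad (e : {ffun 'I_n -> bool}) := exists j, G / n%:R <= sqn (mixed E e j).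
have hbad : unif_prob bad <= delta / 8%:R.
  by apply: le_trans row_small; rewrite -row_prob_eq //; apply: mixed_tail.
apply: le_trans (unif_prob_cond (Bad := bad) cardf cards (x := delta / 2%:R) _ _) _; last first.
- by apply: le_trans (lerD hbad (lexx _)) _; move: d0; lra.
- move=> e hgood.
  pose v j := Num.sqrt (n%:R / G) *: mixed E e j.
  have v1 j : sqn (v j) <= 1.
    rewrite sqnZ sqr_sqrtr ?(ltW nG) // mulrC -ler_pdivlMr // mul1r invf_div.
    by rewrite leNgt; apply/negP => /ltW h; apply: hgood; exists j.
  have dv u j : dotp (v j) u ^+ 2 = n%:R / G * dotp (mixed E e j) u ^+ 2.
    by rewrite dotpZl exprMn sqr_sqrtr // ltW.
  have hT u : \sum_j dotp (v j) u ^+ 2 <= T * sqn u.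
    under eq_bigr => j _ do rewrite dv.
    have -> : T * sqn u = n%:R / G * (s2 * sqn u) by rewrite /T; ring.
    by rewrite -mulr_sumr mixed_qf ler_wpM2l ?(ltW nG).
  have T0 : 0 <= T by rewrite divr_ge0 ?mulr_ge0 ?(ltW n0) ?(ltW G0).
  have hp : 8%:R * T * l%:R / n%:R <= p%:R.
    have -> : 8%:R * T * l%:R / n%:R = 8%:R * s2 * l%:R / G.
      by rewrite /T; field; rewrite !gt_eqF.
    lra.
  have := chernoff_upper v1 hT T0 p0 ln2 hp.
  rewrite -unif_prob_samp // => hch.
  apply: le_trans (le_trans _ hch) _.
    apply: unif_prob_le => f hf; apply: contrapT => hno.
    case: hf => z; apply/negP; rewrite -leNgt.
    set B0' := _ + _; set B := 15%:R * B0'; have B0 : 0 <= B.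
      apply: mulr_ge0 => //.
      by rewrite addr_ge0 ?mulr_ge0 ?divr_ge0 ?(ltW l0R) ?(ltW F0) //; lra.
    apply: sqn_tr_le => // u; rewrite trmx_mul trmxK -mulmxA srht_sqn //=.
    case: (eqVneq u 0) => [->|u0].
      rewrite sqn0 mulr0 big1 ?mulr0 // => j _.
      by rewrite /dotp mulmx0 mxE expr0n.
    have hu : \sum_(j in samp f) dotp (v j) u ^+ 2 <= 15%:R * p%:R * sqn u.
      by rewrite leNgt; apply/negP => h; apply: hno; exists u.
    set S := \sum_(j in samp f) dotp (mixed E e j) u ^+ 2.
    have hS : \sum_(j in samp f) dotp (v j) u ^+ 2 = n%:R / G * S.
      by rewrite mulr_sumr; apply: eq_bigr => j _; apply: dv.
    have {}hu : S <= G / n%:R * (15%:R * p%:R * sqn u).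
      by rewrite -[G / n%:R]invf_div ler_pdivlMl // -hS.
    apply: le_trans (ler_wpM2l _ hu) _; first by rewrite divr_ge0 ?(ltW n0) ?(ltW l0R).
    have -> : n%:R / l%:R * (G / n%:R * (15%:R * p%:R * sqn u)) =
        15%:R * (p%:R * G / l%:R) * sqn u.
      by field; rewrite !gt_eqF.
    rewrite ler_wpM2r ?sqn_ge0 //.
    have h1 : p%:R * G / l%:R <= (8%:R * s2 * l%:R / G + 5%:R * La) * G / l%:R.
      by rewrite ler_wpM2r ?invr_ge0 ?(ltW l0R) // ler_wpM2r ?(ltW G0) //; lra.
    have e1 : (8%:R * s2 * l%:R / G + 5%:R * La) * G / l%:R =
        8%:R * s2 + 5%:R * (La / l%:R) * G by field; rewrite !gt_eqF.
    have Lal : 0 <= La / l%:R by rewrite divr_ge0 ?(ltW l0R) //; lra.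
    have h2 : La / l%:R * G <= La / l%:R * (2%:R * F + 16%:R * L * s2) by rewrite ler_wpM2l.
    have h3 : La / l%:R * L <= 1 by rewrite mulrAC ler_pdivrMr // mul1r mulrC.
    have h4 : La / l%:R * L * s2 <= 1 * s2 by rewrite ler_wpM2r.
    rewrite /B /B0'; lra.
  apply: (@le_trans _ _ (r%:R * expR (- (La + 1)))).
    by rewrite ler_wpM2l // ler_expR lerN2; lra.
  rewrite opprD expRD /La expRN lnK ?posrE ?divr_gt0 ?ltr0n // invf_div mulrA.
  have -> : r%:R * (delta / r%:R) = delta by field; rewrite gt_eqF ?ltr0n.
  by rewrite ler_wpM2l // ltW.
by rewrite divr_ge0 // ltW.
Qed.

End TailEvents.

(** * From the good events to the four bounds *)

Lemma emb_structure (R : realType) q l m k (A : 'M[R]_(m, 2 ^ q)) (w : srht_space l (2 ^ q)) :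
  embeds (top_vecs k A)^T w ->
  exists Wd : 'M[R]_(l, k),
  [/\ (top_vecs k A)^T *m (srht w)^T *m Wd = 1%:M,
      forall z, sqn (Wd *m z) <= 16%:R * sqn z &
      forall p (E : 'M[R]_(p, 2 ^ q)), fsq (E *m (srht w)^T *m Wd)
        <= 16%:R ^+ 2 * fsq (E *m (srht w)^T *m srht w *m top_vecs k A)].
Proof.
move=> hemb; have c0 : 0 < 16%:R^-1 :> R by rewrite invr_gt0.
have [|Wd [h1 h2 h3]] :=
    @emb_right_inverse R _ _ _ (top_vecs k A) (srht w)^T 16%:R^-1 c0.
  by move=> u; have := hemb u; rewrite !trmxK.
exists Wd; split=> // [z|p E]; first by have := h2 z; rewrite invrK.
by have := h3 p E; rewrite trmxK exprVn invrK.
Qed.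

Lemma tail_index m n k j : (1 <= j <= minn m n - k)%N ->
  [/\ (k + (j - 1) <= n)%N, (k + j - 1 = k + (j - 1))%N, j.-1 = (j - 1)%N
    & (k + j).-1 = (k + (j - 1))%N].
Proof. by move=> h; split; lia. Qed.

(** The first requirement serves (i), the next two (ii), the last (iv). The existential form keeps
    [C] a variable in the main proof. *)
Lemma exists_constant (R : realType) : exists C : R,
  [/\ 0 < C, 16%:R ^+ 2 * (16%:R * 11%:R) <= C,
      2%:R + 2%:R * (15%:R * 88%:R * 16%:R) <= C,
      2%:R * (15%:R * 10%:R * 16%:R) <= C & 4%:R <= C].
Proof. by exists (10%:R ^+ 5); split; lra. Qed.

Theorem corollary5p17 (R : realType) :
  exists c C : R, 0 < c /\ 0 < C /\
  forall (m q k l rho : nat), let n := (2 ^ q)%N in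
  forall (hm : (l <= m)%N) (hn : (l <= n)%N)
    (A : 'M[R]_(m, n)) (eps delta : R),
  \rank A = rho ->
  0 < eps < 6%:R^-1 -> 0 < delta < 1 ->
  (0 < k)%N -> (k <= l)%N ->
  10%:R * eps^-1
    * (Num.sqrt k%:R + Num.sqrt (8%:R * ln (n%:R / delta))) ^+ 2
    * ln (k%:R / delta) <= l%:R ->
  ln (n%:R / delta) * ln (rho%:R / delta) <= l%:R ->
  [/\ forall j : nat, (1 <= j <= minn m n - k)%N ->
        1 - 2%:R * delta <=
        prob_srht_tr (fun V1 => forall Q T, rand_qr hn A V1 Q T ->
          let R22 := trail_block l T in
          fnorm (R22 - trunc_svd R22 (j - 1)) ^+ 2
            <= (1 + C * eps) * fnorm (A - trunc_svd A (k + j - 1)) ^+ 2),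
      forall j : nat, (1 <= j <= minn m n - k)%N ->
        1 - 3%:R * delta <=
        prob_srht_tr (fun V1 => forall Q T, rand_qr hn A V1 Q T ->
          let R22 := trail_block l T in
          singval R22 j ^+ 2
            <= C * singval A (k + j) ^+ 2
               + C * (ln (rho%:R / delta) / l%:R)
                 * fnorm (A - trunc_svd A (k + j - 1)) ^+ 2),
      1 - 2%:R * Num.max delta (expR (- (k%:R / 5%:R))) <=
        prob_srht_tr (fun V1 => forall Q T, rand_qr hn A V1 Q T ->
          let Q1 := lead_cols hm Q in
          forall j : nat, (1 <= j <= k)%N ->
          c * Num.sqrt (k%:R / n%:R) * singval A j
            <= singval (Q1 *m Q1^T *m A) j <= singval A j)
    & 1 - delta <=
        prob_srht_tr (fun V1 => forall Q T, rand_qr hn A V1 Q T ->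
          let Q1 := lead_cols hm Q in
          forall j : nat, (1 <= j <= k)%N -> singval A j != 0 ->
          singval A j
              / (1 + C * Num.sqrt (n%:R / k%:R) * (singval A k.+1 / singval A j))
            <= singval (Q1 *m Q1^T *m A) j <= singval A j)].
Proof.
have [C [Cp C1 C2 C3 C4]] := exists_constant R.
exists 5%:R^-1, C; split; first by rewrite invr_gt0.
split=> //.
move=> m q k l rho n hm hn A eps delta hrho heps hdelta k0 kl hl hl2.
have [d0 d1] := andP hdelta; have [e0 e6] := andP heps.
have l0 : (0 < l)%N by apply: leq_trans kl.
have kn : (k <= n)%N by apply: leq_trans hn.
have n1 : (1 : R) <= n%:R by rewrite ler1n expn_gt0.
have n0 : (0 : R) < n%:R by apply: lt_le_trans n1.
have k0R : (0 : R) < k%:R by rewrite ltr0n.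
have l0R : (0 : R) < l%:R by rewrite ltr0n.
have C0 : 0 <= C by apply: ltW.
set M := (_ + _) ^+ 2 in hl; set La := ln (k%:R / delta) in hl.
have M1 : 1 <= M by apply: coherence_ge1.
have k1 : (1 : R) <= k%:R by rewrite ler1n.
have La0 : 0 <= La.
  by rewrite ln_ge0 // ler_pdivlMr // mul1r ltW // (lt_le_trans d1).
have ML0 : 0 <= M * La by rewrite mulr_ge0 // (le_trans _ M1).
have hle : 10%:R * M * La <= eps * l%:R.
  rewrite [leRHS]mulrC -ler_pdivrMr //; apply: le_trans hl.
  by rewrite le_eqVlt; apply/orP; left; apply/eqP; field; rewrite gt_eqF.
have hl60 : 60%:R * M * La <= l%:R.
  have h : eps * l%:R <= 6%:R^-1 * l%:R by rewrite ler_wpM2r // ltW.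
  have : 60%:R * M * La = 6%:R * (10%:R * M * La) by ring.
  move: (le_trans hle h); move: (10%:R * M * La) => x ? ->; lra.
pose X := (top_vecs k A)^T.
have XX : X *m X^T = 1%:M by rewrite /X trmxK; apply: top_gram.
have hemb := embeds_prob hn l0 hdelta k0 kl XX hl60.
have cardT : (0 < #|{: srht_space l n}|)%N.
  rewrite card_prod muln_gt0 (card_inj_space l n) ffact_gt0 hn.
  by rewrite card_ffun card_bool expn_gt0.
(* For rank 0 the logarithm has a default value, but the tail then has no rows and the product is
   zero. *)
have Lr0 d : 0 <= ln (rho%:R / delta) / l%:R * fsq (tail_mx rho d A).
  case: (posnP rho) => hr.
    rewrite [fsq _](_ : _ = 0) ?mulr0 // /fsq big1 // => i _.
    by have := leq_trans (ltn_ord i) (eq_leq hr).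
  rewrite mulr_ge0 ?fsq_ge0 // divr_ge0 // ln_ge0 // ler_pdivlMr // mul1r.
  by rewrite ltW // (lt_le_trans d1) // ler1n.
(* The common source of (iii) and (iv): [4] is the square root of the 16 in the bound on [Wd], and
   [n / l <= n / k]. *)
have hlead (w : srht_space l n) : embeds X w -> forall Q T, rand_qr hn A (srht w)^T Q T ->
    forall j, (1 <= j <= k)%N -> singval A j != 0 ->
    singval A j <= singval (lead_cols hm Q *m (lead_cols hm Q)^T *m A) j *
      (1 + 4%:R * Num.sqrt (n%:R / k%:R) * (singval A k.+1 / singval A j)).
  move=> hw Q T hqr j /andP[j1 jk] sj.
  have [Wd [hWd hc _]] := emb_structure hw.
  have jk' : (j.-1 < k)%N by rewrite prednK.
  have sj0 : 0 < singval A j by rewrite lt_neqAle eq_sym sj (svd_ge0 _ (svdP A)).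
  have hV1 (z : 'cV[R]_l) : sqn ((srht w)^T *m z) <= n%:R / l%:R * sqn z by rewrite srht_tr_sqn.
  have := lead_sv_ge hm kn hqr jk' sj0 (divr_ge0 (ltW n0) (ltW l0R)) (ler0n _ _) hWd hV1 hc.
  move=> /le_trans; apply; apply: ler_wpM2l; first exact: svd_ge0 (svdP _).
  rewrite lerD2l ler_wpM2r ?divr_ge0 ?(ltW sj0) ?(svd_ge0 _ (svdP A)) //.
  have e16 : 16%:R = 4%:R ^+ 2 :> R by lra.
  rewrite mulrC e16 sqrtrM ?sqr_ge0 // sqrtr_sqr ger0_norm // ler_wpM2l //.
  rewrite ler_wsqrtr // ler_wpM2l ?(ltW n0) // lef_pV2 ?posrE // ler_nat //.
split.
- move=> j /tail_index [hkd rE j1E kjE].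
  set P := prob_srht_tr _; have P0 : 0 <= P by apply: unif_prob_ge0.
  (* For [delta >= 1/2] the claimed lower bound on the probability is not positive. *)
  case: (leP 2%:R^-1 delta) => hd; first lra.
  set r := (k + (j - 1))%N in hkd rE kjE.
  pose E := tail_mx rho r A.
  have EX : E *m X^T = 0 by rewrite trmxK; apply: tail_top; apply: leq_addr.
  have hcross := cross_prob hn l0 d0 hd k0 XX EX heps hle.
  apply: (unif_prob_not (Bad := fun w => ~ embeds X w \/
      16%:R * (11%:R * eps) * fsq E < fsq (E *m (srht w)^T *m srht w *m X^T))) => //.
  + move=> w /not_orP [/contrapT hw /negP]; rewrite -leNgt => hc Q T hqr /=.
    have [Wd [hWd _ hf]] := emb_structure hw.
    rewrite !fnorm_sqr rE -(tail_fsq hrho r).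
    apply: le_trans (R22_fsq_le hm hrho hkd hqr hWd) _.
    rewrite mulrDl mul1r lerD2l; apply: le_trans (hf _ _) _.
    rewrite trmxK in hc; apply: le_trans (ler_wpM2l (sqr_ge0 _) hc) _.
    have -> : 16%:R ^+ 2 * (16%:R * (11%:R * eps) * fsq E) =
       16%:R ^+ 2 * (16%:R * 11%:R) * (eps * fsq E) by ring.
    by rewrite -[C * eps * _]mulrA ler_wpM2r // mulr_ge0 ?fsq_ge0 // ltW.
  + apply: le_trans (unif_prob_or _ _) _.
    by apply: le_trans (lerD hemb hcross) _; lra.
- move=> j /tail_index [hkd rE j1E kjE].
  set P := prob_srht_tr _; have P0 : 0 <= P by apply: unif_prob_ge0.
  case: (leP 2%:R^-1 delta) => hd; first lra.
  set r := (k + (j - 1))%N in hkd rE kjE.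
  pose E := tail_mx rho r A.
  pose s2 := (svd A).1.2 r ^+ 2.
  have s20 : 0 <= s2 by apply: sqr_ge0.
  have hE z : sqn (E *m z) <= s2 * sqn z by apply: tail_sqn_le.
  have hET u : sqn (E^T *m u) <= s2 * sqn u by apply: sqn_tr_le => // z; rewrite trmxK.
  set La' := ln (rho%:R / delta) in hl2 Lr0 *.
  pose B := 15%:R * (88%:R * s2 + 10%:R * (La' / l%:R) * fsq E).
  have LF0 := Lr0 r; rewrite -/E in LF0.
  have B0 : 0 <= B.
    apply: mulr_ge0 => //; apply: addr_ge0; first exact: mulr_ge0.
    by rewrite -mulrA; apply: mulr_ge0.
  have hop : unif_prob (fun w : srht_space l n =>
      exists z, B * sqn z < sqn (E *m (srht w)^T *m z)) <= delta.
    (* If more than half of the rows are kept, [|V1 z|^2 = (n / l) |z|^2 <= 2 |z|^2] bounds the term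
       for every outcome. *)
    case: (leqP (2 * l) n) => h2l; first exact: op_prob.
    rewrite unif_probE [avg _](_ : _ = 0) ?(ltW d0) // /avg big1 ?mul0r // => w _.
    case: asboolP => // -[z]; rewrite ltNge => /negP [].
    rewrite -mulmxA; apply: le_trans (hE _) _.
    rewrite srht_tr_sqn // mulrA ler_wpM2r ?sqn_ge0 //.
    have hnl : n%:R / l%:R <= 2%:R :> R.
      by rewrite ler_pdivrMr // -natrM ler_nat ltnW.
    apply: le_trans (ler_wpM2l s20 hnl) _; rewrite /B.
    move: LF0; rewrite -[10%:R * _ * _]mulrA; move: (La' / l%:R * fsq E) => x; lra.
  apply: (unif_prob_not (Bad := fun w => ~ embeds X w \/
      exists z, B * sqn z < sqn (E *m (srht w)^T *m z))) => //.
  + move=> w /not_orP [/contrapT hw hno] Q T hqr /=.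
    have [Wd [hWd hc _]] := emb_structure hw.
    have hb z : sqn (E *m (srht w)^T *m z) <= B * sqn z.
      by rewrite leNgt; apply/negP => h; apply: hno; exists z.
    rewrite fnorm_sqr rE -(tail_fsq hrho r) -/E /singval j1E kjE.
    apply: le_trans (R22_sv_le hm hrho hkd hqr hWd B0 (ler0n _ _) hc hb) _.
    rewrite -/r -/s2 /B; move: LF0; rewrite -[10%:R * _ * _]mulrA -[C * _ * fsq E]mulrA.
    move: (La' / l%:R * fsq E) => x x0.
    have h1 := ler_wpM2r s20 C2; have h2 := ler_wpM2r x0 C3; lra.
  + apply: le_trans (unif_prob_or _ _) _.
    by apply: le_trans (lerD hemb hop) _; lra.
- apply: (unif_prob_not (Bad := fun w => ~ embeds X w)) => //; last first.
    apply: le_trans hemb _; have : delta <= Num.max delta (expR (- (k%:R / 5%:R))).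
      by rewrite le_max lexx.
    lra.
  move=> w /contrapT hw Q T hqr /= j /andP[j1 jk].
  rewrite (lead_sv_le hm hqr) andbT.
  have s'0 : 0 <= singval (lead_cols hm Q *m (lead_cols hm Q)^T *m A) j.
    exact: svd_ge0 (svdP _).
  have [->|sj] := eqVneq (singval A j) 0; first by rewrite mulr0.
  have sj0 : 0 < singval A j by rewrite lt_neqAle eq_sym sj (svd_ge0 _ (svdP A)).
  have := hlead w hw Q T hqr j; rewrite j1 jk => /(_ erefl sj).
  set s' := singval (_ *m A) j in s'0 *.
  have sk : singval A k.+1 / singval A j <= 1.
    by rewrite ler_pdivrMr // mul1r (svd_mono (svdP A)) //= -ltnS prednK // ltnW.
  have nk1 : 1 <= Num.sqrt (n%:R / k%:R) :> R.
    by rewrite -[leLHS]sqrtr1 ler_wsqrtr // ler_pdivlMr // mul1r ler_nat.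
  set g := Num.sqrt (n%:R / k%:R) in nk1 *.
  have g0 : 0 < g by apply: lt_le_trans nk1.
  have -> : Num.sqrt (k%:R / n%:R) = g^-1 :> R.
    by rewrite /g -invf_div sqrtrV // divr_ge0 // ltW.
  (* [sigma_{k+1} <= sigma_j] and [g >= 1] turn [1 + 4 g] into [5 g], whence [c = 1/5]. *)
  move=> h; have h5 : singval A j <= s' * (5%:R * g).
    apply: le_trans h _; rewrite ler_wpM2l //.
    have : 4%:R * g * (singval A k.+1 / singval A j) <= 4%:R * g * 1.
      by rewrite ler_wpM2l // mulr_ge0 // ltW.
    lra.
  rewrite -invfM mulrC ler_pdivrMr // mulr_gt0 //.
apply: (unif_prob_not (Bad := fun w => ~ embeds X w)) => // w /contrapT hw Q T hqr /=.
move=> j hj sj; rewrite (lead_sv_le hm hqr) andbT.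
have sj0 : 0 < singval A j by rewrite lt_neqAle eq_sym sj (svd_ge0 _ (svdP A)).
have sk0 : 0 <= singval A k.+1 / singval A j.
  by rewrite divr_ge0 ?(ltW sj0) // (svd_ge0 _ (svdP A)).
have g0 : 0 <= Num.sqrt (n%:R / k%:R) :> R by apply: sqrtr_ge0.
rewrite ler_pdivrMr; last by rewrite ltr_pwDl // mulr_ge0 // mulr_ge0.
apply: le_trans (hlead w hw Q T hqr j hj sj) _.
apply: ler_wpM2l; first exact: svd_ge0 (svdP _).
by rewrite lerD2l ler_wpM2r // ler_wpM2r.
Qed.
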